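(* Let $ds^2=\sum_i g_{ii}(R)(dR^i)^2$ be a flat diagonal (pseudo-Riemannian) metric in coordinates $R=(R^1,\dots,R^n)$ with Levi-Civita connection $\nabla$, and consider $N$ commuting diagonal systems of hydrodynamic type $$R^i_{t^\beta}=\upsilon^i_\beta(R)R^i_{t^1},\qquad i=1,\dots,n,\quad \beta=1,\dots,N,\qquad \upsilon^i_1\equiv1,$$ which are Hamiltonian with respect to the local Hamiltonian operator generated by $ds^2$, so that $\upsilon^i_\beta=\nabla^i\nabla_ih_\beta$ (no summation over $i$) for densities $h_\beta(R)$. Let $$d\tilde t^\gamma=\sum_{\beta=1}^N a^\gamma_\beta(R)\,dt^\beta,\qquad \gamma=1,\dots,N,$$ be a generalized reciprocal transformation, where $a^\gamma_1$ are conserved densities of these systems and $a^\gamma_\beta$ the corresponding fluxes, $\partial_{t^\beta}a^\gamma_1=\partial_{t^1}a^\gamma_\beta$, and the matrix $(a^\gamma_\beta)$ is invertible with inverse $(A^\beta_\gamma)$, $dt^\beta=\sum_\gamma A^\beta_\gamma\,d\tilde t^\gamma$. Assume $\sum_\nu A^\nu_1\upsilon^i_\nu\neq0$ for all $i$. Let $$R^i_{\tau^\gamma}=w^i_\gamma(R)R^i_{t^1},\qquad w^i_\gamma=\nabla^i\nabla_ia^\gamma_1\ \ (\text{no summation over } i),\qquad \gamma=1,\dots,N,$$ be the (diagonal) flows generated by the same Hamiltonian operator and the densities $a^\gamma_1$, which commute with the $t^\beta$-flows, and let $c^\gamma_\beta(R)$ be the fluxes of $a_1^\gamma$ along the $\tau^\beta$-flow,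 so that $d\tilde t^\gamma=\sum_\beta a^\gamma_\beta\,dt^\beta+\sum_\beta c^\gamma_\beta\,d\tau^\beta$, normalized by $$c^\beta_\gamma+c^\gamma_\beta=\sum_k g^{kk}\,(\partial_ka^\beta_1)(\partial_ka^\gamma_1).$$ Define $$\tilde\upsilon^i_\beta=\frac{\sum_\gamma A^\gamma_\beta\upsilon^i_\gamma}{\sum_\nu A^\nu_1\upsilon^i_\nu},\qquad \tilde w^i_\gamma=\frac{w^i_\gamma-\sum_{\beta,\varepsilon}c^\beta_\gamma A^\varepsilon_\beta\upsilon^i_\varepsilon}{\sum_\nu A^\nu_1\upsilon^i_\nu},\qquad d\tilde s^2=\sum_i\tilde g_{ii}(dR^i)^2,\quad \tilde g_{ii}=g_{ii}\Big(\sum_\nu A^\nu_1\upsilon^i_\nu\Big)^2 .$$ Then the curvature tensor of the transformed metric $d\tilde s^2$ is $$\tilde R^{ij}_{ij}=\sum_{\beta=1}^N\big(\tilde\upsilon^i_\beta\tilde w^j_\beta+\tilde\upsilon^j_\beta\tilde w^i_\beta\big),\qquad i\neq j,$$ and the metric $d\tilde s^2$ generates the nonlocal Hamiltonian operator (with $\tilde x=\tilde t^1$) $$\tilde J^{ij}=\tilde g^{ii}\delta^{ij}\frac{d}{d\tilde x}-\tilde g^{ii}\tilde\Gamma^j_{ik}R^k_{\tilde x}+\sum_{\beta=1}^N\tilde\upsilon^i_\beta R^i_{\tilde x}\Big(\frac{d}{d\tilde x}\Big)^{-1}\tilde w^j_\beta R^j_{\tilde x}+\sum_{\beta=1}^N\tilde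 w^i_\beta R^i_{\tilde x}\Big(\frac{d}{d\tilde x}\Big)^{-1}\tilde\upsilon^j_\beta R^j_{\tilde x},$$ where $\tilde\Gamma$ denotes the Christoffel symbols of the Levi-Civita connection of $d\tilde s^2$ (summation only over $k$ and $\beta$).
   Context: Everything is local and smooth; $\partial_i=\partial/\partial R^i$, $g^{ii}=1/g_{ii}$, $\nabla^i=g^{ii}\nabla_i$. Local Hamiltonian operator generated by $ds^2$: $J^{ij}=g^{ii}\delta^{ij}\frac{d}{dx}-g^{ii}\Gamma^j_{ik}R^k_x$ with $x=t^1$; the flow with density $f(R)$ is $R^i_s=J^{ij}\partial_jf=(\nabla^i\nabla_jf)R^j_x$. For the densities $h_\beta$ and $a_1^\gamma$ these flows are diagonal, i.e. $\nabla^i\nabla_jf=0$ for $i\ne j$. Conserved densities and fluxes: $\partial_{t^\beta}a^\gamma_1=\partial_{t^1}a^\gamma_\beta$ holds on solutions, i.e. $\partial_ia^\gamma_\beta=\upsilon^i_\beta\,\partial_ia^\gamma_1$ for all $i$ (no summation); similarly $\partial_ic^\gamma_\beta=w^i_\beta\,\partial_ia^\gamma_1$. Diagonal flows $R^i_{t}=\upsilon^iR^i_x$ and $R^i_\tau=w^iR^i_x$ commute if and only if $\partial_j\upsilon^i\,(w^j-w^i)=\partial_jw^i\,(\upsilon^j-\upsilon^i)$ for $i\ne j$. After the transformation the flows read $R^i_{\tilde t^\beta}=\tilde\upsilon^i_\beta R^i_{\tilde t^1}$ and $R^i_{\tau^\gamma}=\tilde w^i_\gamma R^i_{\tilde t^1}$.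 Curvature convention: the sign of $R^{ij}_{kl}$ is such that a metric of constant curvature $c$ has $R^{ij}_{kl}=c(\delta^i_k\delta^j_l-\delta^i_l\delta^j_k)$; thus $R^{ij}_{ij}$ ($i\ne j$, no summation) is the sectional curvature of the $(R^i,R^j)$-coordinate plane. Hamiltonian operator: an operator is Hamiltonian if the bracket $\{F,G\}=\int \frac{\delta F}{\delta R^i}J^{ij}\frac{\delta G}{\delta R^j}\,dx$ is skew-symmetric and satisfies the Jacobi identity; $(d/dx)^{-1}$ is the formal inverse of the total derivative. The following known criterion is used for nonlocal operators $$J^{ij}=g^{ij}\frac{d}{dx}-g^{is}\Gamma^j_{sk}R^k_x+\sum_\alpha\varepsilon^\alpha w^i_{(\alpha)k}R^k_x\Big(\frac{d}{dx}\Big)^{-1}w^j_{(\alpha)s}R^s_x,\qquad \varepsilon^\alpha=\pm1,$$ with $\Gamma$ the Levi-Civita connection of the nondegenerate metric $g$: it is Hamiltonian if and only if $g_{ik}w^k_{(\alpha)j}=g_{jk}w^k_{(\alpha)i}$, $\nabla_kw^i_{(\alpha)j}=\nabla_jw^i_{(\alpha)k}$, $R^{ij}_{kl}=\sum_\alpha\varepsilon^\alpha\big(w^i_{(\alpha)k}w^j_{(\alpha)l}-w^i_{(\alpha)l}w^j_{(\alpha)k}\big)$, and the affinors $w_{(\alpha)}$ pairwise commute. For diagonal $g$ and diagonal affinors $w^i_{(\alpha)j}=w^i_{(\alpha)}\delta^i_j$ this reduces to $\partial_jw^i_{(\alpha)}=(w^j_{(\alpha)}-w^i_{(\alpha)})\,\partial_j\ln\sqrt{g_{ii}}$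 for $i\neq j$, $R^{ij}_{ij}=\sum_\alpha\varepsilon^\alpha w^i_{(\alpha)}w^j_{(\alpha)}$ for $i\ne j$, and the vanishing of the remaining curvature components. A symmetric pair of tail terms $a^iR^i_x(d/dx)^{-1}b^jR^j_x+b^iR^i_x(d/dx)^{-1}a^jR^j_x$ is brought to the diagonal tail form $\sum_\alpha\varepsilon^\alpha w^i_{(\alpha)}R^i_x(d/dx)^{-1}w^j_{(\alpha)}R^j_x$, $\varepsilon^\alpha=\pm1$, by polarization (take $w_{(1)}=(a+b)/\sqrt2$ with $\varepsilon^1=1$ and $w_{(2)}=(a-b)/\sqrt2$ with $\varepsilon^2=-1$), and contributes $a^ib^j+a^jb^i$ to $R^{ij}_{ij}$. *)

(* Defs.v *)
(* Mathematical Components / MathComp-Analysis. *)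
From HB Require Import structures.
From mathcomp Require Import all_boot all_order all_algebra.
From mathcomp Require Import all_classical all_reals all_analysis.

Set Implicit Arguments.
Unset Strict Implicit.
Unset Printing Implicit Defensive.

Import Order.TTheory GRing.Theory Num.Theory.
Import numFieldNormedType.Exports.

Local Open Scope classical_set_scope.
Local Open Scope ring_scope.

Section SmoothFunctions.
Context {R : realType}.

Definition partial (m : nat) (i : 'I_m) (f : 'rV[R]_m -> R) : 'rV[R]_m -> R :=
  fun x => 'D_(delta_mx 0 i) f x.

(* C^oo on D (always an open set below): every iterated partial derivative is
   differentiable at every point of D. *)
Definition smooth_on (m : nat) (D : set 'rV[R]_m) (f : 'rV[R]_m -> R) : Prop :=
  forall (s : seq 'I_m) (x : 'rV[R]_m), D x ->
    differentiable (foldr (@partial m) f s) x.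

End SmoothFunctions.

Section DiagonalMetrics.
Context {R : realType} {n : nat}.
Implicit Types (g : 'I_n -> 'rV[R]_n -> R) (f : 'rV[R]_n -> R).

(* A diagonal metric is given by its diagonal g i = g_ii. *)
Definition metric_coef g (i j : 'I_n) : 'rV[R]_n -> R :=
  fun x => if i == j then g i x else 0.

(* christoffel g k i j = Gamma^k_ij; the inverse metric is g^kl = delta^kl / g_kk. *)
Definition christoffel g (k i j : 'I_n) : 'rV[R]_n -> R := fun x =>
  2^-1 * (g k x)^-1 * (partial i (metric_coef g k j) x
                       + partial j (metric_coef g k i) x
                       - partial k (metric_coef g i j) x).

(* curvature g i j k l = R^ij_kl = g^jj R^i_jkl with
   R^i_jkl = d_k Gamma^i_lj - d_l Gamma^i_kj
             + Gamma^i_km Gamma^m_lj - Gamma^i_lm Gamma^m_kj,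
   so that constant curvature c reads
   R^ij_kl = c (delta^i_k delta^j_l - delta^i_l delta^j_k). *)
Definition curvature g (i j k l : 'I_n) : 'rV[R]_n -> R := fun x =>
  (g j x)^-1 *
  (partial k (christoffel g i l j) x - partial l (christoffel g i k j) x
   + \sum_(m < n) (christoffel g i k m x * christoffel g m l j x
                   - christoffel g i l m x * christoffel g m k j x)).

(* nabla^i nabla_j f *)
Definition hessian g (i j : 'I_n) f : 'rV[R]_n -> R := fun x =>
  (g i x)^-1 *
  (partial i (partial j f) x
   - \sum_(k < n) christoffel g k i j x * partial k f x).

End DiagonalMetrics.

(* A map R -> 'rV_n stands for a curve x |-> (R^1(x), ..., R^n(x)), for a
   variation of such a curve, or for a covector field along it. *)
Section Functionals.
Context {R : realType} {n : nat}.
Implicit Types (c xi X : R -> 'rV[R]_n) (U : set 'rV[R]_n).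

Definition smooth_curve c : Prop :=
  forall (k : nat) (x : R), derivable (derive1n k c) x 1.

Definition curve_in U c : Prop := smooth_curve c /\ forall x, U (c x).

Definition smooth_family (p : nat) (Phi : 'rV[R]_p -> R -> 'rV[R]_n) : Prop :=
  forall i : 'I_n, smooth_on setT
    (fun z : 'rV[R]_(p + 1) => Phi (lsubmx z) (rsubmx z 0 0) 0 i).

Definition pairing xi X : R :=
  \int[lebesgue_measure]_(x in setT) \sum_(i < n) xi x 0 i * X x 0 i.

(* kappa is delta K / delta R at the curve c. *)
Definition variational_derivative (K : (R -> 'rV[R]_n) -> R) c
    (kappa : R -> 'rV[R]_n) : Prop :=
  [/\ smooth_curve kappa,
      exists M : R, forall x, M < `|x| -> kappa x = 0 &
      forall phi, smooth_curve phi ->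
        is_derive (0 : R) 1 (fun e : R => K (fun x => c x + e *: phi x))
          (pairing kappa phi)].

(* Smooth functionals of curves in U. Each depends only on the restriction of
   the curve to a bounded window [-M, M], so that integrations by parts
   produce no boundary terms. The local functionals
   \int f(x, R, R_x, ..., R^(k)) dx with f smooth and vanishing for
   M <= `|x| are instances, with fgrad given by the Euler operator. *)
Record functional U := Functional {
  fval :> (R -> 'rV[R]_n) -> R;
  fgrad : (R -> 'rV[R]_n) -> R -> 'rV[R]_n;
  fwindow : R;
  fgrad_window : forall c x, fwindow < `|x| -> fgrad c x = 0;
  fgrad_smooth :
    forall (p : nat) (Phi : 'rV[R]_p -> R -> 'rV[R]_n), smooth_family Phi ->
    forall i : 'I_n, smooth_on
      [set z : 'rV[R]_(p + 1) |
         forall x, `|x| <= fwindow -> U (Phi (lsubmx z) x)]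
      (fun z => fgrad (Phi (lsubmx z)) (rsubmx z 0 0) 0 i);
  fgradP : forall c, smooth_curve c ->
    (forall x, `|x| <= fwindow -> U (c x)) ->
    variational_derivative fval c (fgrad c) }.

(* An operator J assigns to a curve c and a covector field xi along c the
   vector field J c xi along c. *)
Definition bracket U
    (J : (R -> 'rV[R]_n) -> (R -> 'rV[R]_n) -> R -> 'rV[R]_n)
    (F G : functional U) : (R -> 'rV[R]_n) -> R :=
  fun c => pairing (fgrad F c) (J c (fgrad G c)).

(* {F,G} is in general a nonlocal functional; the Jacobi identity includes the
   existence of its variational derivative, with which the outer brackets
   {{F,G},H} = \int (delta {F,G} / delta R^i) J^ij (delta H / delta R^j) dx
   are formed. *)
Definition hamiltonian U
    (J : (R -> 'rV[R]_n) -> (R -> 'rV[R]_n) -> R -> 'rV[R]_n) : Prop :=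
  (forall (F G : functional U) c, curve_in U c ->
     bracket J F G c = - bracket J G F c) /\
  (forall (F G H : functional U) c, curve_in U c ->
     exists kFG kGH kHF : R -> 'rV[R]_n,
       [/\ variational_derivative (bracket J F G) c kFG,
           variational_derivative (bracket J G H) c kGH,
           variational_derivative (bracket J H F) c kHF &
           pairing kFG (J c (fgrad H c)) + pairing kGH (J c (fgrad F c))
           + pairing kHF (J c (fgrad G c)) = 0]).

(* The formal inverse of d/dx. On smooth compactly supported functions this is
   the only right inverse of d/dx that is skew-adjoint, as skew-symmetry of the
   bracket requires. *)
Definition Dinv (u : R -> R) : R -> R := fun x =>
  2^-1 * (\int[lebesgue_measure]_(y in `]-oo, x]) u y
          - \int[lebesgue_measure]_(y in `[x, +oo[) u y).

(* g^ii delta^ij d/dx - g^ii Gamma^j_ik R^k_x *)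
Definition local_op (g : 'I_n -> 'rV[R]_n -> R) c xi : R -> 'rV[R]_n := fun x =>
  \row_(i < n)
    ((g i (c x))^-1 * derive1 xi x 0 i
     - \sum_(j < n) \sum_(k < n)
         (g i (c x))^-1 * christoffel g j i k (c x) * derive1 c x 0 k * xi x 0 j).

(* a^i R^i_x (d/dx)^-1 b^j R^j_x *)
Definition tail_op (a b : 'I_n -> 'rV[R]_n -> R) c xi : R -> 'rV[R]_n := fun x =>
  \row_(i < n)
    (a i (c x) * derive1 c x 0 i
     * Dinv (fun y => \sum_(j < n) b j (c y) * derive1 c y 0 j * xi y 0 j) x).

(* The right-hand side v^i R^i_x of a diagonal system, v = (v^1, ..., v^n). *)
Definition diag_flow (v : 'I_n -> 'rV[R]_n -> R) c : R -> 'rV[R]_n := fun x =>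
  \row_(i < n) (v i (c x) * derive1 c x 0 i).

(* Equality of the mixed derivatives R_{t tau} = R_{tau t}. *)
Definition commuting_flows U (v w : 'I_n -> 'rV[R]_n -> R) : Prop :=
  forall c, curve_in U c -> forall x : R,
    'D_1 (fun e : R => diag_flow v (fun y => c y + e *: diag_flow w c y) x) 0
    = 'D_1 (fun e : R => diag_flow w (fun y => c y + e *: diag_flow v c y) x) 0.

End Functionals.

(* Below, 'I_N.+1 indexes the N.+1 >= 1 times, ord0 standing for t^1;
   a gam bet = a^gam_bet, c gam bet = c^gam_bet, ups bet i = upsilon^i_bet,
   w gam i = w^i_gam. *)
Section Reciprocal.
Context {R : realType} {n N : nat}.
Variables (g : 'I_n -> 'rV[R]_n -> R).
Variables (ups w : 'I_N.+1 -> 'I_n -> 'rV[R]_n -> R).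
Variables (a c : 'I_N.+1 -> 'I_N.+1 -> 'rV[R]_n -> R).

Definition flux_matrix (x : 'rV[R]_n) : 'M[R]_N.+1 :=
  \matrix_(gam, bet) a gam bet x.

(* flux_inverse bet gam = A^bet_gam *)
Definition flux_inverse (bet gam : 'I_N.+1) : 'rV[R]_n -> R :=
  fun x => invmx (flux_matrix x) bet gam.

Definition recip_factor (i : 'I_n) : 'rV[R]_n -> R := fun x =>
  \sum_nu flux_inverse nu ord0 x * ups nu i x.

Definition recip_ups (bet : 'I_N.+1) (i : 'I_n) : 'rV[R]_n -> R := fun x =>
  (\sum_gam flux_inverse gam bet x * ups gam i x) / recip_factor i x.

Definition recip_w (gam : 'I_N.+1) (i : 'I_n) : 'rV[R]_n -> R := fun x =>
  (w gam i x
   - \sum_bet \sum_eps c bet gam x * flux_inverse eps bet x * ups eps i x)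
  / recip_factor i x.

Definition recip_metric (i : 'I_n) : 'rV[R]_n -> R := fun x =>
  g i x * recip_factor i x ^+ 2.

End Reciprocal.

(* Main.v *)
(* Let gamma_ij = d_j ln sqrt g_ii, V^i_gam = sum_eps A^eps_gam upsilon^i_eps,
   b_ij = sum_del V^i_del d_j a^del_1 and lambda = gamma - b. Flatness of g gives
   d_j X^i = gamma_ij (X^j - X^i), i <> j, for X = upsilon_bet and X = w_gam.
   Hence V_gam and W^i_gam = w^i_gam - sum_bet c^bet_gam V^i_bet both satisfy
   d_j X^i = lambda_ij X^j - gamma_ij X^i. The factor q = sum_nu A^nu_1 upsilon_nu
   is V_1, so the new metric g q^2 has tilde gamma_ij = (q_j / q_i) lambda_ij, and
   the quotients V_gam / q and W_gam / q satisfy its Codazzi equations. Expanding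
   the curvature of g q^2 in gamma and b and cancelling the curvature of g leaves
     q_i q_j K_ij = sum_del (V^i_del w^j_del + V^j_del w^i_del)
                    - sum_m b_im b_jm / g_m,
   and the normalization of c turns this into the Gauss equation.

   An operator J whose metric and tails satisfy the Gauss-Codazzi equations is
   Hamiltonian for the following reason. For fixed covectors xi and eta, the
   derivative of \int xi . J eta in the direction phi is \int kappa(xi, eta) . phi,
   where kappa(xi, eta) is free of derivatives of phi. Therefore
   delta {F, G} / delta R = F''[J G'] - G''[J F'] + kappa(F', G'), where F' and F''
   are the first and second variational derivatives of F. The terms with F'' cancel
   in the cyclic sum, because F'' is symmetric (Schwarz's theorem for the
   two-parameter family c + s phi + t psi), and the cyclic sum of
   kappa(xi, eta) . J zeta vanishes pointwise. *)
From HB Require Import structures.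
From mathcomp Require Import all_boot all_order all_algebra.
From mathcomp Require Import all_classical all_reals all_analysis.
From mathcomp Require Import ring lra.
Require Import Defs.

Set Implicit Arguments.
Unset Strict Implicit.
Unset Printing Implicit Defensive.
Import Order.TTheory GRing.Theory Num.Theory.
Import numFieldNormedType.Exports.
Local Open Scope classical_set_scope.
Local Open Scope ring_scope.

(** * Partial derivatives and smooth functions *)

(** The analytic obstacle is that {F, G} is a nonlocal functional whose variational derivative has
    to be produced: differentiation in [e] must pass through [Dinv] and through the integral. This
    is done with expansions in [e] whose remainder is quadratic and uniform on a compact window.
    They survive products, composition with smooth coefficients, [Dinv] and integration, so no
    convergence theorem for integrals is invoked. Directions of variation are arbitrary smooth
    curves, and they must be: in the second-variation terms the direction is J G', whose tails need
    not vanish far out. Hence c + e phi may leave [U] far out even for small [e], and statements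
    about displaced curves are confined to a window, a factor of compact support taking care of the
    rest. The tails are indexed by a finite type with an involution exchanging the two factors of a
    tail, so that symmetric pairs enter as they stand. On the geometric side the derivatives of
    gamma, b and q are eliminated first; each curvature component then becomes a rational identity
    in finitely many scalars. *)

Lemma near0_differentiable (R : realType) (V W : normedModType R) (f : V -> W)
  (x : V) : (\forall y \near x, f y = 0) -> differentiable f x.
Proof.
move=> f0.
have [c0 f00] : continuous (\0 : V -> W) /\
    f \o shift x = cst (f x) + (\0 : V -> W) +o_ 0 id.
  split; first by move=> ?; exact: cst_continuous.
  apply/eqaddoP => _/posnumP[e]; near=> y.
  rewrite !fctE /= (nbhs_singleton f0).
  suff -> : f (y + x) = 0 by rewrite addr0 subrr normr0 mulr_ge0.
  near: y; move: f0; rewrite (near_shift 0) /= subr0.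
  by apply.
by apply/diff_locallyP; rewrite (diff_unique c0 f00).
Unshelve. all: by end_near. Qed.

Section ScalarDerivatives.
Context {R : realType} {V : normedModType R}.
Implicit Types (f g : V -> R) (x v : V).

Lemma is_deriveM_fun f g x v (df dg : R) : is_derive x v f df ->
  is_derive x v g dg -> is_derive x v (fun y => f y * g y) (f x * dg + g x * df).
Proof. exact: is_deriveM. Qed.

Lemma is_deriveD_fun f g x v (df dg : R) : is_derive x v f df ->
  is_derive x v g dg -> is_derive x v (fun y => f y + g y) (df + dg).
Proof. exact: is_deriveD. Qed.

Lemma is_deriveB_fun f g x v (df dg : R) : is_derive x v f df ->
  is_derive x v g dg -> is_derive x v (fun y => f y - g y) (df - dg).
Proof. exact: is_deriveB. Qed.

Lemma is_deriveZ_fun (k : R) f x v (df : R) : is_derive x v f df ->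
  is_derive x v (fun y => k * f y) (k * df).
Proof. exact: is_deriveZ. Qed.

Lemma is_derive_sum_fun (I : Type) (r : seq I) (P : pred I) (F : I -> V -> R)
  (dF : I -> R) x v : (forall i, is_derive x v (F i) (dF i)) ->
  is_derive x v (fun y => \sum_(i <- r | P i) F i y) (\sum_(i <- r | P i) dF i).
Proof.
move=> HF; rewrite (_ : (fun _ => _) = \sum_(i <- r | P i) F i); last first.
  by apply/funext => y; rewrite fct_sumE.
by elim/big_ind2 : _ => // [|] *; [exact: is_derive_cst|exact: is_deriveD].
Qed.

End ScalarDerivatives.

Section PartialDerivatives.
Context {R : realType} {m : nat}.
Implicit Types (f g h : 'rV[R]_m -> R) (x : 'rV[R]_m) (D : set 'rV[R]_m).

Lemma eq_partial D f g i x : open D -> (forall y, D y -> f y = g y) -> D x ->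
  partial i f x = partial i g x.
Proof.
move=> oD fg Dx; apply: near_eq_derive.
by near=> y; apply: fg; near: y; exact: open_nbhs_nbhs.
Unshelve. all: by end_near. Qed.

(** Differentiability is a property of the germ: [g] is [f] plus [g \- f], and the latter vanishes
    near [x]. *)
Lemma eq_differentiable D f g x : open D -> (forall y, D y -> f y = g y) ->
  D x -> differentiable f x -> differentiable g x.
Proof.
move=> oD fg Dx df.
suff : differentiable (g \- f) x.
  move=> dgf; rewrite (_ : g = (g \- f) + f); first exact: differentiableD.
  by apply/funext => y; rewrite fctE subrK.
apply: near0_differentiable; near=> y; rewrite /= fg ?subrr//.
by near: y; exact: open_nbhs_nbhs.
Unshelve. all: by end_near. Qed.

Lemma eq_foldr_partial D f g s x : open D -> (forall y, D y -> f y = g y) ->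
  D x -> foldr (@partial R m) f s x = foldr (@partial R m) g s x.
Proof.
move=> oD fg; elim: s x => [|i s IH] x Dx /=; first exact: fg.
exact: eq_partial oD IH Dx.
Qed.

Lemma partialD f g i x : differentiable f x -> differentiable g x ->
  partial i (fun y => f y + g y) x = partial i f x + partial i g x.
Proof. by move=> /diff_derivable df /diff_derivable dg; exact: deriveD. Qed.

Lemma partialN f i x : differentiable f x ->
  partial i (fun y => - f y) x = - partial i f x.
Proof. by move=> /diff_derivable df; exact: deriveN. Qed.

Lemma partialB f g i x : differentiable f x -> differentiable g x ->
  partial i (fun y => f y - g y) x = partial i f x - partial i g x.
Proof. by move=> /diff_derivable df /diff_derivable dg; exact: deriveB. Qed.

Lemma partialM f g i x : differentiable f x -> differentiable g x ->
  partial i (fun y => f y * g y) x = f x * partial i g x + partial i f x * g x.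
Proof.
move=> /diff_derivable df /diff_derivable dg.
by rewrite [LHS]deriveM// [X in _ + X]mulrC.
Qed.

Lemma partialV f i x : f x != 0 -> differentiable f x ->
  partial i (fun y => (f y)^-1) x = - partial i f x / f x ^+ 2.
Proof.
move=> f0 /diff_derivable df; rewrite [LHS]deriveV//=.
by rewrite [LHS]mulNr mulNr mulrC.
Qed.

Lemma partial_sum (I : Type) (r : seq I) (P : pred I) (F : I -> 'rV[R]_m -> R)
  i x : (forall k, differentiable (F k) x) ->
  partial i (fun y => \sum_(k <- r | P k) F k y) x =
  \sum_(k <- r | P k) partial i (F k) x.
Proof.
move=> dF; suff [] : differentiable (fun y => \sum_(k <- r | P k) F k y) x /\
    partial i (fun y => \sum_(k <- r | P k) F k y) x =
    \sum_(k <- r | P k) partial i (F k) x by [].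
elim: r => [|k r [dr IH]].
  rewrite (_ : (fun _ => _) = fun=> 0); last first.
    by apply/funext => y; rewrite big_nil.
  by rewrite big_nil [partial _ _ _]derive_cst; split => //; exact: differentiable_cst.
rewrite (_ : (fun _ => _) = fun y => if P k then F k y + \sum_(j <- r | P j) F j y
    else \sum_(j <- r | P j) F j y); last first.
  by apply/funext => y; rewrite big_cons.
rewrite big_cons -IH; case: ifP => // Pk; rewrite partialD//; split => //.
exact: differentiableD.
Qed.

Lemma partial_cst (a : R) i x : partial i (fun=> a) x = 0.
Proof. exact: derive_cst. Qed.

Lemma partial_coord i j x : partial i (fun y => y 0 j) x = (i == j)%:R.
Proof.
apply: cvg_lim => //=; apply: cvg_near_cst; near=> e.
have e0 : e != 0 by near: e; exact: nbhs_dnbhs_neq.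
by rewrite !mxE eqxx /= addrK eq_sym /GRing.scale /= mulrA mulVf// mul1r.
Unshelve. all: by end_near. Qed.

Lemma smooth_on_differentiable D f x : smooth_on D f -> D x ->
  differentiable f x.
Proof. by move=> sf Dx; exact: (sf [::]). Qed.

Lemma smooth_on_partial D f i : smooth_on D f -> smooth_on D (partial i f).
Proof. by move=> sf s x Dx; have := sf (rcons s i) x Dx; rewrite foldr_rcons. Qed.

Lemma sub_smooth_on D D' f : D `<=` D' -> smooth_on D' f -> smooth_on D f.
Proof. by move=> DD sf s x Dx; exact: sf (DD _ Dx). Qed.

Lemma eq_smooth_on D f g : open D -> (forall y, D y -> f y = g y) ->
  smooth_on D f -> smooth_on D g.
Proof.
move=> oD fg sf s x Dx; apply: (@eq_differentiable D _ _ _ oD _ Dx (sf s x Dx)).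
by move=> y Dy; exact: eq_foldr_partial oD fg Dy.
Qed.

Lemma smooth_on_cst D (a : R) : smooth_on D (fun=> a).
Proof.
suff H s : exists b : R, foldr (@partial R m) (fun=> a) s = fun=> b.
  by move=> s x _; have [b ->] := H s; exact: differentiable_cst.
elim: s => [|i s [b /= ->]]; first by exists a.
by exists 0; apply/funext => x; exact: partial_cst.
Qed.

Lemma smooth_on_coord D j : smooth_on D (fun y => y 0 j).
Proof.
move=> s x Dx; elim/last_ind: s => [|s i _]; first exact: differentiable_coord.
rewrite foldr_rcons (_ : partial i _ = fun=> (i == j)%:R).
  exact: (@smooth_on_cst D).
by apply/funext => y; exact: partial_coord.
Qed.

End PartialDerivatives.

(** * Closure of the smooth functions under arithmetic and composition *)

Section Composition.
Context {R : realType}.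

Lemma differentiable_row (m p : nat) (Phi : 'I_p -> 'rV[R]_m -> R) x :
  (forall k, differentiable (Phi k) x) ->
  differentiable (fun y => \row_k Phi k y) x.
Proof.
move=> dPhi.
rewrite (_ : (fun y => \row_k Phi k y) =
  \sum_(k < p) (fun y => Phi k y *: (delta_mx 0 k : 'rV[R]_p))).
  by apply: differentiable_sum => k; exact: differentiableZl.
apply/funext => y; rewrite fct_sumE [LHS]row_sum_delta.
by apply: eq_bigr => k _; rewrite mxE.
Qed.

Lemma partial_comp (m p : nat) (f : 'rV[R]_p -> R)
    (Phi : 'I_p -> 'rV[R]_m -> R) i x :
  (forall k, differentiable (Phi k) x) ->
  differentiable f (\row_k Phi k x) ->
  partial i (fun y => f (\row_k Phi k y)) x =
  \sum_(k < p) partial k f (\row_k Phi k x) * partial i (Phi k) x.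
Proof.
move=> dPhi df; have dr := differentiable_row dPhi.
rewrite /partial [LHS]deriveE; last first.
  exact: (@differentiable_comp _ _ _ _ (fun y => \row_k Phi k y)).
rewrite (diff_comp dr df) /= -(deriveE _ dr) derive_mx; last first.
  exact: diff_derivable.
rewrite [X in 'd _ _ X]row_sum_delta linear_sum /=; apply: eq_bigr => k _.
rewrite linearZ /= (deriveE _ df) mulrC; congr (_ * _).
by rewrite mxE; congr ('D_ _ _ x); apply/funext => y; rewrite mxE.
Qed.

(* The smooth functions on D, presented so that the class is visibly stable
   under partial derivatives. *)
Inductive smooth_expr (m : nat) (D : set 'rV[R]_m) : ('rV[R]_m -> R) -> Prop :=
| smooth_expr_base f : smooth_on D f -> smooth_expr D f
| smooth_expr_add f g : smooth_expr D f -> smooth_expr D g ->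
    smooth_expr D (fun x => f x + g x)
| smooth_expr_mul f g : smooth_expr D f -> smooth_expr D g ->
    smooth_expr D (fun x => f x * g x)
| smooth_expr_inv f : smooth_expr D f -> (forall x, D x -> f x != 0) ->
    smooth_expr D (fun x => (f x)^-1)
| smooth_expr_comp p (E : set 'rV[R]_p) f (Phi : 'I_p -> 'rV[R]_m -> R) :
    smooth_on E f -> (forall k, smooth_expr D (Phi k)) ->
    (forall x, D x -> E (\row_k Phi k x)) ->
    smooth_expr D (fun x => f (\row_k Phi k x)).

Lemma smooth_expr_differentiable (m : nat) (D : set 'rV[R]_m) f x :
  smooth_expr D f -> D x -> differentiable f x.
Proof.
move=> sf Dx; elim: sf.
- by move=> {}f sf; exact: smooth_on_differentiable sf Dx.
- by move=> {}f g _ df _ dg; exact: differentiableD.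
- by move=> {}f g _ df _ dg; exact: differentiableM.
- by move=> {}f _ df f0; apply: differentiableV => //; exact: f0.
- move=> p E {}f Phi sf _ dPhi DE.
  apply: (@differentiable_comp _ _ _ _ (fun y => \row_k Phi k y)).
    exact: differentiable_row.
  exact: smooth_on_differentiable sf (DE _ Dx).
Qed.

Lemma smooth_expr_sum (m : nat) (D : set 'rV[R]_m) (I : Type) (r : seq I)
    (P : pred I) (F : I -> 'rV[R]_m -> R) :
  (forall k, smooth_expr D (F k)) ->
  smooth_expr D (fun y => \sum_(k <- r | P k) F k y).
Proof.
move=> sF; elim: r => [|k r IH].
  rewrite (_ : (fun _ => _) = fun=> 0); last first.
    by apply/funext => y; rewrite big_nil.
  by apply: smooth_expr_base; exact: smooth_on_cst.
rewrite (_ : (fun _ => _) = fun y => if P k then F k y + \sum_(j <- r | P j) F j y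
    else \sum_(j <- r | P j) F j y); last first.
  by apply/funext => y; rewrite big_cons.
by case: (P k) => //; exact: smooth_expr_add.
Qed.

(** The derivative stays in the class only up to equality on [D]: off [D] the pieces need not be
    differentiable, and the Leibniz and chain rules may fail there. *)
Lemma smooth_expr_partial (m : nat) (D : set 'rV[R]_m) f i :
  smooth_expr D f ->
  exists2 g, smooth_expr D g & forall x, D x -> partial i f x = g x.
Proof.
elim => {f}.
- move=> f sf; exists (partial i f) => //.
  by apply: smooth_expr_base; exact: smooth_on_partial.
- move=> f g sf [df sdf dfE] sg [dg sdg dgE].
  exists (fun x => df x + dg x); first exact: smooth_expr_add.
  move=> x Dx; rewrite partialD ?dfE ?dgE//.
    exact: smooth_expr_differentiable sf Dx.
  exact: smooth_expr_differentiable sg Dx.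
- move=> f g sf [df sdf dfE] sg [dg sdg dgE].
  exists (fun x => f x * dg x + df x * g x).
    by apply: smooth_expr_add; exact: smooth_expr_mul.
  move=> x Dx; rewrite partialM ?dfE ?dgE//.
    exact: smooth_expr_differentiable sf Dx.
  exact: smooth_expr_differentiable sg Dx.
- move=> f sf [df sdf dfE] f0.
  exists (fun x => (-1 * df x) * ((f x)^-1 * (f x)^-1)).
    apply: smooth_expr_mul; last by apply: smooth_expr_mul; exact: smooth_expr_inv.
    apply: smooth_expr_mul => //; apply: smooth_expr_base; exact: smooth_on_cst.
  move=> x Dx; rewrite partialV ?f0//.
    by rewrite dfE// mulN1r expr2 invfM.
  exact: smooth_expr_differentiable sf Dx.
- move=> p E f Phi sf sPhi IH DE.
  exists (fun x => \sum_(k < p) partial k f (\row_k Phi k x) *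
                     sval (cid2 (IH k)) x).
    apply: smooth_expr_sum => k; apply: smooth_expr_mul.
      by apply: smooth_expr_comp sPhi DE; exact: smooth_on_partial.
    by have := s2valP (cid2 (IH k)); case: cid2.
  move=> x Dx; rewrite partial_comp.
  + apply: eq_bigr => k _; congr (_ * _).
    by case: cid2 => /= h _ ->.
  + by move=> k; exact: smooth_expr_differentiable (sPhi k) Dx.
  + exact: smooth_on_differentiable sf (DE _ Dx).
Qed.

(** The Leibniz and chain rules turn one function into several, so an induction on the list of
    derivatives for a fixed product or composite does not close. Here the innermost derivative is
    replaced by another member of the class, which shortens the list. *)
Lemma smooth_exprP (m : nat) (D : set 'rV[R]_m) f : open D ->
  smooth_expr D f -> smooth_on D f.
Proof.
move=> oD sf s x Dx; elim/last_ind: s f sf => [|s i IH] f sf.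
  exact: smooth_expr_differentiable sf Dx.
rewrite foldr_rcons; have [g sg fg] := smooth_expr_partial i sf.
have gf y : D y -> g y = partial i f y by move=> /fg.
apply: (@eq_differentiable _ _ D _ _ _ oD _ Dx (IH _ sg)).
by move=> y Dy; apply: eq_foldr_partial oD gf Dy.
Qed.

End Composition.

Section SmoothClosure.
Context {R : realType} {m : nat} (D : set 'rV[R]_m).
Hypothesis oD : open D.
Implicit Types f h : 'rV[R]_m -> R.

Lemma smooth_onD f h : smooth_on D f -> smooth_on D h ->
  smooth_on D (fun x => f x + h x).
Proof.
move=> sf sh; apply: smooth_exprP => //.
by apply: smooth_expr_add; exact: smooth_expr_base.
Qed.

Lemma smooth_onM f h : smooth_on D f -> smooth_on D h ->
  smooth_on D (fun x => f x * h x).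
Proof.
move=> sf sh; apply: smooth_exprP => //.
by apply: smooth_expr_mul; exact: smooth_expr_base.
Qed.

Lemma smooth_onN f : smooth_on D f -> smooth_on D (fun x => - f x).
Proof.
move=> sf; have := smooth_onM (@smooth_on_cst _ _ D (-1)) sf.
by congr smooth_on; apply/funext => x; rewrite mulN1r.
Qed.

Lemma smooth_onB f h : smooth_on D f -> smooth_on D h ->
  smooth_on D (fun x => f x - h x).
Proof. by move=> sf sh; apply: smooth_onD => //; exact: smooth_onN. Qed.

Lemma smooth_onV f : (forall x, D x -> f x != 0) -> smooth_on D f ->
  smooth_on D (fun x => (f x)^-1).
Proof.
move=> f0 sf; apply: smooth_exprP => //.
by apply: smooth_expr_inv => //; exact: smooth_expr_base.
Qed.

Lemma smooth_on_sum (I : Type) (r : seq I) (P : pred I) (F : I -> 'rV[R]_m -> R) :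
  (forall k, smooth_on D (F k)) ->
  smooth_on D (fun x => \sum_(k <- r | P k) F k x).
Proof.
move=> sF; apply: smooth_exprP => //; apply: smooth_expr_sum => k.
exact: smooth_expr_base.
Qed.

Lemma smooth_on_prod (I : Type) (r : seq I) (P : pred I) (F : I -> 'rV[R]_m -> R) :
  (forall k, smooth_on D (F k)) ->
  smooth_on D (fun x => \prod_(k <- r | P k) F k x).
Proof.
move=> sF; elim: r => [|k r IH].
  rewrite (_ : (fun _ => _) = fun=> 1); first exact: smooth_on_cst.
  by apply/funext => x; rewrite big_nil.
rewrite (_ : (fun _ => _) = fun x => (if P k then F k x else 1) * \prod_(j <- r | P j) F j x).
  apply: smooth_onM => //; case: (P k) => //; exact: smooth_on_cst.
by apply/funext => x; rewrite big_cons; case: (P k); rewrite ?mul1r.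
Qed.

Lemma smooth_on_det (k : nat) (M : 'rV[R]_m -> 'M[R]_k) :
  (forall i j, smooth_on D (fun x => M x i j)) -> smooth_on D (fun x => \det (M x)).
Proof.
move=> sM; apply: smooth_on_sum => s; apply: smooth_onM; first exact: smooth_on_cst.
exact: smooth_on_prod.
Qed.

(** Cofactor formula: each entry is a minor of [M x], up to sign, divided by a determinant that does
    not vanish on [D]. *)
Lemma smooth_on_invmx (k : nat) (M : 'rV[R]_m -> 'M[R]_k) i j :
  (forall i j, smooth_on D (fun x => M x i j)) -> (forall x, D x -> M x \in unitmx) ->
  smooth_on D (fun x => invmx (M x) i j).
Proof.
move=> sM uM.
apply: (@eq_smooth_on _ _ _ (fun x => (\det (M x))^-1 * ((-1) ^+ (j + i) *
    \det (row' j (col' i (M x)))))) => //.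
  by move=> x Dx; rewrite /invmx uM// !mxE.
apply: smooth_onM.
  apply: smooth_onV; last exact: smooth_on_det.
  by move=> x /uM; rewrite unitmxE unitfE.
apply: smooth_onM; first exact: smooth_on_cst.
apply: smooth_on_det => i' j'; have := sM (lift j i') (lift i j').
by congr smooth_on; apply/funext => x; rewrite !mxE.
Qed.

End SmoothClosure.

(** * Derivatives along curves and Schwarz's theorem *)

Section CurvesAndLines.
Context {R : realType}.

Lemma derive_partial (p : nat) (f : 'rV[R]_p -> R) (x v : 'rV[R]_p) :
  differentiable f x -> 'D_v f x = \sum_(k < p) v 0 k * partial k f x.
Proof.
move=> df; rewrite deriveE// [X in 'd f _ X]row_sum_delta linear_sum.
by apply: eq_bigr => k _; rewrite linearZ /= /partial deriveE.
Qed.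

Lemma is_derive_comp_curve (p : nat) (f : 'rV[R]_p -> R) (c : R -> 'rV[R]_p)
    (dc : 'rV[R]_p) x :
  differentiable f (c x) -> is_derive x 1 c dc ->
  is_derive x 1 (fun y => f (c y)) (\sum_(k < p) partial k f (c x) * dc 0 k).
Proof.
move=> df [dcx <-].
have dcx' : differentiable c x by apply/derivable1_diffP.
have dfc : differentiable (f \o c) x by exact: differentiable_comp.
apply: DeriveDef; first exact: diff_derivable.
rewrite [LHS]deriveE// diff_comp//= -!deriveE// derive_partial//.
by apply: eq_bigr => k _; rewrite mulrC.
Qed.

Lemma is_derive_line (p : nat) (f : 'rV[R]_p -> R) (y v : 'rV[R]_p) t :
  differentiable f (y + t *: v) ->
  is_derive t 1 (fun s => f (y + s *: v)) ('D_v f (y + t *: v)).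
Proof.
move=> df; have dl : is_derive t 1 (fun s : R => y + s *: v) v.
  have : is_derive t 1 (cst y + (fun s : R => s *: v)) (0 + v).
    apply: is_deriveD; apply: DeriveDef.
      by apply: diff_derivable.
    by rewrite deriveE// diff_val scale1r.
  by rewrite add0r.
apply: is_derive_eq; first exact: is_derive_comp_curve.
by rewrite derive_partial//; apply: eq_bigr => k _; rewrite mulrC.
Qed.

Definition second_difference (f : R -> R -> R) h :=
  f h h - f h 0 - f 0 h + f 0 0.

(** The mean value theorem for [s |-> f s h - f s 0] writes the second difference as
    [(f1 s h - f1 s 0) * h] with [s] between 0 and [h]. The expansion errors of [f1] at (s, h) and
    (s, 0) are at most e (s + h) and e s, together at most 3 e h. *)
Lemma second_difference_bound (f f1 : R -> R -> R) (A B d : R) : 0 < d ->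
  (forall s t : R, `|s| < d -> `|t| < d -> is_derive s 1 (f ^~ t) (f1 s t)) ->
  (forall e, 0 < e -> exists2 d', 0 < d' & forall s t : R, `|s| < d' -> `|t| < d' ->
     `|f1 s t - f1 0 0 - A * s - B * t| <= e * (`|s| + `|t|)) ->
  forall e, 0 < e -> exists2 d', 0 < d' & forall h, 0 < h -> h < d' ->
    `|second_difference f h - B * h ^+ 2| <= 3 * e * h ^+ 2.
Proof.
move=> d0 df f1E e e0; have [d' d'0 H] := f1E _ e0.
exists (Num.min d d'); first by rewrite lt_min d0.
move=> h h0; rewrite lt_min => /andP[hd hd'].
have ns s : 0 <= s -> s <= h -> `|s| < d.
  by move=> s0 sh; rewrite ger0_norm//; exact: le_lt_trans hd.
have du s : 0 <= s -> s <= h ->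
    is_derive s 1 (fun s => f s h - f s 0) (f1 s h - f1 s 0).
  move=> s0 sh; apply: is_deriveB; apply: df; rewrite ?normr0//; apply: ns => //.
  exact: ltW.
have [||s] := @MVT_segment R (fun s => f s h - f s 0) (fun s => f1 s h - f1 s 0)
  0 h (ltW h0).
- by move=> s; rewrite in_itv/= => /andP[s0 sh]; apply: du; exact: ltW.
- apply: derivable_within_continuous => s; rewrite in_itv/= => /andP[s0 sh].
  by have [] := du s s0 sh.
rewrite in_itv/= subr0 => /andP[s0 sh] E.
have -> : second_difference f h = (f1 s h - f1 s 0) * h.
  by rewrite /second_difference -E; ring.
have sd' : `|s| < d' by rewrite ger0_norm//; exact: le_lt_trans hd'.
have hh : `|h| < d' by rewrite gtr0_norm.
have H1 := H s h sd' hh.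
have := H s 0 sd'; rewrite normr0 => /(_ d'0) H2.
rewrite (ger0_norm s0) (gtr0_norm h0) in H1; rewrite (ger0_norm s0) in H2.
rewrite (_ : _ - _ = ((f1 s h - f1 0 0 - A * s - B * h) -
   (f1 s 0 - f1 0 0 - A * s - B * 0)) * h); last by ring.
rewrite normrM (gtr0_norm h0) [h ^+ 2]expr2 mulrA ler_pM2r//.
apply: le_trans (ler_normB _ _) _; nra.
Qed.

(** Young's form: differentiability of the first partial derivatives at the origin replaces
    continuity of the second ones. The second difference is unchanged when the two variables are
    exchanged, and divided by h^2 it tends to either mixed derivative. The abstract form serves
    functions of several variables as well as functionals along a two-parameter family of curves. *)
Lemma schwarz (f f1 f2 : R -> R -> R) (A B A' B' d : R) : 0 < d ->
  (forall s t : R, `|s| < d -> `|t| < d -> is_derive s 1 (f ^~ t) (f1 s t)) ->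
  (forall s t : R, `|s| < d -> `|t| < d -> is_derive t 1 (f s) (f2 s t)) ->
  (forall e, 0 < e -> exists2 d', 0 < d' & forall s t : R, `|s| < d' -> `|t| < d' ->
     `|f1 s t - f1 0 0 - A * s - B * t| <= e * (`|s| + `|t|)) ->
  (forall e, 0 < e -> exists2 d', 0 < d' & forall s t : R, `|s| < d' -> `|t| < d' ->
     `|f2 s t - f2 0 0 - A' * s - B' * t| <= e * (`|s| + `|t|)) ->
  B = A'.
Proof.
move=> d0 df1 df2 H1 H2.
have K1 := second_difference_bound d0 df1 H1.
have K2 : forall e, 0 < e -> exists2 d', 0 < d' & forall h, 0 < h -> h < d' ->
    `|second_difference f h - A' * h ^+ 2| <= 3 * e * h ^+ 2.
  move=> e e0; have [||d' d'0 H] := @second_difference_bound (fun s t => f t s)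
      (fun s t => f2 t s) B' A' d d0 _ _ e e0.
  - by move=> s t sd td; exact: df2.
  - move=> {e0} e' e'0; have [d' d'0 H] := H2 _ e'0; exists d' => // s t sd td.
    by rewrite addrAC [`|s| + _]addrC; exact: H.
  exists d' => // h h0 hd; have := H h h0 hd.
  by rewrite /second_difference [_ - _ - f h 0]addrAC.
apply/eqP; rewrite -subr_eq0 -normr_le0; apply/ler_addgt0Pl => e e0.
(* Each of the two bounds carries the constant [3 * (e / 6)], so that they add up to [e]. *)
rewrite addr0; have e6 : 0 < e / 6 by rewrite divr_gt0.
have [d1 d10 {}K1] := K1 _ e6; have [d2 d20 {}K2] := K2 _ e6.
have m0 : 0 < Num.min d1 d2 by rewrite lt_min d10.
pose h := Num.min d1 d2 / 2; have h0 : 0 < h by rewrite divr_gt0.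
have hm : h < Num.min d1 d2 by rewrite /h; lra.
move: hm; rewrite lt_min => /andP[hd1 hd2].
have h20 : 0 < h ^+ 2 by rewrite exprn_gt0.
rewrite -(ler_pM2r h20) -{1}(gtr0_norm h20) -normrM.
rewrite (_ : _ * _ = (second_difference f h - A' * h ^+ 2) -
  (second_difference f h - B * h ^+ 2)); last by ring.
apply: le_trans (ler_normB _ _) _.
by have := K1 h h0 hd1; have := K2 h h0 hd2; lra.
Qed.

Lemma differentiable_bound (p : nat) (f : 'rV[R]_p -> R) (x : 'rV[R]_p) :
  differentiable f x -> forall e, 0 < e ->
  exists2 d, 0 < d & forall v, `|v| < d -> `|f (x + v) - f x - 'D_v f x| <= e * `|v|.
Proof.
move=> df e e0.
have /eqaddoP /(_ _ e0) /= := diff_locally df.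
move=> /nbhs_norm0P[d /= d0 H]; exists d => // v vd.
have := H v vd; rewrite !fctE. rewrite /= [v + x]addrC opprD addrA.
by rewrite deriveE.
Qed.

Lemma norm_delta_mx (m : nat) (i : 'I_m) :
  `|(delta_mx 0 i : 'rV[R]_m)| <= 1.
Proof.
rewrite [leLHS]/Num.Def.normr/= mx_normrE (bigmax_le _ ler01)//= => -[j k] _.
by rewrite mxE /=; case: (_ && _); rewrite ?normr1 ?normr0.
Qed.

Lemma partial_swap (m : nat) (D : set 'rV[R]_m) f i j x : open D ->
  smooth_on D f -> D x ->
  partial i (partial j f) x = partial j (partial i f) x.
Proof.
move=> oD sf Dx; apply: esym.
have : \forall v \near (0 : 'rV[R]_m), D (x + v).
  have : \forall z \near x, D z by exact: open_nbhs_nbhs.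
  rewrite (near_shift 0) /= subr0; apply: filterS => v /=.
  by rewrite addrC.
move=> /nbhs_norm0P[d /= d0 Dv].
pose v s t : 'rV[R]_m := s *: delta_mx 0 i + t *: delta_mx 0 j.
have vst s t : `|v s t| <= `|s| + `|t|.
  apply: le_trans (ler_normD _ _) _; rewrite !normrZ.
  by apply: lerD; rewrite ler_piMr//; exact: norm_delta_mx.
have Dst s t : `|s| < d / 2 -> `|t| < d / 2 -> D (x + v s t).
  by move=> sd td; apply: Dv => /=; apply: le_lt_trans (vst _ _) _; lra.
have dst k s t : D (x + v s t) -> differentiable (partial k f) (x + v s t).
  by move=> ?; exact: smooth_on_differentiable (smooth_on_partial k sf) _.
have B k e : 0 < e -> exists2 d', 0 < d' & forall s t : R, `|s| < d' -> `|t| < d' ->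
   `|partial k f (x + v s t) - partial k f (x + v 0 0) -
     partial i (partial k f) x * s - partial j (partial k f) x * t|
   <= e * (`|s| + `|t|).
  have v00 : v 0 0 = 0 by rewrite /v !scale0r addr0.
  have dx : differentiable (partial k f) x by have := dst k 0 0; rewrite v00 addr0; apply.
  move=> e0; have [d' d'0 H] := differentiable_bound dx e0.
  exists (d' / 2); first by rewrite divr_gt0.
  move=> s t sd td; have vd : `|v s t| < d' by apply: le_lt_trans (vst _ _) _; lra.
  apply: le_trans (_ : e * `|v s t| <= _); last by rewrite ler_pM2l.
  have vE : 'D_(v s t) (partial k f) x =
      partial i (partial k f) x * s + partial j (partial k f) x * t.
    rewrite deriveE// linearD !linearZ /= -!deriveE//.
    by congr (_ + _); exact: mulrC.
  by have := H _ vd; rewrite vE v00 addr0 opprD addrA.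
apply: (@schwarz (fun s t => f (x + v s t)) (fun s t => partial i f (x + v s t))
   (fun s t => partial j f (x + v s t)) _ _ _ _ (d / 2) _ _ _ (B i) (B j)).
- by rewrite divr_gt0.
- move=> s t sd td.
  have E s' : x + v s' t = (x + t *: delta_mx 0 j) + s' *: delta_mx 0 i.
    by rewrite /v addrA addrAC.
  rewrite (_ : (fun _ => _) = fun s' => f ((x + t *: delta_mx 0 j) + s' *: delta_mx 0 i)).
    rewrite E; apply: is_derive_line; rewrite -E.
    by apply: smooth_on_differentiable sf _; exact: Dst.
  by apply/funext => s'; rewrite E.
- move=> s t sd td.
  have E t' : x + v s t' = (x + s *: delta_mx 0 i) + t' *: delta_mx 0 j.
    by rewrite /v addrA.
  rewrite (_ : (fun _ => _) = fun t' => f ((x + s *: delta_mx 0 i) + t' *: delta_mx 0 j)).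
    rewrite E; apply: is_derive_line; rewrite -E.
    by apply: smooth_on_differentiable sf _; exact: Dst.
  by apply/funext => s'; rewrite E.
Qed.

End CurvesAndLines.

(** * Smooth functions and curves on the line *)

Section SmoothCurves.
Context {R : realType}.
Implicit Types f : R -> R.

Record smooth1 f : Prop := Smooth1 {
  smooth1_derivable_n : forall (k : nat) (x : R), derivable (derive1n k f) x 1 }.

Lemma partial_rV1 f (z : 'rV[R]_1) :
  partial 0 (fun z => f (z 0 0)) z = derive1 f (z 0 0).
Proof.
rewrite derive1E /partial /derive.
set u := (fun _ : R => _); set v := (fun _ : R => _).
by suff -> : u = v by []; apply/funext => h; rewrite /u /v /= !mxE eqxx.
Qed.

Lemma foldr_partial_rV1 f (s : seq 'I_1) (z : 'rV[R]_1) :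
  foldr (@partial R 1) (fun z => f (z 0 0)) s z = derive1n (size s) f (z 0 0).
Proof.
elim: s z => //= i s IH z; rewrite ord1 -/(derive1n _ _) -partial_rV1.
by congr (partial _ _ _); apply/funext.
Qed.

(** Through this bridge to ['rV_1] the functions of one real variable inherit the closure properties
    already proved for [smooth_on]. *)
Lemma smooth1P f : smooth1 f <-> smooth_on setT (fun z : 'rV[R]_1 => f (z 0 0)).
Proof.
split => [[sf] s z _|sf]; last split => k x.
  rewrite (_ : foldr _ _ _ = fun z : 'rV[R]_1 => derive1n (size s) f (z 0 0)); last first.
    by apply/funext => y; exact: foldr_partial_rV1.
  have dc : differentiable (fun z : 'rV[R]_1 => z 0 0) z.
    exact: differentiable_coord.
  have dk : differentiable (derive1n (size s) f) (z 0 0).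
    by apply/derivable1_diffP; exact: sf.
  exact: (differentiable_comp dc dk).
have := sf (nseq k 0) (const_mx x) I.
rewrite (_ : foldr _ _ _ = fun z : 'rV[R]_1 => derive1n k f (z 0 0)); last first.
  by apply/funext => y; rewrite foldr_partial_rV1 size_nseq.
move=> /(@diff_derivable _ _ _ _ _ (delta_mx 0 0)) /derivable1P df.
apply/derivable1P; rewrite (_ : (fun _ => _) = fun h : R =>
  derive1n k f ((h *: delta_mx 0 0 + const_mx x : 'rV[R]_1) 0 0)) //.
by apply/funext => h; rewrite !mxE eqxx.
Qed.

Lemma smooth1_coord (m : nat) (D : set 'rV[R]_m) f (j : 'I_m) : smooth1 f ->
  smooth_expr D (fun z => f (z 0 j)).
Proof.
move=> /smooth1P sf.
have := @smooth_expr_comp _ m D 1 setT _ (fun=> fun z => z 0 j) sf.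
under [X in _ -> _ -> smooth_expr D X]eq_fun do rewrite mxE.
by apply=> // _; apply: smooth_expr_base; exact: smooth_on_coord.
Qed.

Lemma smooth1_expr f : smooth_expr setT (fun z : 'rV[R]_1 => f (z 0 0)) ->
  smooth1 f.
Proof. by move=> sf; apply/smooth1P; apply: smooth_exprP sf; exact: openT. Qed.

Lemma smooth1_derivable f (x : R) : smooth1 f -> derivable f x 1.
Proof. by move=> [sf]; exact: (sf 0%N). Qed.

Lemma smooth1_continuous f : smooth1 f -> continuous f.
Proof.
by move=> sf x; apply/differentiable_continuous/derivable1_diffP; exact: smooth1_derivable.
Qed.

Lemma smooth1_derive1 f : smooth1 f -> smooth1 (derive1 f).
Proof. by move=> [sf]; split => k x; rewrite -derive1Sn; exact: sf. Qed.

Lemma smooth1_is_derive f (x : R) : smooth1 f -> is_derive x 1 f (derive1 f x).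
Proof.
by move=> sf; rewrite derive1E; apply: derivableP; exact: smooth1_derivable.
Qed.

Lemma smooth1_antiderivative f g : smooth1 f -> (forall x : R, is_derive x 1 g (f x)) ->
  smooth1 g.
Proof.
move=> [sf] dg; split => -[|k] x; first by have [] := dg x.
rewrite derive1Sn (_ : derive1 g = f); first exact: sf.
by apply/funext => y; rewrite derive1E; have [] := dg y.
Qed.

Lemma smooth1_cst (a : R) : smooth1 (fun=> a).
Proof. by apply: smooth1_expr; apply: smooth_expr_base; exact: smooth_on_cst. Qed.

Lemma smooth1D f g : smooth1 f -> smooth1 g -> smooth1 (fun x => f x + g x).
Proof.
move=> sf sg; apply: smooth1_expr.
by apply: (@smooth_expr_add _ _ _ (fun z => f (z 0 0)) (fun z => g (z 0 0)));
  exact: smooth1_coord.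
Qed.

Lemma smooth1M f g : smooth1 f -> smooth1 g -> smooth1 (fun x => f x * g x).
Proof.
move=> sf sg; apply: smooth1_expr.
by apply: (@smooth_expr_mul _ _ _ (fun z => f (z 0 0)) (fun z => g (z 0 0)));
  exact: smooth1_coord.
Qed.

Lemma smooth1N f : smooth1 f -> smooth1 (fun x => - f x).
Proof.
move=> sf; rewrite (_ : (fun _ => _) = fun x => -1 * f x).
  exact: (smooth1M (@smooth1_cst (-1)) sf).
by apply/funext => x; rewrite mulN1r.
Qed.

Lemma smooth1B f g : smooth1 f -> smooth1 g -> smooth1 (fun x => f x - g x).
Proof. by move=> sf sg; exact: (smooth1D sf (smooth1N sg)). Qed.

Lemma smooth1_sum (I : Type) (r : seq I) (P : pred I) (F : I -> R -> R) :
  (forall k, smooth1 (F k)) -> smooth1 (fun y => \sum_(k <- r | P k) F k y).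
Proof.
move=> sF; apply: smooth1_expr.
apply: (@smooth_expr_sum _ _ _ _ _ _ (fun k z => F k (z 0 0))) => k.
exact: smooth1_coord.
Qed.

Lemma smooth1_comp (p : nat) (E : set 'rV[R]_p) g (c : R -> 'rV[R]_p) :
  smooth_on E g -> (forall i, smooth1 (fun x => c x 0 i)) ->
  (forall x, E (c x)) -> smooth1 (fun x => g (c x)).
Proof.
move=> sg sc cE; apply: smooth1_expr.
have cc y : \row_k c y 0 k = c y by apply/rowP => k; rewrite mxE.
rewrite (_ : (fun z : 'rV[R]_1 => _) =
    fun z : 'rV[R]_1 => g (\row_k (fun k (z : 'rV[R]_1) => c (z 0 0) 0 k) k z)).
  apply: (smooth_expr_comp sg) => [k|x _]; last by rewrite cc.
  exact: (@smooth1_coord 1 setT (fun x => c x 0 k)).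
by apply/funext => z; rewrite cc.
Qed.

Lemma derive1_coord (n : nat) (c : R -> 'rV[R]_n) (x : R) i : derivable c x 1 ->
  derive1 c x 0 i = derive1 (fun y => c y 0 i) x.
Proof. by move=> dc; rewrite !derive1E derive_mx// mxE. Qed.

Lemma smooth_curveP (n : nat) (c : R -> 'rV[R]_n) :
  smooth_curve c <-> forall i, smooth1 (fun x => c x 0 i).
Proof.
(* The coordinate of a derivative is the derivative of the coordinate only where the curve is
   derivable. The comparison at order [k] therefore assumes derivability at all lower orders, and
   each direction of the equivalence supplies it. *)
have E k : (forall j x, (j < k)%N -> derivable (derive1n j c) x 1) ->
    forall i x, derive1n k c x 0 i = derive1n k (fun y => c y 0 i) x.
  elim: k => // k IH dc i x; rewrite !derive1nS derive1_coord; last exact: dc.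
  congr (derive1 _ x); apply/funext => y; apply: IH => j z jk.
  exact/dc/ltnW.
split => [sc i|sc]; first split => k x.
  have -> : derive1n k (fun x => c x 0 i) = fun x => derive1n k c x 0 i.
    by apply/funext => y; rewrite E// => j z _; exact: sc.
  exact: (derivable_mxP _ _ _).1.
suff H k : forall j x, (j < k)%N -> derivable (derive1n j c) x 1.
  by move=> k x; exact: (H k.+1).
elim: k => // k IH j x; rewrite ltnS leq_eqVlt => /orP[/eqP ->|]; last exact: IH.
apply/derivable_mxP => i' i; rewrite ord1.
rewrite (_ : (fun _ => _) = derive1n k (fun y => c y 0 i)).
  exact: smooth1_derivable_n (sc i) k x.
by apply/funext => y; rewrite E.
Qed.

Lemma smooth_curve_derivable (n : nat) (c : R -> 'rV[R]_n) x :
  smooth_curve c -> derivable c x 1.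
Proof. by move=> sc; exact: (sc 0%N). Qed.

Lemma smooth_curve_derive1 (n : nat) (c : R -> 'rV[R]_n) i :
  smooth_curve c -> smooth1 (fun x => derive1 c x 0 i).
Proof.
move=> sc; rewrite (_ : (fun _ => _) = derive1 (fun y => c y 0 i)).
  by apply: smooth1_derive1; exact: (smooth_curveP c).1.
by apply/funext => x; apply: derive1_coord; exact: smooth_curve_derivable.
Qed.

Lemma smooth_curve_coord (n : nat) (c : R -> 'rV[R]_n) i :
  smooth_curve c -> smooth1 (fun x => c x 0 i).
Proof. by move=> sc; exact: (smooth_curveP c).1. Qed.

Lemma smooth_curve_row (n : nat) (c : 'I_n -> R -> R) :
  (forall i, smooth1 (c i)) -> smooth_curve (fun x => \row_i c i x).
Proof.
move=> sc; apply/smooth_curveP => i; move: (sc i); congr smooth1.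
by apply/funext => x; rewrite mxE.
Qed.

End SmoothCurves.

(** * Compactly supported functions and the formal inverse of d/dx *)

Section CompactlySupported.
Context {R : realType}.
Local Notation mu := (@lebesgue_measure R).
Implicit Types (f g A B : R -> R) (m : R).

Definition csupp m f : Prop := continuous f /\ forall x, m < `|x| -> f x = 0.

Definition integ f : R := \int[mu]_(x in setT) f x.

Lemma csupp_integrable m f : csupp m f -> mu.-integrable setT (EFin \o f).
Proof.
move=> [cf f0].
have : mu.-integrable `[- m, m] (EFin \o f).
  apply: continuous_compact_integrable; first exact: segment_compact.
  exact: continuous_subspaceT.
rewrite integrable_mkcond//.
apply: eq_integrable => // x _.
rewrite patchE mem_setE in_itv /= -ler_norml; case: leP => // mx.
by rewrite f0.
Qed.

Let csupp_integrableS m f (D : set R) : measurable D -> csupp m f ->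
  mu.-integrable D (EFin \o f).
Proof. by move=> mD /csupp_integrable; apply: integrableS. Qed.

Let lower f x := \int[mu]_(y in `]-oo, x]) f y.

Let lower_derive m f (x : R) : csupp m f -> is_derive x 1 (lower f) (f x).
Proof.
move=> sf; have [cf _] := sf.
have [||||df dfE] := @continuous_FTC1 R f -oo%O x (x + 1).
- by rewrite ltrDl.
- exact: csupp_integrableS sf.
- by rewrite ltNyr.
- exact: cf.
by apply: DeriveDef; [exact: df|rewrite -derive1E; exact: dfE].
Qed.

Let DinvE m f x : csupp m f -> Dinv f x = lower f x - 2^-1 * integ f.
Proof.
move=> sf; rewrite /Dinv -/(lower f x).
have -> : \int[mu]_(y in `[x, +oo[) f y = integ f - lower f x.
  rewrite -Rintegral_itv_obnd_cbnd; last exact: csupp_integrableS sf.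
  rewrite -(@Rintegral_itvB _ _ -oo%O)//; last exact: csupp_integrableS sf.
  by rewrite set_itvNyy.
lra.
Qed.

Lemma Dinv_derive m f (x : R) : csupp m f -> is_derive x 1 (Dinv f) (f x).
Proof.
move=> sf; rewrite (_ : Dinv f = lower f - cst (2^-1 * integ f)); last first.
  by apply/funext => y; rewrite (DinvE _ sf).
rewrite -[X in is_derive _ _ _ X]subr0; apply: is_deriveB.
exact: lower_derive sf.
Qed.

Lemma Dinv_right m f x : csupp m f -> m < x -> Dinv f x = 2^-1 * integ f.
Proof.
move=> sf mx; rewrite (DinvE _ sf).
have -> : lower f x = integ f.
  rewrite /integ -set_itvNyy; apply: subr0_eq; rewrite -opprB.
  rewrite Rintegral_itvB//; last exact: csupp_integrableS sf.
  rewrite (@eq_Rintegral _ _ _ _ _ (cst 0)).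
    by rewrite Rintegral_cst ?mul0r ?oppr0//.
  move=> y; rewrite inE/= in_itv/= andbT => xy; rewrite sf.2//.
  by apply: lt_le_trans (ler_norm y); exact: lt_trans xy.
lra.
Qed.

Lemma Dinv_left m f x : csupp m f -> x < - m -> Dinv f x = - (2^-1 * integ f).
Proof.
move=> sf mx; rewrite (DinvE _ sf).
have -> : lower f x = 0.
  rewrite /lower (@eq_Rintegral _ _ _ _ _ (cst 0)).
    by rewrite Rintegral_cst ?mul0r ?oppr0//.
  move=> y; rewrite inE/= in_itv/= => xy; rewrite sf.2//.
  by rewrite -normrN; apply: lt_le_trans (ler_norm _); lra.
by rewrite add0r.
Qed.

Lemma is_derive0_cst f : (forall x : R, is_derive x 1 f 0) -> forall x y, f x = f y.
Proof.
move=> df; suff H x y : x <= y -> f x = f y.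
  by move=> x y; have [|/ltW] := leP x y => /H.
move=> xy; have [|z _] := @MVT_segment R f (fun=> 0) x y xy.
  by apply: derivable_within_continuous => z _; have [] := df z.
by rewrite mul0r => /subr0_eq.
Qed.

(** [A - Dinv f] is constant, and the two end values of [Dinv f] differ by the whole integral. *)
Lemma integ_antiderivative m f A b : csupp m f ->
  (forall x : R, is_derive x 1 A (f x)) -> m < b -> integ f = A b - A (- b).
Proof.
move=> sf dA mb.
have E := @is_derive0_cst (A - Dinv f) _ b (- b).
have : (A - Dinv f) b = (A - Dinv f) (- b).
  apply: E => x; rewrite -(subrr (f x)); apply: is_deriveB.
  exact: Dinv_derive sf.
rewrite !fctE (Dinv_right sf mb) (@Dinv_left m)//; last by rewrite ltrN2.
lra.
Qed.

Lemma integ_derive0 m f B : csupp m f -> (forall x : R, is_derive x 1 B (f x)) ->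
  (forall x, m < `|x| -> B x = 0) -> integ f = 0.
Proof.
move=> sf dB B0; rewrite (@integ_antiderivative m _ B (`|m| + 1))//; last first.
  by have := ler_norm m; lra.
have mb : m < `|m| + 1 by have := ler_norm m; lra.
rewrite !B0 ?subrr// ?normrN ger0_norm//; have := normr_ge0 m; lra.
Qed.

(** Two antiderivatives differ by a constant, and opposite values at [b] and [- b], for a single [b]
    beyond the support, fix it. Linearity of [Dinv] is read off from this characterization. *)
Lemma Dinv_unique m f D b : csupp m f -> (forall x : R, is_derive x 1 D (f x)) ->
  m < b -> D b = - D (- b) -> Dinv f = D.
Proof.
move=> sf dD mb Db; apply/funext => x.
have : (D - Dinv f) x = (D - Dinv f) b.
  apply: is_derive0_cst => y; rewrite -(subrr (f y)); apply: is_deriveB.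
  exact: Dinv_derive sf.
have := integ_antiderivative sf dD mb.
rewrite !fctE (Dinv_right sf mb); lra.
Qed.

Lemma csuppD m f g : csupp m f -> csupp m g -> csupp m (fun x => f x + g x).
Proof.
move=> [cf f0] [cg g0]; split => [x|x mx]; last by rewrite f0 ?g0 ?addr0.
by apply: continuousD; [exact: cf|exact: cg].
Qed.

Lemma csuppMl m f g : continuous g -> csupp m f -> csupp m (fun x => g x * f x).
Proof.
move=> cg [cf f0]; split => [x|x mx]; last by rewrite f0 ?mulr0.
by apply: continuousM; [exact: cg|exact: cf].
Qed.

Lemma csuppMr m f g : continuous g -> csupp m f -> csupp m (fun x => f x * g x).
Proof.
move=> cg sf; rewrite (_ : (fun _ => _) = fun x => g x * f x); last first.
  by apply/funext => x; rewrite mulrC.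
exact: csuppMl.
Qed.

Lemma csuppZ m (k : R) f : csupp m f -> csupp m (fun x => k * f x).
Proof. by apply: csuppMl => ?; exact: cst_continuous. Qed.

Lemma csuppB m f g : csupp m f -> csupp m g -> csupp m (fun x => f x - g x).
Proof.
move=> sf sg; rewrite (_ : (fun _ => _) = fun x => f x + (-1 * g x)).
  by apply: csuppD => //; exact: csuppZ.
by apply/funext => x; rewrite mulN1r.
Qed.

Lemma csupp_sum m (I : Type) (r : seq I) (P : pred I) (F : I -> R -> R) :
  (forall k, csupp m (F k)) -> csupp m (fun y => \sum_(k <- r | P k) F k y).
Proof.
move=> sF; split => [|x mx]; last by rewrite big1// => k _; rewrite (sF k).2.
have -> : (fun y => \sum_(k <- r | P k) F k y) = \sum_(k <- r | P k) F k.
  by apply/funext => y; rewrite fct_sumE.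
elim/big_ind : _ => [x|u v cu cv x|k _]; first exact: cst_continuous.
- by apply: continuousD; [exact: cu|exact: cv].
- exact: (sF k).1.
Qed.

Lemma csupp_le m m' f : m <= m' -> csupp m f -> csupp m' f.
Proof. by move=> mm [cf f0]; split => // x mx; apply: f0; exact: le_lt_trans mx. Qed.

Lemma integD m f g : csupp m f -> csupp m g ->
  integ (fun x => f x + g x) = integ f + integ g.
Proof.
by move=> sf sg; rewrite /integ RintegralD//; exact: csupp_integrable (_ : csupp m _).
Qed.

Lemma integZ m k f : csupp m f -> integ (fun x => k * f x) = k * integ f.
Proof. by move=> sf; rewrite /integ RintegralZl//; exact: csupp_integrable sf. Qed.

Lemma integB m f g : csupp m f -> csupp m g ->
  integ (fun x => f x - g x) = integ f - integ g.
Proof.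
by move=> sf sg; rewrite /integ RintegralB//; exact: csupp_integrable (_ : csupp m _).
Qed.

Lemma integ_sum m (I : Type) (r : seq I) (P : pred I) (F : I -> R -> R) :
  (forall k, csupp m (F k)) ->
  integ (fun y => \sum_(k <- r | P k) F k y) = \sum_(k <- r | P k) integ (F k).
Proof.
move=> sF; elim: r => [|k r IH].
  rewrite big_nil (_ : (fun _ => _) = fun=> 0); last first.
    by apply/funext => y; rewrite big_nil.
  by rewrite /integ Rintegral_cst// mul0r.
rewrite (_ : (fun _ => _) = fun y => if P k then F k y + \sum_(j <- r | P j) F j y
    else \sum_(j <- r | P j) F j y); last first.
  by apply/funext => y; rewrite big_cons.
rewrite big_cons -IH; case: (P k) => //; rewrite (@integD m)//.
exact: csupp_sum.
Qed.

Lemma DinvD m f g x : csupp m f -> csupp m g ->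
  Dinv (fun x => f x + g x) x = Dinv f x + Dinv g x.
Proof.
move=> sf sg; pose b := m + 1; have mb : m < b by rewrite ltrDl.
have Nb : - b < - m by rewrite ltrN2.
have -> // : Dinv (fun x => f x + g x) = fun x => Dinv f x + Dinv g x.
apply: (@Dinv_unique m _ _ b); last 2 first.
- exact: mb.
- rewrite (Dinv_right sf mb) (Dinv_right sg mb).
  rewrite (Dinv_left sf Nb) (Dinv_left sg Nb); lra.
- exact: csuppD.
- by move=> y; apply: is_deriveD_fun; [exact: Dinv_derive sf|exact: Dinv_derive sg].
Qed.

Lemma DinvZ m k f x : csupp m f -> Dinv (fun x => k * f x) x = k * Dinv f x.
Proof.
move=> sf; pose b := m + 1; have mb : m < b by rewrite ltrDl.
have Nb : - b < - m by rewrite ltrN2.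
have -> // : Dinv (fun x => k * f x) = fun x => k * Dinv f x.
apply: (@Dinv_unique m _ _ b); last 2 first.
- exact: mb.
- rewrite (Dinv_right sf mb) (Dinv_left sf Nb); lra.
- exact: csuppZ.
- by move=> y; apply: is_deriveZ_fun; exact: Dinv_derive sf.
Qed.

Lemma DinvB m f g x : csupp m f -> csupp m g ->
  Dinv (fun x => f x - g x) x = Dinv f x - Dinv g x.
Proof.
move=> sf sg; rewrite -mulN1r -(DinvZ _ _ sg) -(@DinvD m)//; last exact: csuppZ.
by congr Dinv; apply/funext => y; rewrite mulN1r.
Qed.

Lemma Dinv_continuous m f : csupp m f -> continuous (Dinv f).
Proof.
move=> sf x; apply/differentiable_continuous/derivable1_diffP.
by have [] := Dinv_derive x sf.
Qed.

(* (Dinv f Dinv g)' = f Dinv g + g Dinv f, and Dinv f Dinv g takes the same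
   value on both sides of the supports. *)
Lemma Dinv_skew m f g : csupp m f -> csupp m g ->
  integ (fun x => f x * Dinv g x) = - integ (fun x => g x * Dinv f x).
Proof.
move=> sf sg; pose b := m + 1; have mb : m < b by rewrite ltrDl.
have Nb : - b < - m by rewrite ltrN2.
have sfg : csupp m (fun x => f x * Dinv g x).
  by apply: csuppMr => //; exact: Dinv_continuous sg.
have sgf : csupp m (fun x => g x * Dinv f x).
  by apply: csuppMr => //; exact: Dinv_continuous sf.
apply/eqP; rewrite -addr_eq0 -(integD sfg sgf); apply/eqP.
have dfg (x : R) : is_derive x 1 (fun x => Dinv f x * Dinv g x)
    (f x * Dinv g x + g x * Dinv f x).
  rewrite addrC [f x * _]mulrC [g x * _]mulrC.
  by apply: is_deriveM_fun; [exact: Dinv_derive sf|exact: Dinv_derive sg].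
have -> := integ_antiderivative (csuppD sfg sgf) dfg mb.
rewrite (Dinv_right sf mb) (Dinv_right sg mb).
rewrite (Dinv_left sf Nb) (Dinv_left sg Nb); ring.
Qed.

(** The mean value theorem bounds the increments of [Dinv f] from the left end to [x] and from [x]
    to the right end. In their difference the opposite end values cancel, which leaves twice
    [Dinv f x] against a total length 2 (m + 1). *)
Lemma Dinv_bound m f (B x : R) : csupp m f -> (forall x, `|f x| <= B) -> `|x| <= m + 1 ->
  `|Dinv f x| <= (m + 1) * B.
Proof.
move=> sf fB; rewrite ler_norml => /andP[mx xm].
pose b := m + 1; have mb : m < b by rewrite ltrDl.
have Nb : - b < - m by rewrite ltrN2.
have cD c d : {within `[c, d], continuous (Dinv f)}.
  exact/continuous_subspaceT/(Dinv_continuous sf).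
have dD (y : R) : is_derive y 1 (Dinv f) (f y) by exact: Dinv_derive sf.
have [u _] := MVT_segment mx (fun y _ => dD y) (cD _ _).
have [v _] := MVT_segment xm (fun y _ => dD y) (cD _ _).
rewrite (Dinv_right sf mb) (Dinv_left sf Nb) => E1 E2.
have := fB u; have := fB v; rewrite !ler_norml => /andP[? ?] /andP[? ?].
rewrite -/b in mx xm E1 E2 *.
by apply/andP; split; nra.
Qed.

(** At [m + 1], to the right of the support, [Dinv f] equals half of the integral; hence the factor
    2 in front of the bound for [Dinv]. *)
Lemma integ_bound m f (B : R) : csupp m f -> 0 <= m -> (forall x, `|f x| <= B) ->
  `|integ f| <= 2 * (m + 1) * B.
Proof.
move=> sf m0 fB; have mb : m < m + 1 by rewrite ltrDl.
have := @Dinv_bound m f B (m + 1) sf fB.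
rewrite ger0_norm; last lra.
move=> /(_ (lexx _)); rewrite (Dinv_right sf mb) normrM ger0_norm//; lra.
Qed.

End CompactlySupported.

(** * Expansions along families of curves *)

Section UniformTaylor.
Context {R : realType}.

Lemma norm_coord (p : nat) (v : 'rV[R]_p) k : `|v 0 k| <= `|v|.
Proof.
by rewrite [leRHS]/Num.Def.normr/= mx_normrE; exact: (le_bigmax _ _ (0, k)).
Qed.

Lemma norm_rV_le (p : nat) (v : 'rV[R]_p) B : 0 <= B ->
  (forall k, `|v 0 k| <= B) -> `|v| <= B.
Proof.
move=> B0 vB; rewrite [leLHS]/Num.Def.normr/= mx_normrE (bigmax_le _ B0)//= => -[i k] _.
by rewrite ord1.
Qed.

Lemma is_derive_partial_line (p : nat) (f : 'rV[R]_p -> R) (y v : 'rV[R]_p) (t : R) :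
  differentiable f (y + t *: v) ->
  is_derive t 1 (fun s => f (y + s *: v)) (\sum_k v 0 k * partial k f (y + t *: v)).
Proof.
move=> df; apply: is_derive_eq; first exact: is_derive_line.
by rewrite derive_partial.
Qed.

(** Compactness of the window makes the radius and the bound independent of [x]. The near-covering
    form of compactness is applied to the product filter of [v] near 0 and [N] near infinity, so
    that both come out at once. *)
Lemma uniform_local_bound (p : nat) (I : finType) (D : set 'rV[R]_p)
    (G : I -> 'rV[R]_p -> R) (y : R -> 'rV[R]_p) (m : R) : open D ->
  (forall i z, D z -> {for z, continuous (G i)}) -> continuous y ->
  (forall x, `|x| <= m -> D (y x)) ->
  exists2 d, 0 < d & exists2 N, 0 <= N & forall x v, `|x| <= m -> `|v| < d ->
    D (y x + v) /\ forall i, `|G i (y x + v)| <= N.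
Proof.
move=> oD cG cy Dy.
pose P (q : 'rV[R]_p * R) x := D (y x + q.1) /\
  forall i, `|G i (y x + q.1)| <= q.2.
have : \forall q \near filter_prod (nbhs (0 : 'rV[R]_p)) (pinfty_nbhs R),
    `[- m, m]%classic `<=` P q.
  have /compact_near_coveringP := @segment_compact R (- m) m.
  apply => x; rewrite /= in_itv/= -ler_norml => xm.
  have cyv : (fun q : R * 'rV[R]_p => y q.1 + q.2) @ ((x : R), (0 : 'rV[R]_p)) -->
      y x + 0.
    apply: cvgD; last exact: cvg_snd.
    by apply: (@cvg_comp _ _ _ fst y _ (nbhs x)); [exact: cvg_fst|exact: cy].
  rewrite addr0 in cyv.
  (* The sum dominates each single value at [y x]; the summand 1 pays for the variation of [G i]
     near [y x]. *)
  pose N0 := \sum_i `|G i (y x)| + 1.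
  have nz : \forall z \near y x, D z /\ forall i, `|G i z| <= N0.
    have nD : \forall z \near y x, D z by apply: open_nbhs_nbhs; split => //; exact: Dy.
    suff H : \forall z \near y x, forall i, `|G i z| <= N0.
      near=> z; split; first by near: z.
      by move=> i; exact: (near H z).
    refine (filter_forall (f := fun i z => `|G i z| <= N0) (nbhs_filter (y x)) _) => i /=.
    have := cG i _ (Dy _ xm).
    move=> /cvgrPdist_lt /(_ 1 ltr01); apply: filterS => z.
    rewrite distrC => zx; rewrite -(subrK (G i (y x)) (G i z)).
    apply: le_trans (ler_normD _ _) _.
    apply: (@le_trans _ _ (1 + `|G i (y x)|)); first by rewrite lerD2r; exact: ltW.
    rewrite /N0 [1 + _]addrC lerD2r [leRHS](bigD1 i)//= lerDl.
    exact: sumr_ge0.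
  case: (cyv _ nz) => -[A1 A2] /= [nA1 nA2] A12.
  exists (A1, A2 `*` [set N | N0 <= N]).
    split => //=; exists (A2, [set N | N0 <= N]) => //=; split => //.
    by exists N0; split; [exact: num_real|move=> N; exact: ltW].
  move=> -[x' [v N]] [/= A1x [A2v N0N]].
  have [/= ? H] := A12 (x', v) (conj A1x A2v).
  by split => //= i; exact: le_trans (H i) N0N.
move=> [[A M] /= [/nbhs_norm0P[d /= d0 dA] [N0 [_ N0M]]] AM].
exists d => //; exists (`|N0| + 1); first by rewrite addr_ge0.
move=> x v xm vd; apply: (AM (v, `|N0| + 1)).
  by split => /=; [exact: dA|apply: N0M; have := ler_norm N0; lra].
by rewrite /= in_itv/= -ler_norml.
Unshelve. all: by end_near. Qed.

Lemma uniform_second_order_bound (p : nat) (D : set 'rV[R]_p) (f : 'rV[R]_p -> R)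
    (y : R -> 'rV[R]_p) (m : R) : open D -> smooth_on D f -> continuous y ->
  (forall x, `|x| <= m -> D (y x)) ->
  exists2 d, 0 < d & exists2 N, 0 <= N & forall x v, `|x| <= m -> `|v| < d ->
    D (y x + v) /\ forall k l, `|partial k (partial l f) (y x + v)| <= N.
Proof.
move=> oD sf cy Dy.
have [|d d0 [N N0 H]] := uniform_local_bound
    (G := fun (kl : 'I_p * 'I_p) => partial kl.1 (partial kl.2 f)) oD _ cy Dy.
  move=> kl z Dz; apply: differentiable_continuous.
  by apply: smooth_on_differentiable Dz; do 2 apply: smooth_on_partial.
exists d => //; exists N => // x v xm vd; have [? HG] := H x v xm vd.
by split => // k l; exact: (HG (k, l)).
Qed.

Lemma taylor2_bound (t0 t1 t2 : R -> R) (B : R) :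
  (forall t : R, 0 <= t <= 1 -> is_derive t 1 t0 (t1 t)) ->
  (forall t : R, 0 <= t <= 1 -> is_derive t 1 t1 (t2 t)) ->
  (forall t : R, 0 <= t <= 1 -> `|t2 t| <= B) ->
  `|t0 1 - t0 0 - t1 0| <= B.
Proof.
move=> d0 d1 bB.
have mvt (f g : R -> R) (s : R) : 0 <= s -> s <= 1 ->
    (forall t : R, 0 <= t <= 1 -> is_derive t 1 f (g t)) ->
    exists2 c, 0 <= c <= s & f s - f 0 = g c * s.
  move=> s0 s1 df.
  have df' (t : R) : t \in `]0, s[ -> is_derive t 1 f (g t).
    by rewrite in_itv/= => /andP[t0' ts]; apply: df; apply/andP; split; lra.
  have cf : {within `[0, s], continuous f}.
    apply: derivable_within_continuous => t; rewrite in_itv/= => /andP[t0' ts].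
    by have [] := df t; first (apply/andP; split; lra).
  have [c cs E] := MVT_segment s0 df' cf.
  by exists c; rewrite ?subr0 in E *.
have [c /andP[c0 c1] E] := mvt t0 t1 1 ler01 (lexx _) d0.
have [c' /andP[c0' c1'] E'] := mvt t1 t2 c c0 c1 d1.
rewrite E mulr1 E' normrM (ger0_norm c0).
have b' : `|t2 c'| <= B by apply: bB; apply/andP; split; lra.
by have := normr_ge0 (t2 c'); nra.
Qed.

Lemma uniform_taylor (p : nat) (D : set 'rV[R]_p) (f : 'rV[R]_p -> R)
    (y : R -> 'rV[R]_p) (m : R) : open D -> smooth_on D f -> continuous y ->
  (forall x, `|x| <= m -> D (y x)) ->
  exists2 d, 0 < d & exists2 C, 0 <= C & forall x v, `|x| <= m -> `|v| < d ->
    D (y x + v) /\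
    `|f (y x + v) - f (y x) - \sum_k v 0 k * partial k f (y x)| <= C * `|v| ^+ 2.
Proof.
move=> oD sf cy Dy.
have [d d0 [N N0 H]] := uniform_second_order_bound oD sf cy Dy.
(* The second derivative along [v] is a sum of [p ^ 2] terms, each at most N times the square of the
   norm of [v]; the factor 1/2 of Taylor's formula is given away. *)
exists d => //; exists ((p ^ 2)%:R * N); first by rewrite mulr_ge0.
move=> x v xm vd; split; first by have [] := H x v xm vd.
have tv (t : R) : 0 <= t <= 1 -> `|t *: v| < d.
  move=> /andP[t0 t1]; rewrite normrZ ger0_norm//.
  by apply: le_lt_trans vd; rewrite ler_piMl.
have Dt (t : R) : 0 <= t <= 1 -> D (y x + t *: v).
  by move=> t01; have [] := H x _ xm (tv t t01).
have := @taylor2_bound (fun t => f (y x + t *: v))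
  (fun t => \sum_k v 0 k * partial k f (y x + t *: v))
  (fun t => \sum_k v 0 k * \sum_l v 0 l * partial l (partial k f) (y x + t *: v))
  ((p ^ 2)%:R * N * `|v| ^+ 2).
rewrite scale1r scale0r addr0; apply.
- move=> t t01; apply: is_derive_partial_line.
  exact: smooth_on_differentiable sf (Dt t t01).
- move=> t t01; apply: is_derive_sum_fun => k; apply: is_deriveZ_fun.
  have dk : differentiable (partial k f) (y x + t *: v).
    by apply: smooth_on_differentiable (Dt t t01); exact: smooth_on_partial.
  exact: is_derive_partial_line.
- move=> t t01; have [_ HN] := H x _ xm (tv t t01).
  apply: le_trans (ler_norm_sum _ _ _) _.
  apply: le_trans (_ : \sum_(k < p) p%:R * N * `|v| ^+ 2 <= _); last first.
    rewrite sumr_const card_ord -mulr_natl expnS expn1 natrM le_eqVlt.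
    by apply/orP; left; apply/eqP; ring.
  apply: ler_sum => k _; rewrite normrM.
  apply: le_trans (_ : `|v| * (\sum_(l < p) `|v| * N) <= _).
    apply: ler_pM => //; first exact: norm_coord.
    apply: le_trans (ler_norm_sum _ _ _) _; apply: ler_sum => l _.
    by rewrite normrM; apply: ler_pM => //; exact: norm_coord.
  rewrite sumr_const card_ord -mulr_natl le_eqVlt; apply/orP; left.
  by apply/eqP; ring.
Qed.

Lemma bounded_on (h : R -> R) (m : R) : continuous h ->
  exists2 B, 0 <= B & forall x, `|x| <= m -> `|h x| <= B.
Proof.
move=> ch; have [m0|m0] := ltP m 0.
  by exists 0 => // x xm; have := normr_ge0 x; lra.
have cnf : {within `[- m, m], continuous (fun x => `|h x|)}.
  apply: continuous_subspaceT => x; apply: continuous_comp; first exact: ch.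
  exact: norm_continuous.
have [|z _ Hz] := EVT_max _ cnf; first lra.
by exists `|h z| => // x xm; apply: Hz; rewrite in_itv/= -ler_norml.
Qed.

End UniformTaylor.

(** * First-order expansions with a uniform quadratic remainder *)

Section Jets.
Context {R : realType}.
Implicit Types (p q : R -> R -> R) (h : R -> R) (m : R).

(** [p1] is the derivative in [e] at 0, uniformly over the window. The bounds on [p 0] and [p1]
    belong to the notion because the product rule multiplies remainders by them. A single constant
    serves all three estimates. *)
Definition jet m p (p1 : R -> R) : Prop := exists2 B, 0 <= B &
  (forall x, `|x| <= m -> `|p 0 x| <= B /\ `|p1 x| <= B) /\
  exists2 d, 0 < d & forall e x, `|e| < d -> `|x| <= m ->
    `|p e x - p 0 x - e * p1 x| <= B * e ^+ 2.

Lemma jet_cst m h : continuous h -> jet m (fun=> h) (fun=> 0).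
Proof.
move=> ch; have [B B0 hB] := bounded_on m ch.
exists B => //; split => [x xm|]; first by rewrite normr0; split => //; exact: hB.
exists 1 => // e x _ _; rewrite mulr0 subr0 subrr normr0 mulr_ge0//.
exact: sqr_ge0.
Qed.

Lemma jetD m p q (p1 q1 : R -> R) : jet m p p1 -> jet m q q1 ->
  jet m (fun e x => p e x + q e x) (fun x => p1 x + q1 x).
Proof.
move=> [B B0 [pB [d d0 pd]]] [B' B'0 [qB [d' d'0 qd]]].
exists (B + B'); first exact: addr_ge0.
split => [x xm|].
  have [? ?] := pB x xm; have [? ?] := qB x xm.
  by split; apply: le_trans (ler_normD _ _) _; exact: lerD.
exists (Num.min d d'); first by rewrite lt_min d0.
move=> e x; rewrite lt_min => /andP[ed ed'] xm.
rewrite (_ : _ - _ - _ = (p e x - p 0 x - e * p1 x) + (q e x - q 0 x - e * q1 x)).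
  by rewrite mulrDl; apply: le_trans (ler_normD _ _) _; apply: lerD; [exact: pd|exact: qd].
by ring.
Qed.

Lemma jetM m p q (p1 q1 : R -> R) : jet m p p1 -> jet m q q1 ->
  jet m (fun e x => p e x * q e x) (fun x => p1 x * q 0 x + p 0 x * q1 x).
Proof.
move=> [B0 B00 [pB0 [d d0 pd0]]] [B' B'0 [qB' [d' d'0 qd']]].
pose B := B0 + B'; have B_ge0 : 0 <= B by exact: addr_ge0.
have pB x : `|x| <= m -> `|p 0 x| <= B /\ `|p1 x| <= B.
  by move=> xm; have [? ?] := pB0 x xm; rewrite /B; split; lra.
have qB x : `|x| <= m -> `|q 0 x| <= B /\ `|q1 x| <= B.
  by move=> xm; have [? ?] := qB' x xm; rewrite /B; split; lra.
(* With remainders r and s of the two factors, the product leaves r q + p0 s + e p1 (e q1 + s). For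
   [e] below 1 in absolute value these terms are at most 3, 1 and 2 times B^2 e^2. *)
exists (6 * B ^+ 2); first by rewrite mulr_ge0// sqr_ge0.
split => [x xm|].
  have [p0B p1B] := pB x xm; have [q0B q1B] := qB x xm.
  have M u v : `|u| <= B -> `|v| <= B -> `|u * v| <= B ^+ 2.
    by move=> uB vB; rewrite normrM expr2; exact: ler_pM.
  have B20 : 0 <= B ^+ 2 by exact: sqr_ge0.
  split; first by have := M _ _ p0B q0B; lra.
  apply: le_trans (ler_normD _ _) _.
  by have := M _ _ p1B q0B; have := M _ _ p0B q1B; lra.
exists (Num.min 1 (Num.min d d')); first by rewrite !lt_min d0 d'0 ltr01.
move=> e x; rewrite !lt_min => /andP[e1 /andP[ed ed']] xm.
have [p0B p1B] := pB x xm; have [q0B q1B] := qB x xm.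
have rB : `|p e x - p 0 x - e * p1 x| <= B * `|e| ^+ 2.
  rewrite real_normK ?num_real//; apply: le_trans (pd0 e x ed xm) _.
  by rewrite ler_wpM2r ?sqr_ge0// /B lerDl.
have sB : `|q e x - q 0 x - e * q1 x| <= B * `|e| ^+ 2.
  rewrite real_normK ?num_real//; apply: le_trans (qd' e x ed' xm) _.
  by rewrite ler_wpM2r ?sqr_ge0// /B lerDr.
set r := p e x - _ - _ in rB; set s := q e x - _ - _ in sB.
have -> : p e x = p 0 x + e * p1 x + r by rewrite /r; ring.
have -> : q e x = q 0 x + e * q1 x + s by rewrite /s; ring.
rewrite (_ : _ - _ - _ = r * (q 0 x + e * q1 x + s) + p 0 x * s +
   e * p1 x * (e * q1 x + s)); last by ring.
have e0 : 0 <= `|e| by [].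
have e21 : `|e| ^+ 2 <= 1 by rewrite expr_le1// ltW.
have e20 : 0 <= `|e| ^+ 2 by rewrite exprn_ge0.
have sB1 : `|s| <= B by apply: le_trans sB _; rewrite ler_piMr.
have eq1 : `|e * q1 x| <= B * `|e| by rewrite normrM mulrC; exact: ler_wpM2r.
have eq1' : `|e * q1 x| <= B by apply: le_trans eq1 _; rewrite ler_piMr// ltW.
have sBe : `|s| <= B * `|e|.
  by apply: le_trans sB _; rewrite expr2 mulrA ler_piMr ?mulr_ge0// ltW.
rewrite -(real_normK (num_real e)).
apply: (@le_trans _ _ (B * `|e| ^+ 2 * (3 * B) + B * (B * `|e| ^+ 2) +
   B * `|e| * (2 * (B * `|e|)))); last first.
  by rewrite le_eqVlt; apply/orP; left; apply/eqP; ring.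
apply: le_trans (ler_normD _ _) _; apply: lerD.
  apply: le_trans (ler_normD _ _) _; apply: lerD.
    rewrite normrM; apply: ler_pM => //.
    apply: le_trans (ler_normD _ _) _.
    have := ler_normD (q 0 x) (e * q1 x); lra.
  by rewrite normrM; exact: ler_pM.
rewrite normrM; apply: ler_pM => //.
  by rewrite normrM mulrC; exact: ler_wpM2r.
by apply: le_trans (ler_normD _ _) _; lra.
Qed.

Lemma eq_jet m p (p1 : R -> R) p' (p1' : R -> R) : jet m p p1 -> (forall e x, p e x = p' e x) ->
  (forall x, p1 x = p1' x) -> jet m p' p1'.
Proof.
move=> jp pp pp1; have -> : p' = p by apply/funext => e; apply/funext => x.
by have -> : p1' = p1 by apply/funext => x.
Qed.

Lemma jetN m p (p1 : R -> R) : jet m p p1 -> jet m (fun e x => - p e x) (fun x => - p1 x).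
Proof.
have c1 : continuous (fun _ : R => -1 : R) by move=> ?; exact: cst_continuous.
move=> /(jetM (jet_cst m c1)) jp; apply: eq_jet jp _ _ => [e x|x].
  by rewrite mulN1r.
by rewrite mul0r add0r mulN1r.
Qed.

Lemma jetB m p q (p1 q1 : R -> R) : jet m p p1 -> jet m q q1 ->
  jet m (fun e x => p e x - q e x) (fun x => p1 x - q1 x).
Proof. by move=> jp jq; exact: (jetD jp (jetN jq)). Qed.

Lemma jet_sum m (I : Type) (r : seq I) (p : I -> R -> R -> R) (p1 : I -> R -> R) :
  (forall i, jet m (p i) (p1 i)) ->
  jet m (fun e x => \sum_(i <- r) p i e x) (fun x => \sum_(i <- r) p1 i x).
Proof.
move=> jp; elim: r => [|i r IH].
  have c0 : continuous (fun _ : R => 0 : R) by move=> ?; exact: cst_continuous.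
  by apply: eq_jet (jet_cst m c0) _ _ => [e x|x]; rewrite big_nil.
by apply: eq_jet (jetD (jp i) IH) _ _ => [e x|x]; rewrite big_cons.
Qed.

Lemma jet_id m h : continuous h -> jet m (fun e x => e * h x) h.
Proof.
move=> ch; have [B B0 hB] := bounded_on m ch.
exists B => //; split => [x xm|].
  by rewrite mul0r normr0; split => //; exact: hB.
exists 1 => // e x _ _; rewrite mul0r subr0 subrr normr0 mulr_ge0//.
exact: sqr_ge0.
Qed.

Lemma jet_affine m h (k : R -> R) : continuous h -> continuous k ->
  jet m (fun e x => h x + e * k x) k.
Proof.
move=> ch ck; apply: eq_jet (jetD (jet_cst m ch) (jet_id m ck)) _ _ => [e x|x] //.
by rewrite add0r.
Qed.

Lemma jet_comp m (n : nat) (U : set 'rV[R]_n) f (c phi : R -> 'rV[R]_n) :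
  open U -> smooth_on U f -> continuous c -> continuous phi ->
  (forall x, `|x| <= m -> U (c x)) ->
  jet m (fun e x => f (c x + e *: phi x))
        (fun x => \sum_k partial k f (c x) * phi x 0 k).
Proof.
move=> oU sf cc cphi cU.
have [d d0 [C C0 H]] := uniform_taylor oU sf cc cU.
have [|df df0 [B1 B10 fB1]] := uniform_local_bound
    (G := fun _ : unit => f) oU _ cc cU.
  by move=> _ z Uz; apply: differentiable_continuous; exact: smooth_on_differentiable Uz.
have [|dN dN0 [N N0 HN]] := uniform_local_bound
    (G := fun k => partial k f) oU _ cc cU.
  move=> k z Uz; apply: differentiable_continuous.
  by apply: smooth_on_differentiable Uz; exact: smooth_on_partial.
have cn : continuous (fun x => `|phi x|).
  by move=> x; apply: continuous_comp; [exact: cphi|exact: norm_continuous].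
have [P P0 phiP0] := bounded_on m cn.
have phiP x : `|x| <= m -> `|phi x| <= P by move=> /phiP0; rewrite normr_id.
exists (B1 + n%:R * (N * P) + C * P ^+ 2).
  by rewrite !addr_ge0 ?mulr_ge0 ?sqr_ge0.
have nNP : 0 <= n%:R * (N * P) by rewrite !mulr_ge0.
have CP2 : 0 <= C * P ^+ 2 by rewrite mulr_ge0 ?sqr_ge0.
split => [x xm|].
  have [|_ /(_ tt)] := fB1 x 0 xm; first by rewrite normr0.
  have [|_ HNx] := HN x 0 xm; first by rewrite normr0.
  rewrite addr0 scale0r addr0 => fB; split; first lra.
  apply: (@le_trans _ _ (n%:R * (N * P))); last lra.
  apply: le_trans (ler_norm_sum _ _ _) _.
  rewrite mulr_natl -[X in _ <= _ *+ X]card_ord -sumr_const; apply: ler_sum => k _.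
  rewrite normrM; apply: ler_pM => //; first by have := HNx k; rewrite addr0.
  by apply: le_trans (norm_coord _ _) _; exact: phiP.
exists (d / (P + 1)); first by rewrite divr_gt0// ltr_wpDl.
move=> e x; rewrite ltr_pdivlMr ?ltr_wpDl// => ed xm.
have ephi : `|e *: phi x| <= `|e| * P.
  by rewrite normrZ; apply: ler_wpM2l => //; exact: phiP.
have [|_] := H x (e *: phi x) xm.
  by apply: le_lt_trans ephi _; apply: le_lt_trans ed; rewrite ler_wpM2l// lerDl.
rewrite scale0r addr0.
have -> : e * (\sum_k partial k f (c x) * phi x 0 k) =
    \sum_k (e *: phi x) 0 k * partial k f (c x).
  by rewrite mulr_sumr; apply: eq_bigr => k _; rewrite mxE; ring.
move=> /le_trans; apply.
apply: (@le_trans _ _ (C * P ^+ 2 * e ^+ 2)); last first.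
  by apply: ler_wpM2r; [exact: sqr_ge0|lra].
rewrite -mulrA -exprMn; apply: ler_wpM2l => //.
rewrite -[leRHS]real_normK ?num_real// ler_sqr ?nnegrE//.
by apply: le_trans ephi _; rewrite normrM (ger0_norm P0) mulrC.
Qed.

(** On functions supported in the window [Dinv] is linear and bounded for the sup norm, so it
    carries the uniform remainder of [q] to a uniform remainder of [Dinv (q e)]. *)
Lemma jet_Dinv m q (q1 : R -> R) : 0 <= m -> (exists2 d, 0 < d & forall e, `|e| < d ->
  csupp m (q e)) -> csupp m q1 -> jet m q q1 -> jet m (fun e => Dinv (q e)) (Dinv q1).
Proof.
move=> m0 [d0 d00 cq] cq1 [B B0 [qB [d d1 qd]]].
have M1 : 1 <= m + 1 by lra.
have cq0 : csupp m (q 0) by apply: cq; rewrite normr0.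
have far (h : R -> R) (b : R) : 0 <= b -> csupp m h ->
    (forall x, `|x| <= m -> `|h x| <= b) -> forall x, `|h x| <= b.
  move=> b0 ch hb x; have [mx|xm] := ltP m `|x|; last exact: hb.
  by rewrite ch.2// normr0.
have Db (h : R -> R) (b : R) : 0 <= b -> csupp m h ->
    (forall x, `|x| <= m -> `|h x| <= b) ->
    forall x, `|x| <= m -> `|Dinv h x| <= (m + 1) * b.
  move=> b0 ch hb x xm; apply: (Dinv_bound ch (far h b b0 ch hb)).
  by apply: le_trans xm _; lra.
exists ((m + 1) * B); first by rewrite mulr_ge0//; lra.
split => [x xm|].
  split; apply: Db => // y ym; first by have [] := qB y ym.
  by have [] := qB y ym.
exists (Num.min d0 d); first by rewrite lt_min d00.
move=> e x; rewrite lt_min => /andP[ed0 ed] xm.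
have ce := cq e ed0.
have cr : csupp m (fun x => q e x - q 0 x - e * q1 x).
  exact: csuppB (csuppB ce cq0) (csuppZ e cq1).
rewrite -(DinvZ e _ cq1) -(DinvB _ ce cq0) -(DinvB _ (csuppB ce cq0) (csuppZ e cq1)).
rewrite -mulrA; apply: Db => //; first by rewrite mulr_ge0// sqr_ge0.
by move=> y ym; exact: qd.
Qed.

Lemma is_derive_quadratic (F : R -> R) (L C d : R) : 0 < d ->
  (forall e, `|e| < d -> `|F e - F 0 - e * L| <= C * e ^+ 2) ->
  is_derive (0 : R) 1 F L.
Proof.
move=> d0 FL.
have H : h^-1 *: ((F \o shift 0) (h *: 1) - F 0) @[h --> 0^'] --> L.
  apply/cvgrPdist_le => eps eps0; near=> h.
  have h0 : h != 0 by near: h; exact: nbhs_dnbhs_neq.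
  have nh0 : 0 < `|h| by rewrite normr_gt0.
  have hd : `|h| < d by near: h; exact: dnbhs0_lt.
  have hC : `|h| <= eps / (`|C| + 1).
    by near: h; apply: dnbhs0_le; rewrite divr_gt0// ltr_wpDl.
  rewrite /= addr0 [h *: 1]mulr1 distrC.
  have -> : h^-1 *: (F h - F 0) - L = h^-1 * (F h - F 0 - h * L).
    by rewrite [in RHS]mulrBr mulKf.
  rewrite normrM normfV ler_pdivrMl//.
  apply: le_trans (FL h hd) _.
  rewrite ler_pdivlMr ?ltr_wpDl// in hC.
  rewrite -(real_normK (num_real h)) expr2 [leRHS]mulrC mulrCA [leRHS]mulrC.
  rewrite ler_pM2l// mulrC; have := ler_norm C; nra.
apply: DeriveDef; first by apply/cvg_ex; exists L.
exact: cvg_lim H.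
Unshelve. all: by end_near. Qed.

(** Differentiation under the integral sign: the remainder is supported in the window and uniformly
    of order e^2, hence so is its integral. *)
Lemma jet_integ m p (p1 : R -> R) : 0 <= m -> (exists2 d, 0 < d & forall e, `|e| < d ->
  csupp m (p e)) -> csupp m p1 -> jet m p p1 ->
  is_derive (0 : R) 1 (fun e => integ (p e)) (integ p1).
Proof.
move=> m0 [d0 d00 cp] cp1 [B B0 [pB [d d1 pd]]].
have cp0 : csupp m (p 0) by apply: cp; rewrite normr0.
apply: (@is_derive_quadratic _ _ (2 * (m + 1) * B) (Num.min d0 d)).
  by rewrite lt_min d00.
move=> e; rewrite lt_min => /andP[ed0 ed].
have ce := cp e ed0.
rewrite -(integZ e cp1) -(integB ce cp0) -(integB (csuppB ce cp0) (csuppZ e cp1)).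
rewrite -mulrA; apply: integ_bound => //.
  exact: csuppB (csuppB ce cp0) (csuppZ e cp1).
move=> x; have [mx|xm] := ltP m `|x|; last exact: pd.
by rewrite ce.2// cp0.2// cp1.2// mulr0 !subr0 normr0 mulr_ge0// sqr_ge0.
Qed.

End Jets.

Lemma derive_along (R : realType) (V : normedModType R) (f : V -> R) (g : R -> R)
  (t : R) (x v : V) : (forall h, f (h *: v + x) = g (h + t)) ->
  'D_v f x = derive1 g t.
Proof.
move=> fg; rewrite derive1E /derive.
set u := (fun _ : R => _); set u' := (fun _ : R => _).
suff -> : u = u' by [].
apply/funext => h; rewrite /u /u' /= fg [h *: 1]mulr1.
by have := fg 0; rewrite scale0r !add0r => ->.
Qed.

(** * Gradients of functionals along families of curves *)

Section GradientFamilies.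
Context {R : realType} {n : nat} {U : set 'rV[R]_n}.
Implicit Types (F : functional U) (c phi psi : R -> 'rV[R]_n).

Definition affine_family (p : nat) c (phi : 'I_p -> R -> 'rV[R]_n) (z : 'rV[R]_p) :
  R -> 'rV[R]_n := fun x => c x + \sum_k z 0 k *: phi k x.

(** This is [F''[phi]] at [c], as a covector field along the curve. *)
Definition dgrad F c phi : R -> 'rV[R]_n := fun x =>
  \row_i derive1 (fun e => fgrad F (fun y => c y + e *: phi y) x 0 i) 0.

Lemma affine_family_smooth (p : nat) c (phi : 'I_p -> R -> 'rV[R]_n) :
  smooth_curve c -> (forall k, smooth_curve (phi k)) ->
  smooth_family (affine_family c phi).
Proof.
move=> sc sphi i; apply: smooth_exprP; first exact: openT.
rewrite (_ : (fun z => _) = fun z : 'rV[R]_(p + 1) => c (z 0 (rshift p 0)) 0 i +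
   \sum_k z 0 (lshift 1 k) * phi k (z 0 (rshift p 0)) 0 i).
  apply: smooth_expr_add.
    exact: (@smooth1_coord _ _ setT _ (rshift p 0) (@smooth_curve_coord _ _ _ i sc)).
  apply: (@smooth_expr_sum _ _ _ _ _ _
    (fun k (z : 'rV[R]_(p + 1)) => z 0 (lshift 1 k) * phi k (z 0 (rshift p 0)) 0 i)) => k.
  apply: (@smooth_expr_mul _ _ _ (fun z : 'rV[R]_(p + 1) => z 0 (lshift 1 k))
    (fun z : 'rV[R]_(p + 1) => phi k (z 0 (rshift p 0)) 0 i)).
    by apply: smooth_expr_base; exact: smooth_on_coord.
  exact: (@smooth1_coord _ _ setT _ (rshift p 0) (@smooth_curve_coord _ _ _ i (sphi k))).
apply/funext => z; rewrite !mxE summxE; congr (_ + _).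
by apply: eq_bigr => k _; rewrite !mxE.
Qed.

Definition family_point (p : nat) (v : 'rV[R]_p) (x : R) : 'rV[R]_(p + 1) :=
  row_mx v (const_mx x).

Lemma family_pointE (p : nat) (v : 'rV[R]_p) x :
  (lsubmx (family_point v x) = v) * (rsubmx (family_point v x) 0 0 = x).
Proof. by rewrite /family_point row_mxKl row_mxKr mxE. Qed.

Lemma family_pointD (p : nat) (v : 'rV[R]_p) x :
  family_point v x = family_point 0 x + row_mx v 0.
Proof. by rewrite /family_point add_row_mx add0r addr0. Qed.

Lemma norm_row_mx0 (p : nat) (v : 'rV[R]_p) : `|row_mx v (0 : 'rV[R]_1)| <= `|v|.
Proof.
apply: norm_rV_le => // k; have [j ->|j ->] := split_ordP k.
  by rewrite row_mxEl; exact: norm_coord.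
by rewrite row_mxEr mxE normr0.
Qed.

Lemma family_point_smooth (p : nat) (v : 'rV[R]_p) : smooth_curve (family_point v).
Proof.
apply/smooth_curveP => i.
have [j ->|j ->] := split_ordP i.
  rewrite (_ : (fun _ => _) = fun=> v 0 j); first exact: smooth1_cst.
  by apply/funext => x; rewrite row_mxEl.
rewrite (_ : (fun _ => _) = fun x => x); last first.
  by apply/funext => x; rewrite row_mxEr mxE.
apply: smooth1_expr; apply: smooth_expr_base; exact: smooth_on_coord.
Qed.

Lemma smooth_curve_continuous (q : nat) (c : R -> 'rV[R]_q) :
  smooth_curve c -> continuous c.
Proof.
move=> sc x; apply/differentiable_continuous/derivable1_diffP.
exact: smooth_curve_derivable.
Qed.

Lemma open_lsubmx_ball (p : nat) (d : R) :
  open [set z : 'rV[R]_(p + 1) | `|lsubmx z| < d].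
Proof.
rewrite (_ : [set z | _] = (fun z : 'rV[R]_(p + 1) => `|lsubmx z|) @^-1` [set r | r < d]) //.
apply: open_comp; last exact: open_lt.
move=> z _; apply: continuous_comp; last exact: norm_continuous.
by apply/differentiable_continuous; exact: differentiable_lsubmx.
Qed.

(** The parameters and the position on the line are joined into one variable, as in [fgrad_smooth].
    Differentiation in a direction of the family and differentiation in [x] thus become partial
    derivatives of one smooth function, and they commute. *)
Definition grad_coord F (p : nat) c (phi : 'I_p -> R -> 'rV[R]_n) i
  (z : 'rV[R]_(p + 1)) : R := fgrad F (affine_family c phi (lsubmx z)) (rsubmx z 0 0) 0 i.

(** Smoothness of the gradient is granted only for parameters whose curve stays in [U] over the
    window. As [U] is open and the window compact, a whole ball of parameters qualifies, even when
    the directions are unbounded on the line. *)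
Lemma grad_coord_smooth F (p : nat) c (phi : 'I_p -> R -> 'rV[R]_n) : open U ->
  smooth_curve c -> (forall x, U (c x)) -> (forall k, smooth_curve (phi k)) ->
  exists2 d, 0 < d &
    (forall i, smooth_on [set z : 'rV[R]_(p + 1) | `|lsubmx z| < d]
                         (grad_coord F c phi i)) /\
    forall v, `|v| < d -> forall x, `|x| <= fwindow F -> U (affine_family c phi v x).
Proof.
move=> oU sc cU sphi.
have cz : forall (_ : unit) (z : 'rV[R]_n), U z -> {for z, continuous (fun=> 0 : R)}.
  by move=> _ z _; exact: cst_continuous.
have [d0 d00 [N _ H]] := uniform_local_bound (m := fwindow F) oU cz
  (smooth_curve_continuous sc) (fun x _ => cU x).
have bk k : exists2 B, 0 <= B & forall x, `|x| <= fwindow F -> `|phi k x| <= B.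
  have cn : continuous (fun x => `|phi k x|).
    move=> x; apply: continuous_comp; last exact: norm_continuous.
    exact: (smooth_curve_continuous (sphi k)).
  have [B B0 HB] := bounded_on (fwindow F) cn.
  by exists B => // x xm; have := HB x xm; rewrite normr_id.
pose B k := sval (cid2 (bk k)).
have B0 k : 0 <= B k by rewrite /B; case: cid2.
have BP k x : `|x| <= fwindow F -> `|phi k x| <= B k.
  by rewrite /B; case: cid2 => /= b _; apply.
have S0 : 0 <= \sum_k B k by exact: sumr_ge0.
have S1 : 0 < \sum_k B k + 1 by rewrite ltr_wpDl.
(* The displacement over the window is at most the norm of [v] times the sum of the bounds [B k];
   adding 1 avoids a division by zero. *)
exists (d0 / (\sum_k B k + 1)); first by rewrite divr_gt0.
have inU v : `|v| < d0 / (\sum_k B k + 1) -> forall x, `|x| <= fwindow F ->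
    U (affine_family c phi v x).
  rewrite ltr_pdivlMr// => vd x xm.
  have [|//] := H x (\sum_k v 0 k *: phi k x) xm.
  apply: le_lt_trans vd; apply: le_trans (ler_norm_sum _ _ _) _.
  rewrite mulrDr mulr1 mulr_sumr -[leLHS]addr0; apply: lerD => //.
  apply: ler_sum => k _; rewrite normrZ; apply: ler_pM => //; last exact: BP.
  exact: norm_coord.
split => // i.
have sg := @fgrad_smooth _ _ _ F _ _ (affine_family_smooth sc sphi) i.
refine (sub_smooth_on _ sg) => z /=.
exact: inU.
Qed.

Lemma affine_family_delta (p : nat) c (phi : 'I_p -> R -> 'rV[R]_n) k e :
  affine_family c phi (e *: delta_mx 0 k) = fun x => c x + e *: phi k x.
Proof.
apply/funext => x; rewrite /affine_family (bigD1 k)//= big1 ?addr0.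
  by rewrite !mxE !eqxx mulr1.
by move=> j jk; rewrite !mxE eqxx (negbTE jk) mulr0 scale0r.
Qed.

Lemma dgradE F (p : nat) c (phi : 'I_p -> R -> 'rV[R]_n) k i x :
  partial (lshift 1 k) (grad_coord F c phi i) (family_point 0 x) =
  dgrad F c (phi k) x 0 i.
Proof.
rewrite mxE; apply: derive_along => h; rewrite addr0.
have -> : h *: delta_mx 0 (lshift 1 k) + family_point 0 x =
    family_point (h *: delta_mx 0 k) x.
  rewrite addrC [RHS]family_pointD; congr (_ + _); apply/rowP => j; rewrite mxE.
  have [j' ->|j' ->] := split_ordP j; rewrite ?row_mxEl ?row_mxEr !mxE eqxx/=.
    by rewrite eq_lshift.
  by rewrite eq_rlshift mulr0.
by rewrite /grad_coord !family_pointE affine_family_delta.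
Qed.

End GradientFamilies.

Lemma eq_jet_near (R : realType) (m : R) (p p' : R -> R -> R) (p1 p1' : R -> R) (d : R) :
  0 < d -> (forall e x, `|e| < d -> p e x = p' e x) ->
  (forall x, p1 x = p1' x) -> jet m p p1 -> jet m p' p1'.
Proof.
move=> d0 pp pp1 [B B0 [pB [d1 d10 pd]]].
have p0 x : p 0 x = p' 0 x by apply: pp; rewrite normr0.
exists B => //; split => [x xm|]; first by rewrite -p0 -pp1; exact: pB.
exists (Num.min d d1); first by rewrite lt_min d0.
move=> e x; rewrite lt_min => /andP[ed ed1] xm; rewrite -p0 -pp1 -pp//.
exact: pd.
Qed.

Lemma is_derive_translate (R : realType) (g : R -> R) (s L : R) :
  is_derive (0 : R) 1 (fun e => g (s + e)) L -> is_derive s 1 g L.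
Proof.
move=> [dg <-]; have E : (fun h : R => h^-1 *: ((g \o shift s) (h *: 1) - g s)) =
    (fun h : R => h^-1 *: (((fun e => g (s + e)) \o shift 0) (h *: 1) - g (s + 0))).
  by apply/funext => h; rewrite /= !addr0 [s + _]addrC.
by apply: DeriveDef; rewrite /derivable /derive E.
Qed.

Lemma common_radius (R : realType) (V : normedModType R) (I : finType)
    (P : I -> V -> Prop) :
  (forall i, exists2 d, 0 < d & forall v, `|v| < d -> P i v) ->
  exists2 d, 0 < d & forall v, `|v| < d -> forall i, P i v.
Proof.
move=> H; have : \forall v \near (0 : V), forall i, P i v.
  refine (filter_forall (f := P) (nbhs_filter (0 : V)) _) => i.
  by apply/nbhs_norm0P; have [d d0 Hd] := H i; exists d => // v; exact: Hd.
by move=> /nbhs_norm0P[d /= d0 Hd]; exists d => // v vd; exact: Hd.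
Qed.

Section GradientJets.
Context {R : realType} {n : nat} {U : set 'rV[R]_n}.
Variables (F : functional U) (c : R -> 'rV[R]_n).
Hypotheses (oU : open U) (sc : smooth_curve c) (cU : forall x, U (c x)).

Lemma fgrad_smooth_curve (c' : R -> 'rV[R]_n) : smooth_curve c' ->
  (forall x, `|x| <= fwindow F -> U (c' x)) -> smooth_curve (fgrad F c').
Proof. by move=> sc' cU'; have [] := @fgradP _ _ _ F c' sc' cU'. Qed.

Lemma fgrad_csupp (c' : R -> 'rV[R]_n) i : smooth_curve c' ->
  (forall x, `|x| <= fwindow F -> U (c' x)) ->
  csupp (fwindow F) (fun x => fgrad F c' x 0 i).
Proof.
move=> sc' cU'; split => [|x xw]; last by rewrite fgrad_window// mxE.
by apply: smooth1_continuous; apply: smooth_curve_coord; exact: fgrad_smooth_curve.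
Qed.

Lemma affine_family_curve (p : nat) (phi : 'I_p -> R -> 'rV[R]_n) z :
  (forall k, smooth_curve (phi k)) -> smooth_curve (affine_family c phi z).
Proof.
move=> sphi; apply/smooth_curveP => i.
rewrite (_ : (fun _ => _) = fun x => c x 0 i + \sum_k z 0 k * phi k x 0 i).
  apply: smooth1D; first exact: (@smooth_curve_coord _ _ c i sc).
  apply: smooth1_sum => k.
  exact: (smooth1M (@smooth1_cst _ _) (@smooth_curve_coord _ _ _ i (sphi k))).
apply/funext => x; rewrite mxE summxE; congr (_ + _).
by apply: eq_bigr => k _; rewrite mxE.
Qed.

Lemma family_point_delta (x e : R) : family_point 0 x + e *: delta_mx 0 (lshift 1 0) =
  family_point (e *: delta_mx 0 0 : 'rV[R]_1) x.
Proof.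
rewrite [RHS]family_pointD; congr (_ + _); apply/rowP => j.
by have [j' ->|j' ->] := split_ordP j;
  rewrite ?row_mxEl ?row_mxEr !mxE eqxx ?eq_lshift ?eq_rlshift ?mulr0.
Qed.

Section OneDirection.
Variable phi : R -> 'rV[R]_n.
Hypothesis sphi : smooth_curve phi.

Let phi1 (k : 'I_1) := phi.

Lemma affine_curveE e : (fun x => c x + e *: phi x) =
  affine_family c phi1 (e *: delta_mx 0 0).
Proof. by rewrite affine_family_delta. Qed.

Lemma affine_curve_smooth e : smooth_curve (fun x => c x + e *: phi x).
Proof. by rewrite affine_curveE; apply: affine_family_curve. Qed.

Let norm_e (e : R) : `|e *: delta_mx 0 0 : 'rV[R]_1| <= `|e|.
Proof. by rewrite normrZ ler_piMr//; exact: norm_delta_mx. Qed.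

Let grad1 : exists2 d, 0 < d &
    (forall i, smooth_on [set z : 'rV[R]_(1 + 1) | `|lsubmx z| < d]
                         (grad_coord F c phi1 i)) /\
    forall v, `|v| < d -> forall x, `|x| <= fwindow F -> U (affine_family c phi1 v x).
Proof. by apply: grad_coord_smooth. Qed.

Lemma affine_curve_in : exists2 d, 0 < d & forall e, `|e| < d ->
  forall x, `|x| <= fwindow F -> U (c x + e *: phi x).
Proof.
have [d d0 [_ H]] := grad1; exists d => // e ed x xw.
have := H (e *: delta_mx 0 0) _ x xw; rewrite -affine_curveE; apply.
exact: le_lt_trans (norm_e e) ed.
Qed.

Lemma grad_coordE e x i :
  grad_coord F c phi1 i (family_point 0 x + e *: delta_mx 0 (lshift 1 0)) =
  fgrad F (fun y => c y + e *: phi y) x 0 i.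
Proof. by rewrite family_point_delta /grad_coord !family_pointE affine_curveE. Qed.

Let sum_delta (f : 'I_(1 + 1) -> R) :
  \sum_k f k * (delta_mx 0 (lshift 1 0) : 'rV[R]_(1 + 1)) 0 k = f (lshift 1 0).
Proof.
rewrite (bigD1 (lshift 1 0))//= big1 ?addr0; first by rewrite mxE !eqxx mulr1.
by move=> k k0; rewrite mxE eqxx (negbTE k0) mulr0.
Qed.

Let cst_dir : continuous (fun _ : R => delta_mx 0 (lshift 1 0) : 'rV[R]_(1 + 1)).
Proof. by move=> ?; exact: cst_continuous. Qed.

Let point0_in d (x : R) : 0 < d -> `|lsubmx (family_point (0 : 'rV[R]_1) x)| < d.
Proof. by move=> d0; rewrite family_pointE normr0. Qed.

Lemma grad_jet m i : jet m (fun e x => fgrad F (fun y => c y + e *: phi y) x 0 i)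
  (fun x => dgrad F c phi x 0 i).
Proof.
have [d d0 [sg _]] := grad1.
have oD := open_lsubmx_ball (p := 1) (d := d).
have jt := @jet_comp R m _ _ _ _ _ oD (sg i)
  (smooth_curve_continuous (@family_point_smooth _ 1 0)) cst_dir
  (fun x _ => point0_in x d0).
apply: (eq_jet jt) => [e x|x]; first exact: grad_coordE.
by rewrite sum_delta; exact: (@dgradE _ _ _ F 1 c phi1).
Qed.

Lemma dgrad_smooth : smooth_curve (dgrad F c phi).
Proof.
have [d d0 [sg _]] := grad1; apply/smooth_curveP => i.
rewrite (_ : (fun _ => _) = fun x =>
    partial (lshift 1 0) (grad_coord F c phi1 i) (family_point 0 x)).
  apply: (smooth1_comp (smooth_on_partial (lshift 1 0) (sg i))).
    by move=> j; apply: smooth_curve_coord; exact: family_point_smooth.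
  by move=> x; exact: point0_in.
by apply/funext => x; rewrite -(@dgradE _ _ _ F 1 c phi1 0).
Qed.

Lemma dgrad_csupp i : csupp (fwindow F) (fun x => dgrad F c phi x 0 i).
Proof.
split; first by apply: smooth1_continuous; apply: smooth_curve_coord; exact: dgrad_smooth.
move=> x xw; rewrite mxE (_ : (fun e => _) = cst 0); first exact: derive1_cst.
by apply/funext => e; rewrite fgrad_window// mxE.
Qed.

(** The operator contains the x-derivative of the gradient, whose expansion does not follow from
    that of the gradient itself. It is the expansion of the partial derivative of [grad_coord] in
    the position variable; [partial_swap] then identifies its first-order term. *)
Lemma grad_derive_jet m i :
  jet m (fun e x => derive1 (fgrad F (fun y => c y + e *: phi y)) x 0 i)
        (fun x => derive1 (dgrad F c phi) x 0 i).
Proof.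
have [d d0 [sg _]] := grad1; have [d1 d10 cU1] := affine_curve_in.
have oD := open_lsubmx_ball (p := 1) (d := d).
have jt := @jet_comp R m _ _ _ _ _ oD (smooth_on_partial (rshift 1 0) (sg i))
  (smooth_curve_continuous (@family_point_smooth _ 1 0)) cst_dir
  (fun x _ => point0_in x d0).
(* Only for small [e] does the displaced curve stay in [U] over the window, and only then is its
   gradient known to be smooth. *)
apply: (eq_jet_near d10 _ _ jt).
- move=> e x ed1; rewrite derive1_coord; last first.
    apply: smooth_curve_derivable; apply: fgrad_smooth_curve (cU1 e ed1).
    exact: affine_curve_smooth.
  apply: derive_along => h; rewrite -grad_coordE; congr (grad_coord _ _ _ _ _).
  rewrite addrA; congr (_ + _); apply/rowP => j.
  have [j' ->|j' ->] := split_ordP j;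
    rewrite [LHS]mxE ?row_mxEl ?row_mxEr !mxE eqxx ?eq_lrshift.
    by rewrite mulr0 addr0.
  by rewrite ord1 eqxx mulr1.
- move=> x; rewrite sum_delta derive1_coord; last first.
    exact/smooth_curve_derivable/dgrad_smooth.
  rewrite (partial_swap _ _ oD (sg i)); last exact: point0_in.
  apply: derive_along => h; rewrite -(@dgradE _ _ _ F 1 c phi1 0).
  congr (partial _ _ _); apply/rowP => j.
  have [j' ->|j' ->] := split_ordP j;
    rewrite [LHS]mxE ?row_mxEl ?row_mxEr !mxE eqxx ?eq_lrshift.
    by rewrite mulr0 add0r.
  by rewrite ord1 eqxx mulr1.
Qed.

End OneDirection.

End GradientJets.

Lemma is_derive_eq_fun (R : realType) (f g : R -> R) (x L : R) :
  (forall e, f e = g e) -> is_derive x 1 f L -> is_derive x 1 g L.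
Proof. by move=> fg; have -> : g = f by apply/funext. Qed.

Lemma pairingE (R : realType) (n : nat) (xi X : R -> 'rV[R]_n) :
  pairing xi X = integ (fun x => \sum_(i < n) xi x 0 i * X x 0 i).
Proof. by []. Qed.

(** * Symmetry of the second variation *)

Section HessianSymmetry.
Context {R : realType} {n : nat} {U : set 'rV[R]_n}.
Variables (F : functional U) (c phi psi : R -> 'rV[R]_n).
Hypotheses (oU : open U) (sc : smooth_curve c) (cU : forall x, U (c x)).
Hypotheses (sphi : smooth_curve phi) (spsi : smooth_curve psi).

Let dir (k : 'I_2) := if k == 0 then phi else psi.

Let sdir k : smooth_curve (dir k).
Proof. by rewrite /dir; case: ifP. Qed.

Let v (s t : R) : 'rV[R]_2 := s *: delta_mx 0 0 + t *: delta_mx 0 1.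

Let fam s t := affine_family c dir (v s t).

Let famE s t : fam s t = fun x => c x + (s *: phi x + t *: psi x).
Proof.
apply/funext => x; rewrite /fam /affine_family; congr (_ + _).
rewrite big_ord_recl big_ord1 /v !mxE /=.
by rewrite !mulr1 !mulr0 addr0 add0r.
Qed.

Let norm_v s t : `|v s t| <= `|s| + `|t|.
Proof.
apply: le_trans (ler_normD _ _) _; rewrite !normrZ.
by apply: lerD; rewrite ler_piMr//; exact: norm_delta_mx.
Qed.

Let gradE i s t x :
  grad_coord F c dir i (family_point 0 x + row_mx (v s t) 0) = fgrad F (fam s t) x 0 i.
Proof. by rewrite -family_pointD /grad_coord !family_pointE. Qed.

(* Fréchet differentiability at the origin of the partial derivatives of the
   function (s, t) |-> F (c + s phi + t psi). *)
Let pairing_expansion chi : smooth_curve chi ->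
  forall e, 0 < e -> exists2 d, 0 < d & forall s t : R, `|s| < d -> `|t| < d ->
    `|pairing (fgrad F (fam s t)) chi - pairing (fgrad F (fam 0 0)) chi
      - pairing (dgrad F c phi) chi * s - pairing (dgrad F c psi) chi * t|
    <= e * (`|s| + `|t|).
Proof.
move=> schi e e0.
have [d d0 [sg inU]] := @grad_coord_smooth _ _ _ F 2 c dir oU sc cU sdir.
have oD := open_lsubmx_ball (p := 2) (d := d).
have point0_in (x : R) : `|lsubmx (family_point (0 : 'rV[R]_2) x)| < d.
  by rewrite family_pointE normr0.
(* [integ_bound] asks for a nonnegative radius, whereas a window may be negative. *)
pose m := Num.max 0 (fwindow F).
have m0 : 0 <= m by rewrite le_max lexx.
have wm : fwindow F <= m by rewrite le_max lexx orbT.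
pose D i := fun x s t => fgrad F (fam s t) x 0 i - fgrad F (fam 0 0) x 0 i
  - (dgrad F c phi x 0 i * s + dgrad F c psi x 0 i * t).
have T i : exists2 r, 0 < r & exists2 C, 0 <= C & forall x s t, `|x| <= m ->
    `|v s t| < r -> `|D i x s t| <= C * `|v s t| ^+ 2.
  have [r r0 [C C0 H]] := uniform_taylor (m := m) oD (sg i)
    (smooth_curve_continuous (@family_point_smooth _ 2 0)) (fun x _ => point0_in x).
  exists r => //; exists C => // x s t xm vr.
  have nv := norm_row_mx0 (v s t).
  have [|_] := H x (row_mx (v s t) 0) xm; first exact: le_lt_trans vr.
  have v00 : v 0 0 = 0 by rewrite /v !scale0r addr0.
  rewrite gradE -[X in _ - grad_coord _ _ _ _ X - _]addr0.
  have -> : (0 : 'rV[R]_(2 + 1)) = row_mx (v 0 0) 0 by rewrite v00 row_mx0.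
  rewrite gradE big_split_ord /= [X in _ - (_ + X)]big1 ?addr0; last first.
    by move=> k _; rewrite row_mxEr mxE mul0r.
  rewrite big_ord_recl big_ord1 !row_mxEl !dgradE /dir /=.
  have -> : v s t 0 ord0 = s by rewrite !mxE /= mulr1 mulr0 addr0.
  have -> : v s t 0 (lift ord0 ord0) = t by rewrite !mxE /= mulr1 mulr0 add0r.
  rewrite /D [s * _]mulrC [t * _]mulrC => /le_trans; apply.
  by rewrite ler_wpM2l// ler_pXn2r ?nnegrE.
pose r i := sval (cid2 (T i)).
have r0 i : 0 < r i by rewrite /r; case: cid2.
have T' i : exists2 C, 0 <= C & forall x s t, `|x| <= m ->
    `|v s t| < r i -> `|D i x s t| <= C * `|v s t| ^+ 2.
  by rewrite /r; case: cid2.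
pose C i := sval (cid2 (T' i)).
have C0 i : 0 <= C i by rewrite /C; case: cid2.
have TC i x s t : `|x| <= m -> `|v s t| < r i -> `|D i x s t| <= C i * `|v s t| ^+ 2.
  by move=> xm vr; rewrite /C; case: cid2 => /= C' _; apply.
have [r1 r10 Hr] : exists2 r1, 0 < r1 & forall e : R, `|e| < r1 -> forall i, `|e| < r i.
  by apply: (@common_radius R R _ (fun i (e : R) => `|e| < r i)) => i; exists (r i).
have cn i : continuous (fun x => chi x 0 i).
  exact: smooth1_continuous (@smooth_curve_coord _ _ _ i schi).
pose P i := sval (cid2 (bounded_on m (cn i))).
have P0 i : 0 <= P i by rewrite /P; case: cid2.
have chiP i x : `|x| <= m -> `|chi x 0 i| <= P i.
  by rewrite /P; case: cid2 => /= b _; apply.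
pose S := \sum_i C i * P i.
have S0 : 0 <= S by apply: sumr_ge0 => i _; rewrite mulr_ge0.
pose K := 2 * (m + 1) * S.
have K0 : 0 <= K by rewrite !mulr_ge0//; lra.
(* If s and t are below this number in absolute value, the sum of their absolute values is at most 2
   e / (2 K + 1), and K times its square is at most [e] times the sum itself. *)
have eK : 0 < e / (2 * K + 1) by rewrite divr_gt0//; lra.
exists (Num.min (Num.min d r1 / 2) (e / (2 * K + 1))).
  by rewrite lt_min eK andbT divr_gt0// lt_min d0.
move=> s t; rewrite !lt_min => /andP[sd se] /andP[td te].
have vdr : `|v s t| < Num.min d r1 by apply: le_lt_trans (norm_v s t) _; lra.
move: vdr; rewrite lt_min => /andP[vd vr].
have famU a b : `|v a b| < d -> forall x, `|x| <= fwindow F -> U (fam a b x).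
  by move=> vab; exact: inU.
have sfam a b : smooth_curve (fam a b) by exact: affine_family_curve.
have v00 : `|v 0 0| < d by rewrite /v !scale0r addr0 normr0.
have cg a b i : `|v a b| < d -> csupp m (fun x => fgrad F (fam a b) x 0 i * chi x 0 i).
  move=> vab; apply: csuppMr (cn i) _; apply: csupp_le wm _.
  by apply: fgrad_csupp (sfam _ _) (famU _ _ vab).
have cd (phi' : R -> 'rV[R]_n) i : smooth_curve phi' ->
    csupp m (fun x => dgrad F c phi' x 0 i * chi x 0 i).
  move=> sphi'; apply: csuppMr (cn i) _; apply: csupp_le wm _.
  exact: dgrad_csupp.
have cD : csupp m (fun x => \sum_i D i x s t * chi x 0 i).
  apply: csupp_sum => i; rewrite (_ : (fun _ => _) = fun x =>
    (fgrad F (fam s t) x 0 i * chi x 0 i - fgrad F (fam 0 0) x 0 i * chi x 0 i)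
    - (s * (dgrad F c phi x 0 i * chi x 0 i) + t * (dgrad F c psi x 0 i * chi x 0 i))).
    apply: csuppB; first by apply: csuppB; exact: cg.
    by apply: csuppD; apply: csuppZ; exact: cd.
  by apply/funext => x; rewrite /D; ring.
have -> : pairing (fgrad F (fam s t)) chi - pairing (fgrad F (fam 0 0)) chi
      - pairing (dgrad F c phi) chi * s - pairing (dgrad F c psi) chi * t
    = integ (fun x => \sum_i D i x s t * chi x 0 i).
  have c1 a b : `|v a b| < d ->
      csupp m (fun x => \sum_i fgrad F (fam a b) x 0 i * chi x 0 i).
    by move=> vab; apply: csupp_sum => i; exact: cg.
  have c2 (phi' : R -> 'rV[R]_n) : smooth_curve phi' ->
      csupp m (fun x => \sum_i dgrad F c phi' x 0 i * chi x 0 i).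
    by move=> sphi'; apply: csupp_sum => i; exact: cd.
  have E (a1 a0 b1 b2 f : R -> R) : csupp m a1 -> csupp m a0 -> csupp m b1 ->
      csupp m b2 -> (forall x, f x = a1 x - a0 x - s * b1 x - t * b2 x) ->
      integ a1 - integ a0 - integ b1 * s - integ b2 * t = integ f.
    move=> ca1 ca0 cb1 cb2 fE.
    have -> : f = fun x => a1 x - a0 x - s * b1 x - t * b2 x by apply/funext.
    have c10 := csuppB ca1 ca0; have cs := csuppZ s cb1; have ct := csuppZ t cb2.
    rewrite (integB (csuppB c10 cs) ct) (integB c10 cs) (integB ca1 ca0).
    by rewrite (integZ s cb1) (integZ t cb2) [s * _]mulrC [t * _]mulrC.
  apply: (E _ _ _ _ _ (c1 _ _ vd) (c1 _ _ v00) (c2 _ sphi) (c2 _ spsi)) => x.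
  rewrite !mulr_sumr -!sumrB; apply: eq_bigr => i _; rewrite /D; ring.
have DB x : `|\sum_i D i x s t * chi x 0 i| <= S * `|v s t| ^+ 2.
  have [mx|xm] := ltP m `|x|.
    by rewrite cD.2// normr0 mulr_ge0// sqr_ge0.
  rewrite mulr_suml; apply: le_trans (ler_norm_sum _ _ _) _; apply: ler_sum => i _.
  rewrite normrM mulrAC; apply: ler_pM => //; last exact: chiP.
  by apply: TC => //; have := Hr `|v s t|; rewrite normr_id; apply.
have := @integ_bound _ m _ _ cD m0 DB => /le_trans; apply.
rewrite mulrA -/K.
have st0 : 0 <= `|s| + `|t| by exact: addr_ge0.
apply: (@le_trans _ _ (K * (`|s| + `|t|) ^+ 2)).
  by rewrite ler_wpM2l// ler_pXn2r ?nnegrE.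
rewrite expr2 mulrA; apply: ler_wpM2r => //.
have ste : `|s| + `|t| <= 2 * (e / (2 * K + 1)) by lra.
apply: (@le_trans _ _ (K * (2 * (e / (2 * K + 1))))); first exact: ler_wpM2l.
have -> : K * (2 * (e / (2 * K + 1))) = (2 * K) * e / (2 * K + 1) by ring.
have K1 : 0 < 2 * K + 1 by lra.
rewrite ler_pdivrMr// mulrDr mulr1 [e * _]mulrC lerDl.
exact: ltW.
Qed.

Lemma dgrad_sym : pairing (dgrad F c phi) psi = pairing (dgrad F c psi) phi.
Proof.
have [d d0 [_ inU]] := @grad_coord_smooth _ _ _ F 2 c dir oU sc cU sdir.
have d20 : 0 < d / 2 by rewrite divr_gt0.
have famU s t : `|s| < d / 2 -> `|t| < d / 2 ->
    forall x, `|x| <= fwindow F -> U (fam s t x).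
  by move=> sd td; apply: inU; apply: le_lt_trans (norm_v s t) _; lra.
have sfam a b : smooth_curve (fam a b) by exact: affine_family_curve.
apply: esym; apply: (@schwarz R (fun s t => F (fam s t))
  (fun s t => pairing (fgrad F (fam s t)) phi)
  (fun s t => pairing (fgrad F (fam s t)) psi)
  _ _ _ _ (d / 2) d20 _ _ (pairing_expansion sphi) (pairing_expansion spsi)).
(* [fgradP] differentiates at parameter 0 only, so the derivative at [s] is obtained by taking
   [fam s t] as the base curve. *)
- move=> s t sd td; apply: is_derive_translate.
  have [_ _ /(_ phi sphi)] := @fgradP _ _ _ F (fam s t) (sfam s t) (famU s t sd td).
  apply: is_derive_eq_fun => e; congr (fval F _); rewrite !famE; apply/funext => x.
  by rewrite scalerDl -!addrA; congr (_ + (_ + _)); exact: addrC.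
- move=> s t sd td; apply: is_derive_translate.
  have [_ _ /(_ psi spsi)] := @fgradP _ _ _ F (fam s t) (sfam s t) (famU s t sd td).
  apply: is_derive_eq_fun => e; congr (fval F _); rewrite !famE; apply/funext => x.
  by rewrite scalerDl -!addrA.
Qed.

End HessianSymmetry.

Section PointedJets.
Context {R : realType}.
Implicit Types (p q : R -> R -> R) (h : R -> R) (m : R).

(** A jet with a prescribed value at [e = 0], so that the product rule yields coefficients along the
    original curve and not along the curve displaced by 0. *)
Definition pjet m p (p0 p1 : R -> R) : Prop := (forall x, p 0 x = p0 x) /\ jet m p p1.

Lemma pjetD m p q (p0 q0 p1 q1 : R -> R) : pjet m p p0 p1 -> pjet m q q0 q1 ->
  pjet m (fun e x => p e x + q e x) (fun x => p0 x + q0 x) (fun x => p1 x + q1 x).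
Proof. by move=> [E jp] [E' jq]; split => [x|]; [rewrite E E'|exact: jetD]. Qed.

Lemma pjetB m p q (p0 q0 p1 q1 : R -> R) : pjet m p p0 p1 -> pjet m q q0 q1 ->
  pjet m (fun e x => p e x - q e x) (fun x => p0 x - q0 x) (fun x => p1 x - q1 x).
Proof. by move=> [E jp] [E' jq]; split => [x|]; [rewrite E E'|exact: jetB]. Qed.

Lemma pjetM m p q (p0 q0 p1 q1 : R -> R) : pjet m p p0 p1 -> pjet m q q0 q1 ->
  pjet m (fun e x => p e x * q e x) (fun x => p0 x * q0 x)
    (fun x => p1 x * q0 x + p0 x * q1 x).
Proof.
move=> [E jp] [E' jq]; split => [x|]; first by rewrite E E'.
by apply: eq_jet (jetM jp jq) _ _ => // x; rewrite E E'.
Qed.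

Lemma pjet_sum m (I : Type) (r : seq I) (p : I -> R -> R -> R) (p0 p1 : I -> R -> R) :
  (forall i, pjet m (p i) (p0 i) (p1 i)) ->
  pjet m (fun e x => \sum_(i <- r) p i e x) (fun x => \sum_(i <- r) p0 i x)
    (fun x => \sum_(i <- r) p1 i x).
Proof.
move=> jp; split => [x|]; first by apply: eq_bigr => i _; rewrite (jp i).1.
by apply: jet_sum => i; exact: (jp i).2.
Qed.

Lemma pjet_Dinv m q (q0 q1 : R -> R) : 0 <= m ->
  (exists2 d, 0 < d & forall e, `|e| < d -> csupp m (q e)) -> csupp m q1 ->
  pjet m q q0 q1 -> pjet m (fun e => Dinv (q e)) (Dinv q0) (Dinv q1).
Proof.
move=> m0 cq cq1 [E jq]; split; last exact: jet_Dinv.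
by move=> x; congr (Dinv _ x); apply/funext.
Qed.

Lemma eq_pjet m p (p0 p1 : R -> R) p' (p0' p1' : R -> R) : pjet m p p0 p1 ->
  (forall e x, p e x = p' e x) -> (forall x, p0 x = p0' x) ->
  (forall x, p1 x = p1' x) -> pjet m p' p0' p1'.
Proof.
move=> [E jp] pp pp0 pp1; split; last exact: eq_jet jp pp pp1.
by move=> x; rewrite -pp E pp0.
Qed.

(** A coefficient along a displaced curve is under control only slightly beyond the window, since
    the curve may leave [U] further out. There [f] already vanishes in a neighbourhood of each
    point, which makes the product continuous everywhere. *)
Lemma csupp_local_mul m h (f : R -> R) :
  (forall x, `|x| < m + 1 -> {for x, continuous h}) -> csupp m f ->
  csupp m (fun x => h x * f x).
Proof.
move=> ch [cf f0]; split => [x|x mx]; last by rewrite f0 ?mulr0.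
have [xm|mx] := ltP `|x| (m + 1).
  by apply: continuousM; [exact: ch|exact: cf].
have nm : nbhs `|x| [set z | m < z].
  by apply: open_nbhs_nbhs; split; [exact: open_gt|rewrite /=; lra].
have nx : \forall y \near x, m < `|y| := @norm_continuous _ _ x _ nm.
have fx0 : h x * f x = 0 by rewrite f0 ?mulr0//; lra.
rewrite /continuous_at fx0; apply: cvg_near_cst.
by apply: filterS nx => y my; rewrite f0// mulr0.
Qed.

End PointedJets.

(** * Nonlocal operators satisfying the Gauss-Codazzi equations *)

Section PointwiseAlgebra.
Context {R : comPzRingType} {n : nat}.
Implicit Types (a b phi psi u : 'I_n -> R).

Lemma sum_if_eql (i : 'I_n) (x : R) a : \sum_l (if i == l then x else 0) * a l = x * a i.
Proof.
rewrite (bigD1 i)//= eqxx big1 ?addr0// => l li.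
by rewrite eq_sym (negbTE li) mul0r.
Qed.

Section Connection.
Variables (gi : 'I_n -> R) (dgi : 'I_n -> 'I_n -> R).
Variables (Gam : 'I_n -> 'I_n -> 'I_n -> R) (dGam : 'I_n -> 'I_n -> 'I_n -> 'I_n -> R).

(* conn phi eta i = Gamma^l_ik phi^k eta_l, so that conn phi is the connection
   matrix acting on covectors. *)
Definition conn phi a : 'I_n -> R := fun i => \sum_l \sum_k Gam l i k * phi k * a l.

Definition dconn psi phi a : 'I_n -> R := fun i =>
  \sum_l \sum_k (\sum_m dGam m l i k * psi m) * phi k * a l.

Hypothesis Gam_sym : forall l j k, Gam l j k = Gam l k j.

Hypothesis compat : forall m i l,
  (if i == l then dgi m i else 0) = - (Gam i m l * gi l) - Gam l m i * gi i.

Lemma conn_sym phi psi a : \sum_i conn phi a i * psi i = \sum_i conn psi a i * phi i.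
Proof.
have E (f h : 'I_n -> R) : \sum_i conn f a i * h i =
    \sum_l \sum_i \sum_k Gam l i k * f k * a l * h i.
  rewrite exchange_big; apply: eq_bigr => i _; rewrite mulr_suml.
  by apply: eq_bigr => l _; rewrite mulr_suml.
rewrite !E; apply: eq_bigr => l _; rewrite exchange_big.
by apply: eq_bigr => i _; apply: eq_bigr => k _; rewrite Gam_sym; ring.
Qed.

Lemma metric_compatibility phi a b :
  \sum_i (\sum_m dgi m i * phi m) * a i * b i =
  - (\sum_i gi i * conn phi a i * b i) - \sum_i gi i * a i * conn phi b i.
Proof.
have -> : \sum_i (\sum_m dgi m i * phi m) * a i * b i =
    \sum_i \sum_l \sum_m (- (Gam i m l * gi l) - Gam l m i * gi i) * phi m * a i * b l.
  apply: eq_bigr => i _; rewrite exchange_big /= !mulr_suml; apply: eq_bigr => m _.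
  rewrite -mulrA -(sum_if_eql i (dgi m i * phi m) (fun l => a i * b l)).
  rewrite -(eq_bigr _ (fun l _ => mulrA _ _ _)).
  apply: eq_bigr => l _; rewrite -compat.
  by case: (i == l); ring.
have E1 : \sum_i gi i * conn phi a i * b i =
    \sum_i \sum_l \sum_m Gam i m l * gi l * phi m * a i * b l.
  rewrite exchange_big /=; apply: eq_bigr => i _.
  rewrite mulr_sumr mulr_suml; apply: eq_bigr => l _.
  rewrite mulr_sumr mulr_suml; apply: eq_bigr => m _.
  by rewrite (Gam_sym l i m); ring.
have E2 : \sum_i gi i * a i * conn phi b i =
    \sum_i \sum_l \sum_m Gam l m i * gi i * phi m * a i * b l.
  apply: eq_bigr => i _.
  rewrite mulr_sumr; apply: eq_bigr => l _.
  rewrite mulr_sumr; apply: eq_bigr => m _.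
  by rewrite (Gam_sym l i m); ring.
rewrite E1 E2 -opprD -big_split -sumrN /=; apply: eq_bigr => i _.
rewrite -big_split -sumrN /=; apply: eq_bigr => l _.
rewrite -big_split -sumrN /=; apply: eq_bigr => m _.
ring.
Qed.

Section Curvature.
Variables (T : finType) (s : T -> T) (p : T -> 'I_n -> R) (dp : T -> 'I_n -> 'I_n -> R).

Hypothesis s_inv : involutive s.

Hypothesis dGam_sym : forall m l j k, dGam m l j k = dGam m l k j.

Hypothesis codazzi : forall t i k l,
  (if i == l then dp t k i else 0) - (if i == k then dp t l i else 0) =
  Gam i l k * (p t k - p t l).

Hypothesis gauss : forall i j k l,
  gi i * (dGam k j l i - dGam l j k i +
    \sum_m (Gam j k m * Gam m l i - Gam j l m * Gam m k i)) =
  (((j == k) && (i == l))%:R - ((j == l) && (i == k))%:R) *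
  \sum_t p t j * p (s t) i.

(** The covariant derivative of the affinor is symmetric in its two lower indices. Contracted, this
    exchanges the direction of differentiation with the vector acted upon, at the price of
    connection terms. *)
Lemma codazzi_contract t phi u a :
  \sum_i a i * (\sum_k dp t k i * phi k * u i) + \sum_i conn phi a i * (p t i * u i) =
  \sum_i a i * (\sum_k dp t k i * u k * phi i) + \sum_i conn u a i * (p t i * phi i).
Proof.
have E (f h : 'I_n -> R) : \sum_i conn f a i * (p t i * h i) =
    \sum_i a i * \sum_k \sum_l Gam i l k * p t l * f k * h l.
  rewrite (eq_bigr (fun i => \sum_l \sum_k a l * (Gam l i k * p t i * f k * h i))).
    rewrite exchange_big; apply: eq_bigr => i _.
    rewrite exchange_big mulr_sumr; apply: eq_bigr => k _.
    by rewrite mulr_sumr.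
  move=> i _; rewrite mulr_suml; apply: eq_bigr => l _; rewrite mulr_suml.
  by apply: eq_bigr => k _; ring.
rewrite !E -!big_split; apply: eq_bigr => i _ /=; rewrite -!mulrDr; congr (_ * _).
have F (f h : 'I_n -> R) : \sum_k dp t k i * f k * h i =
    \sum_k \sum_l (if i == l then dp t k i else 0) * f k * h l.
  apply: eq_bigr => k _; rewrite -(sum_if_eql i (dp t k i * f k)).
  by apply: eq_bigr => l _; case: (i == l); ring.
rewrite !F [X in _ = X + _]exchange_big [X in _ = _ + X]exchange_big /=.
rewrite -!big_split; apply: eq_bigr => k _; rewrite -!big_split /=.
apply: eq_bigr => l _; have := codazzi t i k l; rewrite (Gam_sym i k l) => c.
apply/eqP; rewrite -subr_eq0; apply/eqP.
rewrite (_ : _ - _ = (((if i == l then dp t k i else 0) -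
   (if i == k then dp t l i else 0)) - Gam i l k * (p t k - p t l)) * (phi k * u l)).
  by rewrite c subrr mul0r.
by ring.
Qed.

(** On the left stands the curvature of the connection matrices acting on covectors, evaluated on
    [u] and [phi]. The Kronecker symbols of the Gauss equation collapse the four index sums to
    two. *)
Lemma gauss_contract phi u a b :
  \sum_i gi i * a i * (dconn u phi b i - dconn phi u b i
     + conn phi (conn u b) i - conn u (conn phi b) i) =
  (\sum_t (\sum_i a i * (p t i * phi i)) * (\sum_j b j * (p (s t) j * u j)))
  - \sum_t (\sum_i a i * (p (s t) i * u i)) * (\sum_j b j * (p t j * phi j)).
Proof.
have E1 (f h : 'I_n -> R) i : dconn f h b i = \sum_j \sum_k \sum_l
    dGam l j i k * f l * h k * b j.
  by apply: eq_bigr => j _; apply: eq_bigr => k _; rewrite !mulr_suml.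
have E2 (f h : 'I_n -> R) i : conn f (conn h b) i = \sum_j \sum_k \sum_l
    (\sum_m Gam m i k * Gam j m l) * f k * h l * b j.
  rewrite /conn; under eq_bigr do (under eq_bigr do rewrite mulr_sumr).
  rewrite (eq_bigr (fun m => \sum_j \sum_k \sum_l
      Gam m i k * Gam j m l * f k * h l * b j)); last first.
    move=> m _; rewrite exchange_big; apply: eq_bigr => j _; apply: eq_bigr => k _.
    by rewrite mulr_sumr; apply: eq_bigr => l _; ring.
  rewrite exchange_big; apply: eq_bigr => j _.
  rewrite exchange_big; apply: eq_bigr => k _.
  rewrite exchange_big; apply: eq_bigr => l _.
  by rewrite !mulr_suml.
transitivity (- \sum_i \sum_j \sum_k \sum_l
   (((j == k) && (i == l))%:R - ((j == l) && (i == k))%:R) *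
   (\sum_t p t j * p (s t) i) * (a i * b j * phi k * u l)).
  rewrite -sumrN; apply: eq_bigr => i _.
  rewrite E1 E2 E1 E2.
  rewrite [X in _ - X + _ - _](eq_bigr (fun j => \sum_k \sum_l
    dGam k j i l * phi k * u l * b j)); last by move=> j _; rewrite exchange_big.
  rewrite [X in _ - _ + _ - X](eq_bigr (fun j => \sum_k \sum_l
    (\sum_m Gam m i l * Gam j m k) * u l * phi k * b j)); last first.
    by move=> j _; rewrite exchange_big.
  rewrite -sumrB -big_split -sumrB mulr_sumr -sumrN; apply: eq_bigr => j _ /=.
  rewrite -sumrB -big_split -sumrB mulr_sumr -sumrN; apply: eq_bigr => k _ /=.
  rewrite -sumrB -big_split -sumrB mulr_sumr -sumrN; apply: eq_bigr => l _ /=.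
  rewrite -gauss sumrB.
  rewrite [X in _ + (X - _)](eq_bigr (fun m => Gam m i l * Gam j m k)); last first.
    by move=> m _; rewrite (Gam_sym m l i) (Gam_sym j k m); ring.
  rewrite [X in _ + (_ - X)](eq_bigr (fun m => Gam m i k * Gam j m l)); last first.
    by move=> m _; rewrite (Gam_sym m k i) (Gam_sym j l m); ring.
  by rewrite (dGam_sym k j l i) (dGam_sym l j k i); ring.
have delta (f : 'I_n -> 'I_n -> 'I_n -> 'I_n -> R) i j :
    \sum_k \sum_l (((j == k) && (i == l))%:R - ((j == l) && (i == k))%:R) * f i j k l =
    f i j j i - f i j i j.
  have D (x y : 'I_n) (h : 'I_n -> 'I_n -> R) :
      \sum_k \sum_l ((x == k) && (y == l))%:R * h k l = h x y.
    rewrite (bigD1 x)//= (bigD1 y)//= !eqxx mul1r big1 ?big1 ?addr0//.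
      by move=> k kx; rewrite big1// => l _; rewrite eq_sym (negbTE kx) mul0r.
    by move=> l ly; rewrite andbC eq_sym (negbTE ly) mul0r.
  rewrite -(D j i (f i j)) -(D i j (f i j)) -sumrB; apply: eq_bigr => k _.
  rewrite -sumrB; apply: eq_bigr => l _.
  by rewrite mulrBl [(i == k) && _]andbC.
under eq_bigr => i _ do under eq_bigr => j _ do
  (under eq_bigr => k _ do under eq_bigr => l _ do rewrite -mulrA;
   rewrite (delta (fun i j k l => (\sum_t p t j * p (s t) i) *
     (a i * b j * phi k * u l)))).
have P (A B : 'I_n -> R) : (\sum_i A i) * (\sum_j B j) = \sum_i \sum_j A i * B j.
  by rewrite mulr_suml; apply: eq_bigr => i _; rewrite mulr_sumr.
(* After reindexing the first sum by [s], both sums carry the common factor [p t j * p (s t) i]. *)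
rewrite (reindex_inj (can_inj s_inv)) /= -sumrB.
rewrite (eq_bigr (fun t => \sum_i \sum_j p t j * p (s t) i *
  (a i * b j * phi i * u j - a i * b j * phi j * u i))); last first.
  move=> t _; rewrite s_inv !P -sumrB; apply: eq_bigr => i _.
  by rewrite -sumrB; apply: eq_bigr => j _; ring.
rewrite [RHS]exchange_big -sumrN; apply: eq_bigr => i _ /=.
rewrite [RHS]exchange_big -sumrN; apply: eq_bigr => j _ /=.
by rewrite -mulrBr mulr_suml -sumrN; apply: eq_bigr => t _; ring.
Qed.

Section BracketIdentity.
Variables (u phi dphi xi dxi eta deta : 'I_n -> R) (x y : T -> R).

(** Covariant x-derivative along the curve of a covector field with value [a] and x-derivative [da].
    At one point values and derivatives are independent vectors, so the identities of this section
    are purely algebraic. *)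
Definition covd a da i : R := da i - conn u a i.

(** Derivative of xi . (local part) eta in the direction [phi], with [xi] and [eta] fixed; [dphi]
    enters because [u] is the velocity of the curve. *)
Definition local_variation : R := \sum_i xi i *
  ((\sum_m dgi m i * phi m) * covd eta deta i
   - gi i * (dconn phi u eta i + conn dphi eta i)).

Definition weight (z : T -> R) i : R := \sum_t p t i * z t.

Definition ham_vector a da z i : R := gi i * covd a da i + u i * weight z i.

Definition flow_density t a : R := \sum_i a i * (p t i * u i).

(** Derivative of [flow_density t a] in the direction [phi], with [a] fixed. *)
Definition flow_variation t a : R :=
  \sum_i a i * (\sum_k dp t k i * phi k * u i + p t i * dphi i).

(* With u = R_x, x and y the potentials of the tails at xi and eta: for fixed xi
   and eta, the derivative of xi . J eta in the direction phi equals
   kernel_pairing up to the x-derivative of a boundary term. *)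
Definition kernel_pairing : R :=
  \sum_i phi i * (weight x i * covd eta deta i - weight y i * covd xi dxi i)
  + \sum_i conn phi eta i * ham_vector xi dxi x i
  - \sum_i conn phi xi i * ham_vector eta deta y i.

(** The x-derivative of the sum of [gi i * xi i * conn phi eta i], expanded by the product rule.
    Likewise [boundary_flow] is the x-derivative of the sum of [a i * (p t i * phi i)]. *)
Definition boundary_local : R :=
  \sum_i ((\sum_m dgi m i * u m) * xi i * conn phi eta i
          + gi i * dxi i * conn phi eta i
          + gi i * xi i * (dconn u phi eta i + conn dphi eta i + conn phi deta i)).

Definition boundary_flow t a da : R := \sum_i da i * (p t i * phi i)
   + \sum_i a i * (\sum_k dp t k i * u k * phi i + p t i * dphi i).

Lemma connB a b i : conn phi (fun j => a j - b j) i = conn phi a i - conn phi b i.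
Proof.
rewrite /conn -sumrB; apply: eq_bigr => l _.
by rewrite -sumrB; apply: eq_bigr => k _; rewrite mulrBr.
Qed.

(** Metric compatibility, used once along [phi] and once along [u], removes the derivatives of the
    inverse metric. What remains from commuting the two connection matrices is curvature, which the
    Gauss equation converts into products of tails. *)
Lemma local_identity : local_variation + boundary_local =
  \sum_i conn phi eta i * (gi i * covd xi dxi i)
  - \sum_i conn phi xi i * (gi i * covd eta deta i)
  + ((\sum_t (\sum_i xi i * (p t i * phi i)) * flow_density (s t) eta)
     - \sum_t flow_density (s t) xi * (\sum_j eta j * (p t j * phi j))).
Proof.
rewrite /flow_density -gauss_contract.
have C1 := metric_compatibility phi xi (covd eta deta).
have C2 := metric_compatibility u xi (conn phi eta).
transitivity (\sum_i (\sum_m dgi m i * phi m) * xi i * covd eta deta i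
  + \sum_i (\sum_m dgi m i * u m) * xi i * conn phi eta i
  + \sum_i (- (gi i * xi i * (dconn phi u eta i + conn dphi eta i))
     + gi i * dxi i * conn phi eta i
     + gi i * xi i * (dconn u phi eta i + conn dphi eta i + conn phi deta i))).
  rewrite -!big_split /=; apply: eq_bigr => i _; ring.
rewrite C1 C2 -!sumrN -!big_split /=; apply: eq_bigr => i _.
rewrite /covd connB; ring.
Qed.

(** By the Codazzi equation the variation of a flow density is a total x-derivative up to terms free
    of [dphi]. *)
Lemma flow_identity t a da : boundary_flow t a da = flow_variation t a +
  \sum_i p t i * phi i * covd a da i + \sum_i conn phi a i * (p t i * u i).
Proof.
have C := codazzi_contract t phi u a.
transitivity (\sum_i a i * (\sum_k dp t k i * phi k * u i) +
    \sum_i conn phi a i * (p t i * u i) - \sum_i conn u a i * (p t i * phi i)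
   + \sum_i (da i * (p t i * phi i) + a i * (p t i * dphi i))).
  rewrite C addrK /boundary_flow -!big_split /=; apply: eq_bigr => i _; ring.
rewrite -!sumrN -!big_split /=; apply: eq_bigr => i _; rewrite /covd; ring.
Qed.

Lemma weight_exchange (z : T -> R) a :
  \sum_t z t * (\sum_i a i * p t i) = \sum_i a i * weight z i.
Proof.
rewrite (eq_bigr (fun t => \sum_i a i * (p t i * z t))); last first.
  by move=> t _; rewrite mulr_sumr; apply: eq_bigr => i _; ring.
by rewrite exchange_big; apply: eq_bigr => i _; rewrite mulr_sumr.
Qed.

(** Boundary terms containing potentials, when differentiated, give products of a flow density with
    a term in [phi]. These are exactly the curvature terms of [local_identity]: here the Gauss
    equation couples the local part of the operator to its tails. *)
Lemma bracket_identity :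
  local_variation + \sum_t (flow_variation t xi * y t - flow_variation t eta * x t) =
  kernel_pairing - boundary_local +
  \sum_t (flow_density (s t) eta * (\sum_i xi i * (p t i * phi i))
     + boundary_flow t xi dxi * y t
     - flow_density (s t) xi * (\sum_i eta i * (p t i * phi i))
     - boundary_flow t eta deta * x t).
Proof.
have Wx (z : T -> R) a da : \sum_t z t * (\sum_i p t i * phi i * covd a da i +
    \sum_i conn phi a i * (p t i * u i)) =
    \sum_i (phi i * covd a da i + conn phi a i * u i) * weight z i.
  rewrite -weight_exchange; apply: eq_bigr => t _; congr (_ * _).
  by rewrite -big_split; apply: eq_bigr => i _ /=; ring.
have L := canRL (addrK _) local_identity.
rewrite [X in _ = _ + X](eq_bigr (fun t =>
  (flow_variation t xi * y t - flow_variation t eta * x t)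
  + (y t * (\sum_i p t i * phi i * covd xi dxi i +
    \sum_i conn phi xi i * (p t i * u i))
  - x t * (\sum_i p t i * phi i * covd eta deta i +
    \sum_i conn phi eta i * (p t i * u i)))
  + ((\sum_i xi i * (p t i * phi i)) * flow_density (s t) eta
     - flow_density (s t) xi * (\sum_j eta j * (p t j * phi j))))); last first.
  by move=> t _; rewrite !flow_identity; ring.
rewrite [in RHS]big_split [in RHS]big_split /= [X in _ + (_ + X + _)]sumrB.
rewrite [X in _ + (_ + X)]sumrB !Wx.
rewrite L.
have E : \sum_i (phi i * covd xi dxi i + conn phi xi i * u i) * weight y i
  - \sum_i (phi i * covd eta deta i + conn phi eta i * u i) * weight x i =
   - kernel_pairing + \sum_i conn phi eta i * (gi i * covd xi dxi i)
  - \sum_i conn phi xi i * (gi i * covd eta deta i).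
  rewrite /kernel_pairing -!sumrN -!big_split -!sumrN -!big_split /=.
  apply: eq_bigr => i _; rewrite /ham_vector; ring.
rewrite E; ring.
Qed.

End BracketIdentity.

(** The connection terms cancel in pairs by [conn_sym]. The other terms form, for each index, a 3 by
    3 determinant whose columns belong to the three covectors and whose rows are the Hamiltonian
    vectors, the weights and the covariant derivatives; the first row is a linear combination of the
    other two. *)
Lemma kernel_cyclic u xi dxi eta deta zeta dzeta (x y z : T -> R) :
  kernel_pairing u (ham_vector u zeta dzeta z) xi dxi eta deta x y
  + kernel_pairing u (ham_vector u xi dxi x) eta deta zeta dzeta y z
  + kernel_pairing u (ham_vector u eta deta y) zeta dzeta xi dxi z x = 0.
Proof.
have E (A1 A2 A3 c1 c2 c3 d1 d2 d3 : R) : A1 + A2 + A3 = 0 -> c1 = d1 -> c2 = d2 ->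
    c3 = d3 -> (A1 + c1 - c2) + (A2 + c3 - d1) + (A3 + d2 - d3) = 0.
  move=> A0 -> -> ->; rewrite (_ : _ + _ = A1 + A2 + A3)//; ring.
rewrite /kernel_pairing; apply: E; [|exact: conn_sym|exact: conn_sym|exact: conn_sym].
rewrite -!big_split /= big1// => i _; rewrite /ham_vector; ring.
Qed.

End Curvature.
End Connection.
End PointwiseAlgebra.

(** * Christoffel symbols of a diagonal metric *)

Section ChristoffelSymbols.
Context {R : realType} {n : nat}.
Variables (U : set 'rV[R]_n) (g : 'I_n -> 'rV[R]_n -> R).
Hypotheses (oU : open U) (sg : forall i, smooth_on U (g i)).
Hypothesis g0 : forall i x, U x -> g i x != 0.

Lemma metric_coef_sym i j : metric_coef g i j = metric_coef g j i.
Proof.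
apply/funext => x; rewrite /metric_coef [j == i]eq_sym.
by case: eqVneq => // ->.
Qed.

Lemma christoffel_sym k i j : christoffel g k i j = christoffel g k j i.
Proof.
apply/funext => x; rewrite /christoffel (metric_coef_sym j i); congr (_ * (_ - _)).
by rewrite addrC.
Qed.

Lemma metric_coef_diag i : metric_coef g i i = g i.
Proof. by apply/funext => x; rewrite /metric_coef eqxx. Qed.

Lemma metric_coef_offdiag i j : i != j -> metric_coef g i j = fun=> 0.
Proof. by move=> ij; apply/funext => x; rewrite /metric_coef (negbTE ij). Qed.

Lemma smooth_metric_coef i j : smooth_on U (metric_coef g i j).
Proof.
have [->|ij] := eqVneq i j; first by rewrite metric_coef_diag.
by rewrite metric_coef_offdiag//; exact: smooth_on_cst.
Qed.

Lemma smooth_inv_metric i : smooth_on U (fun x => (g i x)^-1).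
Proof. by apply: smooth_onV => //; exact: g0. Qed.

Lemma smooth_christoffel k i j : smooth_on U (christoffel g k i j).
Proof.
have sm l a b : smooth_on U (partial l (metric_coef g a b)).
  by apply: smooth_on_partial; exact: smooth_metric_coef.
apply: smooth_onM => //; last by apply: smooth_onB => //; exact: smooth_onD.
by apply: smooth_onM => //; [exact: smooth_on_cst|exact: smooth_inv_metric].
Qed.

Lemma metric_compat m i l x : U x ->
  (if i == l then partial m (fun z => (g i z)^-1) x else 0) =
  - (christoffel g i m l x * (g l x)^-1) - christoffel g l m i x * (g i x)^-1.
Proof.
move=> Ux; rewrite /christoffel.
have -> : partial l (metric_coef g i m) = partial l (metric_coef g m i).
  by rewrite metric_coef_sym.
have -> : partial i (metric_coef g l m) = partial i (metric_coef g m l).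
  by rewrite metric_coef_sym.
have -> : partial m (metric_coef g l i) = partial m (metric_coef g i l).
  by rewrite metric_coef_sym.
have gi0 := g0 i Ux; have gl0 := g0 l Ux.
have [il|il] := eqVneq i l.
  rewrite -il in gl0 *; rewrite metric_coef_diag partialV//.
    by field.
  exact: smooth_on_differentiable (sg i) Ux.
rewrite (metric_coef_offdiag il) partial_cst.
by field; rewrite gl0 gi0.
Qed.

Lemma christoffel_distinct k i j x : k != i -> k != j -> i != j ->
  christoffel g k i j x = 0.
Proof.
move=> ki kj ij; rewrite /christoffel !metric_coef_offdiag// !partial_cst.
by rewrite !addr0 subrr mulr0.
Qed.

End ChristoffelSymbols.

(** * The nonlocal operator, its skew-symmetry and its variation along a curve *)

Section DiagonalOperator.
Context {R : realType} {n : nat}.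
Variables (U : set 'rV[R]_n) (g : 'I_n -> 'rV[R]_n -> R).
Hypotheses (oU : open U) (sg : forall i, smooth_on U (g i)).
Hypothesis g0 : forall i x, U x -> g i x != 0.
Variables (T : finType) (s : T -> T) (p : T -> 'I_n -> 'rV[R]_n -> R).
Hypothesis s_inv : involutive s.
Hypothesis sp : forall t i, smooth_on U (p t i).
Hypothesis codazzi_p : forall t i j x, U x -> i != j ->
  partial j (p t i) x = (p t j x - p t i x) * christoffel g i i j x.
Hypothesis gauss_p : forall i j k l x, U x -> curvature g i j k l x =
  (((i == k) && (j == l))%:R - ((i == l) && (j == k))%:R) *
  \sum_t p t i x * p (s t) j x.

Local Notation gi z := (fun i => (g i z)^-1).
Local Notation dgi z := (fun m i => partial m (fun y => (g i y)^-1) z).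
Local Notation Gam z := (fun l j k => christoffel g l j k z).
Local Notation dGam z := (fun m l j k => partial m (christoffel g l j k) z).
Local Notation pz z := (fun t i => p t i z).
Local Notation dpz z := (fun t k i => partial k (p t i) z).

(* The involution s pairs the two tails of a (d/dx)^-1 b + b (d/dx)^-1 a: their
   sum is skew-adjoint, and no polarization is needed. *)
Definition nonlocal_op (r xi : R -> 'rV[R]_n) (x : R) : 'rV[R]_n :=
  local_op g r xi x + \sum_t tail_op (p t) (p (s t)) r xi x.

Definition density t (r xi : R -> 'rV[R]_n) (x : R) : R :=
  \sum_j p t j (r x) * derive1 r x 0 j * xi x 0 j.

Definition potential (r xi : R -> 'rV[R]_n) (x : R) t : R :=
  Dinv (density (s t) r xi) x.

Lemma nonlocal_opE r xi x i : nonlocal_op r xi x 0 i =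
  ham_vector (gi (r x)) (Gam (r x)) (pz (r x)) (fun j => derive1 r x 0 j)
    (fun j => xi x 0 j) (fun j => derive1 xi x 0 j) (potential r xi x) i.
Proof.
rewrite mxE summxE /ham_vector; congr (_ + _).
  rewrite mxE /covd mulrBr; congr (_ - _); rewrite mulr_sumr; apply: eq_bigr => l _.
  by rewrite mulr_sumr; apply: eq_bigr => k _; rewrite !mulrA.
rewrite mulr_sumr; apply: eq_bigr => t _; rewrite mxE /potential /density.
by rewrite mulrA [_ * p _ _ _]mulrC.
Qed.

Lemma densityE t r xi x : density t r xi x =
  flow_density (pz (r x)) (fun j => derive1 r x 0 j) t (fun j => xi x 0 j).
Proof. by apply: eq_bigr => j _; rewrite mulrC. Qed.

(** The diagonal Codazzi equation covers the index triples in which the upper index agrees with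
    exactly one lower index. For three distinct indices both sides vanish, the right one because
    such Christoffel symbols of a diagonal metric are zero. *)
Lemma codazzi_pz t i k l x : U x ->
  (if i == l then dpz x t k i else 0) - (if i == k then dpz x t l i else 0) =
  Gam x i l k * (p t k x - p t l x).
Proof.
move=> Ux; have [il|il] := eqVneq i l; have [ik|ik] := eqVneq i k.
- by rewrite -il -ik !subrr mulr0.
- by rewrite subr0 codazzi_p// -il mulrC.
- by rewrite sub0r codazzi_p// -ik /= christoffel_sym -mulNr opprB mulrC.
- have [->|lk] := eqVneq l k; first by rewrite !subrr mulr0.
  by rewrite /= christoffel_distinct// mul0r subrr.
Qed.

Lemma gauss_pz i j k l x : U x ->
  gi x i * (dGam x k j l i - dGam x l j k i +
    \sum_m (Gam x j k m * Gam x m l i - Gam x j l m * Gam x m k i)) =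
  (((j == k) && (i == l))%:R - ((j == l) && (i == k))%:R) *
  \sum_t p t j x * p (s t) i x.
Proof. by move=> Ux; rewrite -gauss_p. Qed.

Lemma Gam_sym z l j k : Gam z l j k = Gam z l k j.
Proof. by rewrite /= christoffel_sym. Qed.

Lemma dGam_sym z m l j k : dGam z m l j k = dGam z m l k j.
Proof. by rewrite /= christoffel_sym. Qed.

Definition covector m (xi : R -> 'rV[R]_n) : Prop :=
  smooth_curve xi /\ forall x, m < `|x| -> xi x = 0.

Lemma covector_smooth m xi i : covector m xi -> smooth1 (fun x => xi x 0 i).
Proof. by move=> [sx _]; exact: (@smooth_curve_coord _ _ _ i sx). Qed.

Lemma covector_csupp m xi i : covector m xi -> csupp m (fun x => xi x 0 i).
Proof.
move=> cx; split; first exact: smooth1_continuous (covector_smooth i cx).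
by move=> x mx; rewrite cx.2// mxE.
Qed.

Section AlongACurve.
Variable r : R -> 'rV[R]_n.
Hypothesis rU : curve_in U r.

Let sr : smooth_curve r := rU.1.
Let inU x : U (r x) := rU.2 x.

Lemma coef_smooth f : smooth_on U f -> smooth1 (fun x => f (r x)).
Proof.
move=> sf; apply: (smooth1_comp sf) => [i|x]; last exact: inU.
exact: (@smooth_curve_coord _ _ _ i sr).
Qed.

Lemma coef_derive f (x : R) : smooth_on U f ->
  is_derive x 1 (fun y => f (r y)) (\sum_k partial k f (r x) * derive1 r x 0 k).
Proof.
move=> sf; apply: is_derive_comp_curve.
  exact: smooth_on_differentiable sf (inU x).
apply: DeriveDef; first exact: smooth_curve_derivable.
by rewrite derive1E.
Qed.

Lemma velocity_smooth i : smooth1 (fun x => derive1 r x 0 i).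
Proof. exact: (@smooth_curve_derive1 _ _ _ i sr). Qed.

Lemma density_smooth m t xi : covector m xi -> smooth1 (density t r xi).
Proof.
move=> cx; rewrite (_ : density t r xi =
    fun x => \sum_j p t j (r x) * derive1 r x 0 j * xi x 0 j) //.
apply: smooth1_sum => j.
exact: (smooth1M (smooth1M (coef_smooth (sp t j)) (velocity_smooth j))
  (covector_smooth j cx)).
Qed.

Lemma density_csupp m t xi : covector m xi -> csupp m (density t r xi).
Proof.
move=> cx; split; first exact: smooth1_continuous (density_smooth t cx).
by move=> x mx; apply: big1 => j _; rewrite cx.2// mxE mulr0.
Qed.

Lemma potential_derive m xi t (x : R) : covector m xi ->
  is_derive x 1 (fun y => potential r xi y t) (density (s t) r xi x).
Proof. by move=> cx; exact: Dinv_derive (density_csupp (s t) cx). Qed.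

Lemma potential_smooth m xi t : covector m xi ->
  smooth1 (fun x => potential r xi x t).
Proof.
move=> cx; apply: (smooth1_antiderivative (density_smooth (s t) cx)) => x.
exact: potential_derive cx.
Qed.

Lemma conn_smooth (phi a : R -> 'I_n -> R) i :
  (forall j, smooth1 (phi^~ j)) -> (forall j, smooth1 (a^~ j)) ->
  smooth1 (fun x => conn (Gam (r x)) (phi x) (a x) i).
Proof.
move=> sphi sa; apply: smooth1_sum => l; apply: smooth1_sum => k.
exact: (smooth1M (smooth1M (coef_smooth (smooth_christoffel oU sg g0 l i k)) (sphi k)) (sa l)).
Qed.

Lemma covd_smooth m xi i : covector m xi -> smooth1 (fun x =>
  covd (Gam (r x)) (fun j => derive1 r x 0 j) (fun j => xi x 0 j)
    (fun j => derive1 xi x 0 j) i).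
Proof.
move=> cx; apply: smooth1B; first exact: (@smooth_curve_derive1 _ _ _ i cx.1).
apply: (@conn_smooth (fun x j => derive1 r x 0 j) (fun x j => xi x 0 j)).
  exact: velocity_smooth.
by move=> j; exact: covector_smooth cx.
Qed.

Lemma weight_smooth m xi i : covector m xi -> smooth1 (fun x =>
  weight (pz (r x)) (potential r xi x) i).
Proof.
move=> cx; apply: smooth1_sum => t.
exact: (smooth1M (coef_smooth (sp t i)) (potential_smooth t cx)).
Qed.

Lemma nonlocal_op_smooth m xi : covector m xi -> smooth_curve (nonlocal_op r xi).
Proof.
move=> cx; apply/smooth_curveP => i.
rewrite (_ : (fun _ => _) = fun x => ham_vector (gi (r x)) (Gam (r x)) (pz (r x))
    (fun j => derive1 r x 0 j) (fun j => xi x 0 j) (fun j => derive1 xi x 0 j)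
    (potential r xi x) i); last by apply/funext => x; rewrite nonlocal_opE.
apply: smooth1D.
  exact: (smooth1M (coef_smooth (smooth_inv_metric oU sg g0 i)) (covd_smooth i cx)).
exact: (smooth1M (velocity_smooth i) (weight_smooth i cx)).
Qed.

Lemma covd_out m xi i x : covector m xi -> m < `|x| ->
  covd (Gam (r x)) (fun j => derive1 r x 0 j) (fun j => xi x 0 j)
    (fun j => derive1 xi x 0 j) i = 0.
Proof.
move=> [sx x0] mx; rewrite /covd /conn.
rewrite [X in _ - X]big1 ?subr0; last first.
  by move=> l _; rewrite big1// => k _; rewrite x0// mxE mulr0.
rewrite derive1_coord; last exact: smooth_curve_derivable.
rewrite derive1E (near_eq_derive (g := cst 0)); first exact: derive_cst.
have nm : nbhs `|x| [set z | m < z].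
  by apply: open_nbhs_nbhs; split => //; exact: open_gt.
have nx : \forall y \near x, m < `|y| := @norm_continuous _ _ x _ nm.
by apply: filterS nx => y my; rewrite x0// mxE.
Qed.

(** The local parts of the two pairings add up to the x-derivative of the sum of g^ii xi_i eta_i. In
    the tails, the term of index [t] in one pairing is matched with the term of index [s t] in the
    other through skew-adjointness of [Dinv]. *)
Lemma pairing_skew m xi eta : covector m xi -> covector m eta ->
  pairing xi (nonlocal_op r eta) = - pairing eta (nonlocal_op r xi).
Proof.
move=> cx ce.
have E a b : covector m a -> covector m b -> pairing a (nonlocal_op r b) =
    integ (fun x => \sum_i (g i (r x))^-1 * covd (Gam (r x)) (fun j => derive1 r x 0 j)
      (fun j => b x 0 j) (fun j => derive1 b x 0 j) i * a x 0 i)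
    + \sum_t integ (fun x => density t r a x * Dinv (density (s t) r b) x).
  move=> ca cb.
  rewrite -(@integ_sum _ m); last first.
    move=> t; apply: csuppMr; last exact: density_csupp.
    exact: Dinv_continuous (density_csupp (s t) cb).
  rewrite -(@integD _ m); last 2 first.
  - apply: csupp_sum => i; apply: csuppMl; last exact: covector_csupp.
    apply: smooth1_continuous.
    exact: (smooth1M (coef_smooth (smooth_inv_metric oU sg g0 i)) (covd_smooth i cb)).
  - apply: csupp_sum => t; apply: csuppMr; last exact: density_csupp.
    exact: Dinv_continuous (density_csupp (s t) cb).
  congr integ; apply/funext => x.
  rewrite (eq_bigr (fun t => potential r b x t * (\sum_i (a x 0 i * derive1 r x 0 i) * p t i (r x)))).
    rewrite (weight_exchange (pz (r x))) -big_split; apply: eq_bigr => i _ /=.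
    by rewrite nonlocal_opE /ham_vector; ring.
  move=> t _; rewrite mulrC; congr (_ * _).
  by apply: eq_bigr => i _; ring.
rewrite !E// opprD; congr (_ + _); last first.
  rewrite -sumrN (reindex_inj (can_inj s_inv)); apply: eq_bigr => t _.
  rewrite s_inv.
  exact: (Dinv_skew (density_csupp (s t) cx) (density_csupp t ce)).
apply/eqP; rewrite -addr_eq0; apply/eqP.
have c1 a b : covector m a -> covector m b -> csupp m (fun x => \sum_i (g i (r x))^-1 *
    covd (Gam (r x)) (fun j => derive1 r x 0 j)
      (fun j => b x 0 j) (fun j => derive1 b x 0 j) i * a x 0 i).
  move=> ca cb; apply: csupp_sum => i; apply: csuppMl; last exact: covector_csupp.
  apply: smooth1_continuous.
  exact: (smooth1M (coef_smooth (smooth_inv_metric oU sg g0 i)) (covd_smooth i cb)).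
rewrite -(integD (c1 _ _ cx ce) (c1 _ _ ce cx)).
apply: (@integ_derive0 _ m _ (fun x => \sum_i (g i (r x))^-1 * (xi x 0 i * eta x 0 i))).
- exact: csuppD (c1 _ _ cx ce) (c1 _ _ ce cx).
- move=> x; apply: is_derive_eq.
    apply: is_derive_sum_fun => i; apply: is_deriveM_fun.
      exact: (coef_derive x (smooth_inv_metric oU sg g0 i)).
    exact: (is_deriveM_fun (smooth1_is_derive x (covector_smooth i cx))
      (smooth1_is_derive x (covector_smooth i ce))).
  have := metric_compatibility (Gam_sym (r x)) (fun m i l => metric_compat sg g0 m i l (inU x))
    (fun j => derive1 r x 0 j) (fun j => xi x 0 j) (fun j => eta x 0 j).
  rewrite /= => C; rewrite big_split /= addrC.
  rewrite [X in X + _](eq_bigr (fun i => (\sum_m partial m (fun z => (g i z)^-1) (r x) *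
    derive1 r x 0 m) * xi x 0 i * eta x 0 i)); last by move=> i _; ring.
  rewrite C -!sumrN -!big_split /=; apply: eq_bigr => i _.
  rewrite /covd (derive1_coord i (@smooth_curve_derivable _ _ _ x cx.1)).
  by rewrite (derive1_coord i (@smooth_curve_derivable _ _ _ x ce.1)); ring.
- by move=> x mx; rewrite big1// => i _; rewrite cx.2// mxE mul0r mulr0.
Qed.

Implicit Types (xi eta : R -> 'rV[R]_n).

Local Notation vel x := (fun j => derive1 r x 0 j).
Local Notation co xi x := (fun j => xi x 0 j).
Local Notation dco xi x := (fun j => derive1 xi x 0 j).

(** The covector field kappa(xi, eta) that represents [kernel_pairing]. In the connection terms
    [conn_sym] has moved [phi] out of the connection matrix, and the Hamiltonian vectors have taken
    its place. *)
Definition kernel (xi eta : R -> 'rV[R]_n) (x : R) : 'rV[R]_n := \row_i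
  (weight (pz (r x)) (potential r xi x) i *
     covd (Gam (r x)) (vel x) (co eta x) (dco eta x) i
   - weight (pz (r x)) (potential r eta x) i *
     covd (Gam (r x)) (vel x) (co xi x) (dco xi x) i
   + conn (Gam (r x)) (co (nonlocal_op r xi) x) (co eta x) i
   - conn (Gam (r x)) (co (nonlocal_op r eta) x) (co xi x) i).

Lemma kernelE xi eta (phi : R -> 'rV[R]_n) x : \sum_i kernel xi eta x 0 i * phi x 0 i =
  kernel_pairing (gi (r x)) (Gam (r x)) (pz (r x)) (vel x) (co phi x)
    (co xi x) (dco xi x) (co eta x) (dco eta x) (potential r xi x) (potential r eta x).
Proof.
rewrite /kernel_pairing.
have E (a b : R -> 'rV[R]_n) : \sum_i conn (Gam (r x)) (co phi x) (co a x) i *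
    ham_vector (gi (r x)) (Gam (r x)) (pz (r x)) (vel x) (co b x) (dco b x)
      (potential r b x) i =
    \sum_i conn (Gam (r x)) (co (nonlocal_op r b) x) (co a x) i * phi x 0 i.
  rewrite [RHS](conn_sym (Gam_sym (r x))).
  by apply: eq_bigr => i _; rewrite nonlocal_opE.
rewrite !E -!sumrN -!big_split /=; apply: eq_bigr => i _; rewrite mxE; ring.
Qed.

(** The potentials and the Hamiltonian vectors need not vanish outside the window, but each term
    contains [xi], [eta] or a covariant derivative of one of them. *)
Lemma kernel_covector m xi eta : covector m xi -> covector m eta ->
  covector m (kernel xi eta).
Proof.
move=> cx ce; split.
  apply: smooth_curve_row => i.
  have J (a b : R -> 'rV[R]_n) : covector m a -> covector m b ->
      smooth1 (fun x => conn (Gam (r x)) (co (nonlocal_op r a) x) (co b x) i).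
    move=> ca cb; apply: (@conn_smooth (fun x => co (nonlocal_op r a) x)
      (fun x => co b x)) => j.
      exact: (@smooth_curve_coord _ _ _ j (nonlocal_op_smooth ca)).
    exact: covector_smooth j cb.
  exact: (smooth1B (smooth1D (smooth1B
    (smooth1M (weight_smooth i cx) (covd_smooth i ce))
    (smooth1M (weight_smooth i ce) (covd_smooth i cx))) (J _ _ cx ce)) (J _ _ ce cx)).
move=> x mx; apply/rowP => i; rewrite !mxE (covd_out i cx mx) (covd_out i ce mx).
have J a (b : R -> 'rV[R]_n) : covector m b -> conn (Gam (r x)) a (co b x) i = 0.
  by move=> cb; apply: big1 => l _; apply: big1 => k _; rewrite cb.2// mxE mulr0.
by rewrite !J// !mulr0 subrr addr0 subrr.
Qed.

Section Boundary.
Variable phi : R -> 'rV[R]_n.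
Hypothesis sphi : smooth_curve phi.

Let phi_derive j (x : R) : is_derive x 1 (fun y => phi y 0 j) (derive1 phi x 0 j).
Proof.
rewrite derive1_coord; last exact: smooth_curve_derivable.
apply: smooth1_is_derive; exact: (@smooth_curve_coord _ _ _ j sphi).
Qed.

Let covector_derive m xi j (x : R) : covector m xi ->
  is_derive x 1 (fun y => xi y 0 j) (derive1 xi x 0 j).
Proof.
move=> cx; rewrite derive1_coord; last exact: smooth_curve_derivable cx.1.
apply: smooth1_is_derive; exact: covector_smooth j cx.
Qed.

Lemma conn_derive m eta i (x : R) : covector m eta ->
  is_derive x 1 (fun y => conn (Gam (r y)) (co phi y) (co eta y) i)
   (dconn (dGam (r x)) (vel x) (co phi x) (co eta x) i
    + conn (Gam (r x)) (dco phi x) (co eta x) i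
    + conn (Gam (r x)) (co phi x) (dco eta x) i).
Proof.
move=> ce; apply: is_derive_eq.
  apply: is_derive_sum_fun => l; apply: is_derive_sum_fun => k.
  apply: is_deriveM_fun; last exact: covector_derive l x ce.
  apply: is_deriveM_fun; last exact: phi_derive.
  exact: (coef_derive x (smooth_christoffel oU sg g0 l i k)).
rewrite /conn /dconn -!big_split /=; apply: eq_bigr => l _.
rewrite -!big_split /=; apply: eq_bigr => k _; ring.
Qed.

Let covector_flow xi t (x : R) : R := \sum_i xi x 0 i * (p t i (r x) * phi x 0 i).

Lemma covector_flow_derive m xi t (x : R) : covector m xi ->
  is_derive x 1 (covector_flow xi t)
    (boundary_flow (pz (r x)) (dpz (r x)) (vel x) (co phi x) (dco phi x) t
      (co xi x) (dco xi x)).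
Proof.
move=> cx; apply: is_derive_eq.
  apply: is_derive_sum_fun => i; apply: is_deriveM_fun; first exact: covector_derive i x cx.
  apply: is_deriveM_fun; last exact: phi_derive.
  exact: (coef_derive x (sp t i)).
rewrite /boundary_flow -!big_split /=; apply: eq_bigr => i _.
have -> : \sum_k partial k (p t i) (r x) * derive1 r x 0 k * phi x 0 i =
    (\sum_k partial k (p t i) (r x) * derive1 r x 0 k) * phi x 0 i.
  by rewrite mulr_suml.
ring.
Qed.

(** The quantity whose x-derivative separates the varied integrand from the kernel pairing. Each
    potential is multiplied by an expression linear in the other covector, so the whole has compact
    support although the potentials do not. *)
Definition boundary_term xi eta (x : R) : R :=
  - (\sum_i (g i (r x))^-1 * xi x 0 i * conn (Gam (r x)) (co phi x) (co eta x) i)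
  + \sum_t (potential r eta x t * covector_flow xi t x
            - potential r xi x t * covector_flow eta t x).

Lemma boundary_term_derive m xi eta (x : R) : covector m xi -> covector m eta ->
  is_derive x 1 (boundary_term xi eta)
  (- boundary_local (gi (r x)) (dgi (r x)) (Gam (r x)) (dGam (r x))
       (vel x) (co phi x) (dco phi x) (co xi x) (dco xi x) (co eta x) (dco eta x)
   + \sum_t (flow_density (pz (r x)) (vel x) (s t) (co eta x) *
       (\sum_i xi x 0 i * (p t i (r x) * phi x 0 i))
     + boundary_flow (pz (r x)) (dpz (r x)) (vel x) (co phi x) (dco phi x) t
         (co xi x) (dco xi x) * potential r eta x t
     - flow_density (pz (r x)) (vel x) (s t) (co xi x) *
       (\sum_i eta x 0 i * (p t i (r x) * phi x 0 i))
     - boundary_flow (pz (r x)) (dpz (r x)) (vel x) (co phi x) (dco phi x) t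
         (co eta x) (dco eta x) * potential r xi x t)).
Proof.
move=> cx ce; apply: is_deriveD_fun.
  apply: is_deriveN.
  apply: is_derive_eq.
    apply: is_derive_sum_fun => i; apply: is_deriveM_fun; last exact: conn_derive i x ce.
    apply: is_deriveM_fun; last exact: covector_derive i x cx.
    exact: (coef_derive x (smooth_inv_metric oU sg g0 i)).
  apply: eq_bigr => i _; ring.
apply: is_derive_sum_fun => t; rewrite -!densityE.
have H := is_deriveB_fun
  (is_deriveM_fun (potential_derive t x ce) (covector_flow_derive t x cx))
  (is_deriveM_fun (potential_derive t x cx) (covector_flow_derive t x ce)).
apply: (is_derive_eq H).
rewrite /covector_flow; ring.
Qed.

Lemma boundary_term_out m xi eta x : covector m xi -> covector m eta -> m < `|x| ->
  boundary_term xi eta x = 0.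
Proof.
move=> cx ce mx; rewrite /boundary_term big1 ?oppr0 ?add0r; last first.
  by move=> i _; rewrite cx.2// mxE mulr0 mul0r.
rewrite big1// => t _; rewrite /covector_flow !big1 ?mulr0 ?subrr// => i _.
  by rewrite ce.2// mxE mul0r.
by rewrite cx.2// mxE mul0r.
Qed.

End Boundary.

(** Regrouping for [op_jet]: [c0] and [c1] are the variation and the value of the inverse metric.
    The result separates the operator applied to the varied argument from the variation of the
    operator. *)
Let double_sum_variation (c0 c1 d0 d1 : R) (A1 A2 A3 A4 Q : 'I_n -> 'I_n -> R) :
  (forall j k, Q j k = c0 * A1 j k + c1 * A2 j k + c1 * A3 j k + A4 j k) ->
  c0 * d0 + c1 * d1 - \sum_j \sum_k Q j k =
  c1 * d1 - \sum_j \sum_k A4 j k + (c0 * (d0 - \sum_j \sum_k A1 j k)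
    - c1 * (\sum_j \sum_k A2 j k + \sum_j \sum_k A3 j k)).
Proof.
move=> QE; have P (c : R) (f : 'I_n -> 'I_n -> R) :
    \sum_j \sum_k c * f j k = c * \sum_j \sum_k f j k.
  by rewrite mulr_sumr; apply: eq_bigr => j _; rewrite mulr_sumr.
have -> : \sum_j \sum_k Q j k = c0 * (\sum_j \sum_k A1 j k) +
    c1 * (\sum_j \sum_k A2 j k) + c1 * (\sum_j \sum_k A3 j k) +
    (\sum_j \sum_k A4 j k).
  rewrite -!P -!big_split; apply: eq_bigr => j _ /=.
  by rewrite -!big_split; apply: eq_bigr => k _ /=.
ring.
Qed.

Section Variation.
Variables (phi : R -> 'rV[R]_n) (m : R).
Hypotheses (sphi : smooth_curve phi) (m0 : 0 <= m).

Definition shifted (e : R) : R -> 'rV[R]_n := fun x => r x + e *: phi x.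

Lemma shifted0 : shifted 0 = r.
Proof. by apply/funext => x; rewrite /shifted scale0r addr0. Qed.

Lemma shifted_smooth e : smooth_curve (shifted e).
Proof.
apply/smooth_curveP => i.
rewrite (_ : (fun _ => _) = fun x => r x 0 i + e * phi x 0 i); last first.
  by apply/funext => x; rewrite !mxE.
exact: (smooth1D (@smooth_curve_coord _ _ _ i sr)
  (smooth1M (@smooth1_cst _ e) (@smooth_curve_coord _ _ _ i sphi))).
Qed.

(** The margin 1 beyond the window is the one that [csupp_local_mul] asks for. *)
Lemma shifted_in : exists2 d, 0 < d & forall e, `|e| < d -> forall x, `|x| <= m + 1 ->
  U (shifted e x).
Proof.
have cz : forall (_ : unit) (z : 'rV[R]_n), U z -> {for z, continuous (fun=> 0 : R)}.
  by move=> _ z _; exact: cst_continuous.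
have [d d0 [N _ H]] := uniform_local_bound (m := m + 1) oU cz
  (smooth_curve_continuous sr) (fun x _ => inU x).
have cn : continuous (fun x => `|phi x|).
  move=> x; apply: continuous_comp; last exact: norm_continuous.
  exact: (smooth_curve_continuous sphi).
have [B B0 HB] := bounded_on (m + 1) cn.
have B1 : 0 < B + 1 by rewrite ltr_wpDl.
exists (d / (B + 1)); first by rewrite divr_gt0.
move=> e; rewrite ltr_pdivlMr// => ed x xm.
have [|//] := H x (e *: phi x) xm.
apply: le_lt_trans ed; rewrite normrZ; apply: ler_wpM2l => //.
by have := HB x xm; rewrite normr_id; lra.
Qed.

Lemma coef_jet f : smooth_on U f -> pjet m (fun e x => f (shifted e x))
  (fun x => f (r x)) (fun x => \sum_k partial k f (r x) * phi x 0 k).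
Proof.
move=> sf; split => [x|]; first by rewrite shifted0.
exact: (jet_comp oU sf (smooth_curve_continuous sr) (smooth_curve_continuous sphi)
  (fun x _ => inU x)).
Qed.

Lemma velocity_shifted e x j :
  derive1 (shifted e) x 0 j = derive1 r x 0 j + e * derive1 phi x 0 j.
Proof.
rewrite (derive1_coord _ (@smooth_curve_derivable _ _ _ x (@shifted_smooth e))).
rewrite (derive1_coord _ (@smooth_curve_derivable _ _ _ x sr)).
rewrite (derive1_coord _ (@smooth_curve_derivable _ _ _ x sphi)).
have H := is_deriveD_fun (smooth1_is_derive x (@smooth_curve_coord _ _ _ j sr))
  (is_deriveZ_fun e (smooth1_is_derive x (@smooth_curve_coord _ _ _ j sphi))).
rewrite [LHS]derive1E (_ : (fun y => shifted e y 0 j) =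
  fun y => r y 0 j + e * phi y 0 j); first by rewrite derive_val.
by apply/funext => y; rewrite !mxE.
Qed.

Lemma velocity_jet j : pjet m (fun e x => derive1 (shifted e) x 0 j)
  (fun x => derive1 r x 0 j) (fun x => derive1 phi x 0 j).
Proof.
split => [x|]; first by rewrite shifted0.
have := jet_affine m (smooth1_continuous (velocity_smooth j))
  (smooth1_continuous (@smooth_curve_derive1 _ _ _ j sphi)).
by move=> jt; apply: (eq_jet jt) => // e x; rewrite velocity_shifted.
Qed.

(** The operator differentiates its argument, and a jet in [e] cannot be differentiated in [x]; the
    expansion of the x-derivative is therefore a separate requirement. Gradients along displaced
    curves are the intended instance. *)
Definition covector_family (X : R -> R -> 'rV[R]_n) (X0 X1 : R -> 'rV[R]_n) : Prop :=
  [/\ X 0 = X0,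
      exists2 d, 0 < d & forall e, `|e| < d -> covector m (X e),
      covector m X1,
      forall i, jet m (fun e x => X e x 0 i) (fun x => X1 x 0 i) &
      forall i, jet m (fun e x => derive1 (X e) x 0 i) (fun x => derive1 X1 x 0 i)].

Lemma covector_family0 X X0 X1 : covector_family X X0 X1 -> covector m X0.
Proof. by move=> [<- [d d0 H] _ _ _]; apply: H; rewrite normr0. Qed.

Definition flow_var t eta (x : R) : R :=
  flow_variation (pz (r x)) (dpz (r x)) (vel x) (co phi x) (dco phi x) t (co eta x).

Let flow_coef t i (x : R) : R := \sum_k partial k (p t i) (r x) * phi x 0 k *
  derive1 r x 0 i + p t i (r x) * derive1 phi x 0 i.

Let flow_coef_smooth t i : smooth1 (flow_coef t i).
Proof.
apply: smooth1D.
  apply: smooth1_sum => k.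
  exact: (smooth1M (smooth1M (coef_smooth (smooth_on_partial k (sp t i)))
    (@smooth_curve_coord _ _ _ k sphi)) (velocity_smooth i)).
exact: (smooth1M (coef_smooth (sp t i)) (@smooth_curve_derive1 _ _ _ i sphi)).
Qed.

Lemma flow_var_csupp t eta : covector m eta -> csupp m (flow_var t eta).
Proof.
move=> ce; apply: csupp_sum => i; apply: csuppMr; last exact: covector_csupp i ce.
exact: smooth1_continuous (flow_coef_smooth t i).
Qed.

Lemma density_jet t X X0 X1 : covector_family X X0 X1 ->
  pjet m (fun e => density t (shifted e) (X e)) (density t r X0)
    (fun x => flow_var t X0 x + density t r X1 x).
Proof.
move=> [X00 _ _ jX _].
have jp := pjet_sum (index_enum 'I_n) (fun j => pjetM (pjetM (coef_jet (sp t j))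
  (velocity_jet j)) (conj (fun x => congr1 (fun Y : R -> 'rV[R]_n => Y x 0 j) X00) (jX j))).
apply: (eq_pjet jp) => // x.
rewrite /flow_var /flow_variation /density -big_split; apply: eq_bigr => j _ /=.
rewrite -mulr_suml; ring.
Qed.

Lemma shifted_coef_continuous f e x : smooth_on U f -> U (shifted e x) ->
  {for x, continuous (fun y => f (shifted e y))}.
Proof.
move=> sf Ux; apply: (@continuous_comp _ _ _ (shifted e) f).
  exact: (smooth_curve_continuous (@shifted_smooth e)).
apply/differentiable_continuous; exact: smooth_on_differentiable sf Ux.
Qed.

Let shifted_velocity_continuous e j : continuous (fun x => derive1 (shifted e) x 0 j).
Proof. exact: smooth1_continuous (@smooth_curve_derive1 _ _ _ j (@shifted_smooth e)). Qed.

Lemma density_near t X X0 X1 : covector_family X X0 X1 ->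
  exists2 d, 0 < d & forall e, `|e| < d -> csupp m (density t (shifted e) (X e)).
Proof.
move=> [_ [d d0 cX] _ _ _]; have [d' d'0 sU] := shifted_in.
exists (Num.min d d'); first by rewrite lt_min d0.
move=> e; rewrite lt_min => /andP[ed ed']; apply: csupp_sum => j.
apply: csupp_local_mul; last exact: covector_csupp j (cX e ed).
move=> x xm; apply: continuousM.
  by apply: shifted_coef_continuous (sp t j) _; apply: sU => //; exact: ltW.
exact: shifted_velocity_continuous.
Qed.

(** The derivative of the operator in the direction [phi], applied to a fixed covector. In a tail
    both the outer coefficient and the density under [Dinv] are varied. *)
Definition op_var eta (x : R) i : R :=
  (\sum_k partial k (fun y => (g i y)^-1) (r x) * phi x 0 k) *
    covd (Gam (r x)) (vel x) (co eta x) (dco eta x) i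
  - (g i (r x))^-1 * (dconn (dGam (r x)) (co phi x) (vel x) (co eta x) i
    + conn (Gam (r x)) (dco phi x) (co eta x) i)
  + \sum_t (flow_coef t i x * potential r eta x t
    + p t i (r x) * derive1 r x 0 i * Dinv (flow_var (s t) eta) x).

Lemma op_jet X X0 X1 i : covector_family X X0 X1 ->
  pjet m (fun e x => nonlocal_op (shifted e) (X e) x 0 i)
    (fun x => nonlocal_op r X0 x 0 i)
    (fun x => nonlocal_op r X1 x 0 i + op_var X0 x i).
Proof.
move=> cX; have [X00 _ cX1 jX jdX] := cX; have cX0 := covector_family0 cX.
have pX j : pjet m (fun e x => X e x 0 j) (fun x => X0 x 0 j) (fun x => X1 x 0 j).
  by split => // x; rewrite X00.
have pdX j : pjet m (fun e x => derive1 (X e) x 0 j) (fun x => derive1 X0 x 0 j)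
    (fun x => derive1 X1 x 0 j) by split => // x; rewrite X00.
have jg := coef_jet (smooth_inv_metric oU sg g0 i).
have jG j k := coef_jet (smooth_christoffel oU sg g0 j i k).
have jD t := pjet_Dinv m0 (density_near (s t) cX)
  (csuppD (flow_var_csupp (s t) cX0) (density_csupp (s t) cX1)) (density_jet (s t) cX).
have jt := pjetD (pjetB (pjetM jg (pdX i)) (pjet_sum (index_enum 'I_n) (fun j =>
    pjet_sum (index_enum 'I_n) (fun k => pjetM (pjetM (pjetM jg (jG j k)) (velocity_jet k)) (pX j)))))
  (pjet_sum (index_enum T) (fun t => pjetM (pjetM (coef_jet (sp t i)) (velocity_jet i)) (jD t))).
apply: (eq_pjet jt) => [e x|x|x].
- rewrite mxE summxE mxE; congr (_ + _); apply: eq_bigr => t _; by rewrite mxE.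
- rewrite mxE summxE mxE; congr (_ + _); apply: eq_bigr => t _; by rewrite mxE.
- rewrite mxE summxE mxE /op_var [RHS]addrACA; congr (_ + _).
    rewrite /covd /conn /dconn; set gd := \sum_k _ * _.
    by apply: double_sum_variation => j k; rewrite /gd; ring.
  rewrite -big_split; apply: eq_bigr => t _ /=; rewrite mxE.
  rewrite (DinvD x (flow_var_csupp (s t) cX0) (density_csupp (s t) cX1)).
  rewrite /flow_coef -mulr_suml /potential; ring.
Qed.

Lemma sum_continuous (I : Type) (q : seq I) (F : I -> R -> R) (x : R) :
  (forall k, {for x, continuous (F k)}) ->
  {for x, continuous (fun y => \sum_(k <- q) F k y)}.
Proof.
move=> cF; have -> : (fun y => \sum_(k <- q) F k y) = \sum_(k <- q) F k.
  by apply/funext => y; rewrite fct_sumE.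
elim/big_ind : _ => [|u v cu cv|k _]; first exact: cst_continuous.
- exact: continuousD cu cv.
- exact: cF.
Qed.

(** For small [e] the displaced curve is known to lie in [U] only around the window, so the
    smoothness of the operator along curves in [U] does not apply to it. Continuity near the window
    is what the integrability of the varied integrand requires. *)
Lemma op_near X X0 X1 i : covector_family X X0 X1 ->
  exists2 d, 0 < d & forall e x, `|e| < d -> `|x| < m + 1 ->
    {for x, continuous (fun y => nonlocal_op (shifted e) (X e) y 0 i)}.
Proof.
move=> cX; have [_ [d d0 cXe] _ _ _] := cX; have [d' d'0 sU] := shifted_in.
have [d1 d10 cD] := common_radius (fun t => density_near (s t) cX).
exists (Num.min (Num.min d d') d1); first by rewrite !lt_min d0 d'0.
move=> e x; rewrite !lt_min => /andP[/andP[ed ed'] ed1] xm.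
have Ux : U (shifted e x) by apply: sU => //; exact: ltW.
have cc f : smooth_on U f -> {for x, continuous (fun y => f (shifted e y))}.
  by move=> sf; exact: shifted_coef_continuous.
have cXi j := smooth1_continuous (covector_smooth j (cXe e ed)) (x := x).
rewrite (_ : (fun y => nonlocal_op _ _ y 0 i) = fun y =>
  (g i (shifted e y))^-1 * derive1 (X e) y 0 i
  - \sum_j \sum_k (g i (shifted e y))^-1 * christoffel g j i k (shifted e y) *
      derive1 (shifted e) y 0 k * X e y 0 j
  + \sum_t p t i (shifted e y) * derive1 (shifted e) y 0 i *
      Dinv (density (s t) (shifted e) (X e)) y); last first.
  apply/funext => y; rewrite mxE summxE mxE; congr (_ + _).
  by apply: eq_bigr => t _; rewrite mxE.
apply: continuousD.
  apply: continuousB.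
    apply: continuousM; first exact: cc (smooth_inv_metric oU sg g0 i).
    exact: smooth1_continuous (@smooth_curve_derive1 _ _ _ i (cXe e ed).1) _.
  apply: sum_continuous => j; apply: sum_continuous => k.
  apply: continuousM; last exact: cXi.
  apply: continuousM; last exact: shifted_velocity_continuous.
  apply: continuousM; first exact: cc (smooth_inv_metric oU sg g0 i).
  exact: cc (smooth_christoffel oU sg g0 j i k).
apply: sum_continuous => t; apply: continuousM.
  apply: continuousM; first exact: cc (sp t i).
  exact: shifted_velocity_continuous.
exact: Dinv_continuous (cD e ed1 t) _.
Qed.

Lemma op_var_smooth eta i : covector m eta -> smooth1 (fun x => op_var eta x i).
Proof.
move=> ce.
have sd : smooth1 (fun x => \sum_k partial k (fun y => (g i y)^-1) (r x) * phi x 0 k).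
  apply: smooth1_sum => k.
  exact: (smooth1M (coef_smooth (smooth_on_partial k (smooth_inv_metric oU sg g0 i)))
    (@smooth_curve_coord _ _ _ k sphi)).
have sdc : smooth1 (fun x => dconn (dGam (r x)) (co phi x) (vel x) (co eta x) i).
  apply: smooth1_sum => l; apply: smooth1_sum => k.
  apply: smooth1M; last exact: covector_smooth l ce.
  apply: smooth1M; last exact: velocity_smooth.
  apply: smooth1_sum => j.
  exact: (smooth1M (coef_smooth (smooth_on_partial j (smooth_christoffel oU sg g0 l i k)))
    (@smooth_curve_coord _ _ _ j sphi)).
have sc : smooth1 (fun x => conn (Gam (r x)) (dco phi x) (co eta x) i).
  apply: (@conn_smooth (fun x => dco phi x) (fun x => co eta x)) => j.
    exact: (@smooth_curve_derive1 _ _ _ j sphi).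
  exact: covector_smooth j ce.
apply: smooth1D.
  exact: (smooth1B (smooth1M sd (covd_smooth i ce))
    (smooth1M (coef_smooth (smooth_inv_metric oU sg g0 i)) (smooth1D sdc sc))).
apply: smooth1_sum => t; apply: smooth1D.
  exact: (smooth1M (flow_coef_smooth t i) (potential_smooth t ce)).
apply: smooth1M; first exact: (smooth1M (coef_smooth (sp t i)) (velocity_smooth i)).
have sF : smooth1 (flow_var (s t) eta).
  apply: smooth1_sum => j.
  exact: (smooth1M (covector_smooth j ce) (flow_coef_smooth (s t) j)).
apply: (smooth1_antiderivative sF) => x.
exact: Dinv_derive (flow_var_csupp (s t) ce).
Qed.

Lemma pairing_csupp xi (X : R -> 'rV[R]_n) : covector m xi -> smooth_curve X ->
  csupp m (fun x => \sum_i xi x 0 i * X x 0 i).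
Proof.
move=> cx sX; apply: csupp_sum => i; apply: csuppMr; last exact: covector_csupp i cx.
exact: smooth1_continuous (@smooth_curve_coord _ _ _ i sX).
Qed.

(** The variation of the inner densities depends on [phi] in a nonlocal way. Skew-adjointness moves
    [Dinv] onto the density of [xi]; the integrand is then local in [phi], and [bracket_identity]
    shows that it differs from the kernel pairing by the x-derivative of [boundary_term]. *)
Lemma op_var_pairing xi eta : covector m xi -> covector m eta ->
  integ (fun x => \sum_i xi x 0 i * op_var eta x i) = pairing (kernel xi eta) phi.
Proof.
move=> cx ce.
pose L x := local_variation (gi (r x)) (dgi (r x)) (Gam (r x)) (dGam (r x)) (vel x)
  (co phi x) (dco phi x) (co xi x) (co eta x) (dco eta x).
pose A t x := flow_var t xi x * potential r eta x t.
pose B t x := density t r xi x * Dinv (flow_var (s t) eta) x.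
pose C t x := flow_var t eta x * potential r xi x t.
have cA t : csupp m (A t).
  apply: csuppMr; last exact: flow_var_csupp.
  exact: smooth1_continuous (potential_smooth t ce).
have cC t : csupp m (C t).
  apply: csuppMr; last exact: flow_var_csupp.
  exact: smooth1_continuous (potential_smooth t cx).
have cB t : csupp m (B t).
  apply: csuppMr; last exact: density_csupp.
  exact: Dinv_continuous (flow_var_csupp (s t) ce).
have E x : \sum_i xi x 0 i * op_var eta x i = L x + \sum_t (A t x + B t x).
  transitivity (L x + \sum_i xi x 0 i * \sum_t (flow_coef t i x * potential r eta x t
      + p t i (r x) * derive1 r x 0 i * Dinv (flow_var (s t) eta) x)).
    rewrite /L /local_variation -big_split; apply: eq_bigr => i _ /=.
    by rewrite /op_var; ring.
  congr (_ + _); transitivity (\sum_t \sum_i (xi x 0 i * flow_coef t i x * potential r eta x t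
      + p t i (r x) * derive1 r x 0 i * xi x 0 i * Dinv (flow_var (s t) eta) x)).
    rewrite exchange_big; apply: eq_bigr => i _; rewrite mulr_sumr.
    by apply: eq_bigr => t _; ring.
  by apply: eq_bigr => t _; rewrite big_split /A /B /density /= !mulr_suml.
have cL : csupp m L.
  have -> : L = fun x => (\sum_i xi x 0 i * op_var eta x i) - \sum_t (A t x + B t x).
    by apply/funext => x; rewrite E addrK.
  apply: csuppB; last by apply: csupp_sum => t; exact: csuppD.
  apply: csupp_sum => i; apply: csuppMr; last exact: covector_csupp i cx.
  exact: smooth1_continuous (op_var_smooth i ce).
have skew : \sum_t integ (B t) = - \sum_t integ (C t).
  rewrite [in RHS](reindex_inj (can_inj s_inv)) -sumrN; apply: eq_bigr => t _ /=.
  rewrite /B (Dinv_skew (density_csupp t cx) (flow_var_csupp (s t) ce)).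
  by congr (- integ _); apply/funext => x; rewrite /C /potential s_inv.
have -> : integ (fun x => \sum_i xi x 0 i * op_var eta x i) =
    integ (fun x => L x + \sum_t (A t x - C t x)).
  have -> : (fun x => \sum_i xi x 0 i * op_var eta x i) =
      fun x => L x + \sum_t (A t x + B t x) by apply/funext.
  have cAB : csupp m (fun x => \sum_t (A t x + B t x)).
    by apply: csupp_sum => t; exact: csuppD.
  have cAC : csupp m (fun x => \sum_t (A t x - C t x)).
    by apply: csupp_sum => t; exact: csuppB.
  rewrite (integD cL cAB) (integD cL cAC); congr (_ + _).
  have -> : integ (fun x => \sum_t (A t x + B t x)) =
      \sum_t integ (A t) + \sum_t integ (B t).
    rewrite -big_split (@integ_sum _ m) => [|t]; last exact: csuppD.
    by apply: eq_bigr => t _; exact: (integD (cA t) (cB t)).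
  have -> : integ (fun x => \sum_t (A t x - C t x)) =
      \sum_t integ (A t) - \sum_t integ (C t).
    rewrite -sumrB (@integ_sum _ m) => [|t]; last exact: csuppB.
    by apply: eq_bigr => t _; exact: (integB (cA t) (cC t)).
  by congr (_ + _); exact: skew.
have cK := pairing_csupp (kernel_covector cx ce) sphi.
apply/eqP; rewrite -subr_eq0; apply/eqP.
have cLAC : csupp m (fun x => L x + \sum_t (A t x - C t x)).
  by apply: csuppD => //; apply: csupp_sum => t; exact: csuppB.
rewrite pairingE -(integB cLAC cK).
have dB (x : R) : is_derive x 1 (boundary_term phi xi eta)
   (L x + \sum_t (A t x - C t x) - \sum_i kernel xi eta x 0 i * phi x 0 i).
  apply: is_derive_eq; first exact: (boundary_term_derive sphi x cx ce).
  rewrite kernelE.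
  have /= I := bracket_identity (Gam_sym (r x))
    (fun m i l => metric_compat sg g0 m i l (inU x)) s_inv
    (fun m l j k => dGam_sym (r x) m l j k)
    (fun t i k l => codazzi_pz t i k l (inU x)) (fun i j k l => gauss_pz i j k l (inU x))
    (vel x) (co phi x) (dco phi x) (co xi x) (dco xi x) (co eta x) (dco eta x)
    (potential r xi x) (potential r eta x).
  rewrite /L /A /C /flow_var I; ring.
apply: (integ_derive0 (csuppB cLAC cK) dB) => x mx.
exact: boundary_term_out cx ce mx.
Qed.

(** Product rule for the pairing, after which skew-symmetry takes the operator off [Y1]. *)
Lemma bracket_derive X X0 X1 Y Y0 Y1 :
  covector_family X X0 X1 -> covector_family Y Y0 Y1 ->
  is_derive (0 : R) 1 (fun e => pairing (X e) (nonlocal_op (shifted e) (Y e)))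
    (pairing X1 (nonlocal_op r Y0) - pairing Y1 (nonlocal_op r X0)
     + pairing (kernel X0 Y0) phi).
Proof.
move=> cX cY; have cX0 := covector_family0 cX; have cY0 := covector_family0 cY.
have [X00 [d d0 cXe] cX1 jX _] := cX; have [_ _ cY1 _ _] := cY.
have jt := pjet_sum (index_enum 'I_n) (fun i => pjetM
  (conj (fun x => congr1 (fun Z : R -> 'rV[R]_n => Z x 0 i) X00) (jX i)) (op_jet i cY)).
have c1 := pairing_csupp cX1 (nonlocal_op_smooth cY0).
have c2 := pairing_csupp cX0 (nonlocal_op_smooth cY1).
have c3 : csupp m (fun x => \sum_i X0 x 0 i * op_var Y0 x i).
  apply: csupp_sum => i; apply: csuppMr; last exact: covector_csupp i cX0.
  exact: smooth1_continuous (op_var_smooth i cY0).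
have jt' : jet m (fun e x => \sum_i X e x 0 i * nonlocal_op (shifted e) (Y e) x 0 i)
    (fun x => \sum_i X1 x 0 i * nonlocal_op r Y0 x 0 i
      + \sum_i X0 x 0 i * nonlocal_op r Y1 x 0 i + \sum_i X0 x 0 i * op_var Y0 x i).
  apply: (eq_jet jt.2) => // x; rewrite -!big_split; apply: eq_bigr => i _ /=; ring.
have near : exists2 d, 0 < d & forall e, `|e| < d ->
    csupp m (fun x => \sum_i X e x 0 i * nonlocal_op (shifted e) (Y e) x 0 i).
  have [d' d'0 cO] : exists2 d, 0 < d & forall e : R, `|e| < d -> forall i x,
      `|x| < m + 1 -> {for x, continuous (fun y => nonlocal_op (shifted e) (Y e) y 0 i)}.
    apply: (@common_radius R R _ (fun i e => forall x, `|x| < m + 1 ->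
      {for x, continuous (fun y => nonlocal_op (shifted e) (Y e) y 0 i)})) => i.
    by have [d' d'0 H] := op_near i cY; exists d' => // e ed x; exact: H.
  exists (Num.min d d'); first by rewrite lt_min d0.
  move=> e; rewrite lt_min => /andP[ed ed']; apply: csupp_sum => i.
  rewrite (_ : (fun y => _) = fun y => nonlocal_op (shifted e) (Y e) y 0 i * X e y 0 i).
    apply: csupp_local_mul; last exact: covector_csupp i (cXe e ed).
    by move=> x; exact: cO.
  by apply/funext => y; rewrite mulrC.
have := jet_integ m0 near (csuppD (csuppD c1 c2) c3) jt'.
rewrite (integD (csuppD c1 c2) c3) (integD c1 c2) (op_var_pairing cX0 cY0).
by rewrite -!pairingE (pairing_skew cX0 cY1).
Qed.

End Variation.

Lemma covector_le m m' xi : m <= m' -> covector m xi -> covector m' xi.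
Proof. by move=> mm [sx x0]; split => // x mx; apply: x0; exact: le_lt_trans mx. Qed.

Lemma pairing_combine m a b k (X : R -> 'rV[R]_n) : smooth_curve X ->
  covector m a -> covector m b -> covector m k ->
  pairing (fun x => a x - b x + k x) X = pairing a X - pairing b X + pairing k X.
Proof.
move=> sX ca cb ck; have C xi : covector m xi -> csupp m (fun x => \sum_i xi x 0 i * X x 0 i).
  by move=> cx; exact: pairing_csupp cx sX.
rewrite !pairingE -(integB (C _ ca) (C _ cb)) -(integD (csuppB (C _ ca) (C _ cb)) (C _ ck)).
congr integ; apply/funext => x; rewrite -sumrB -big_split /=; apply: eq_bigr => i _.
by rewrite !mxE; ring.
Qed.

Lemma covector_combine m a b k : covector m a -> covector m b -> covector m k ->
  covector m (fun x => a x - b x + k x).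
Proof.
move=> ca cb ck; split; last first.
  by move=> x mx; rewrite ca.2// cb.2// ck.2// subrr addr0.
apply/smooth_curveP => i; rewrite (_ : (fun _ => _) = fun x => a x 0 i - b x 0 i + k x 0 i).
  exact: (smooth1D (smooth1B (covector_smooth i ca) (covector_smooth i cb))
    (covector_smooth i ck)).
by apply/funext => x; rewrite !mxE.
Qed.

(** * Variational derivative of the bracket and the Jacobi identity *)

Section Functionals.
Implicit Types (F G : functional U) (phi : R -> 'rV[R]_n).

Lemma grad_covector F m : fwindow F <= m -> covector m (fgrad F r).
Proof.
move=> Fm; apply: covector_le Fm _; split; last exact: fgrad_window.
by apply: fgrad_smooth_curve => // x _; exact: inU.
Qed.

Lemma dgrad_covector F phi m : smooth_curve phi -> fwindow F <= m ->
  covector m (dgrad F r phi).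
Proof.
move=> sphi Fm; apply: covector_le Fm _; split; first exact: dgrad_smooth.
by move=> x wx; apply/rowP => i; rewrite (dgrad_csupp F oU sr inU sphi i).2// mxE.
Qed.

Lemma grad_family F phi m : smooth_curve phi -> fwindow F <= m ->
  covector_family m (fun e => fgrad F (shifted phi e)) (fgrad F r) (dgrad F r phi).
Proof.
move=> sphi Fm; split; first by rewrite shifted0.
- have [d d0 H] := affine_curve_in F oU sr inU sphi.
  exists d; first exact: d0.
  move=> e ed; apply: covector_le Fm _; split; last exact: fgrad_window.
  exact: (fgrad_smooth_curve (@shifted_smooth _ sphi e) (H e ed)).
- exact: (dgrad_covector sphi Fm).
- by move=> i; exact: (grad_jet F oU sr inU sphi).
- by move=> i; exact: (grad_derive_jet F oU sr inU sphi).
Qed.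

Definition bracket_grad F G (x : R) : 'rV[R]_n :=
  dgrad F r (nonlocal_op r (fgrad G r)) x - dgrad G r (nonlocal_op r (fgrad F r)) x
  + kernel (fgrad F r) (fgrad G r) x.

Lemma bracket_grad_pairing F G phi m : fwindow F <= m -> fwindow G <= m ->
  smooth_curve phi -> pairing (bracket_grad F G) phi =
  pairing (dgrad F r (nonlocal_op r (fgrad G r))) phi
  - pairing (dgrad G r (nonlocal_op r (fgrad F r))) phi
  + pairing (kernel (fgrad F r) (fgrad G r)) phi.
Proof.
move=> Fm Gm sphi; have cF := grad_covector Fm; have cG := grad_covector Gm.
exact: (pairing_combine sphi (dgrad_covector (nonlocal_op_smooth cG) Fm)
  (dgrad_covector (nonlocal_op_smooth cF) Gm) (kernel_covector cF cG)).
Qed.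

(** [bracket_derive] delivers the second variations in the direction [phi]; [dgrad_sym] moves [phi]
    to the other slot, so that it appears only as a factor. The direction exchanged with it is a
    Hamiltonian vector, which is smooth but need not have compact support. *)
Lemma bracket_variational_derivative F G :
  variational_derivative (bracket nonlocal_op F G) r (bracket_grad F G).
Proof.
pose m := Num.max 0 (Num.max (fwindow F) (fwindow G)).
have m0 : 0 <= m by rewrite le_max lexx.
have Fm : fwindow F <= m by rewrite !le_max lexx orbT.
have Gm : fwindow G <= m by rewrite !le_max lexx !orbT.
have cF := grad_covector Fm; have cG := grad_covector Gm.
have sF := nonlocal_op_smooth cF; have sG := nonlocal_op_smooth cG.
have cB : covector m (bracket_grad F G).
  exact: (covector_combine (dgrad_covector sG Fm) (dgrad_covector sF Gm)
    (kernel_covector cF cG)).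
split; first exact: cB.1.
  by exists m; exact: cB.2.
move=> phi sphi.
apply: (is_derive_eq (bracket_derive sphi m0 (grad_family sphi Fm) (grad_family sphi Gm))).
apply: etrans (esym (bracket_grad_pairing Fm Gm sphi)).
have E1 := dgrad_sym F oU sr inU sphi sG.
have E2 := dgrad_sym G oU sr inU sphi sF.
exact: (f_equal2 +%R (f_equal2 (fun a b => a - b) E1 E2) erefl).
Qed.

Lemma bracket_jacobi F G H :
  pairing (bracket_grad F G) (nonlocal_op r (fgrad H r))
  + pairing (bracket_grad G H) (nonlocal_op r (fgrad F r))
  + pairing (bracket_grad H F) (nonlocal_op r (fgrad G r)) = 0.
Proof.
pose m := Num.max (fwindow F) (Num.max (fwindow G) (fwindow H)).
have Fm : fwindow F <= m by rewrite !le_max lexx.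
have Gm : fwindow G <= m by rewrite !le_max lexx !orbT.
have Hm : fwindow H <= m by rewrite !le_max lexx !orbT.
have cF := grad_covector Fm; have cG := grad_covector Gm; have cH := grad_covector Hm.
have sF := nonlocal_op_smooth cF; have sG := nonlocal_op_smooth cG.
have sH := nonlocal_op_smooth cH.
have E (p1 p2 p3 x1 x2 x3 y1 y2 y3 k1 k2 k3 : R) : p1 = x1 - y1 + k1 ->
    p2 = x2 - y2 + k2 -> p3 = x3 - y3 + k3 -> x1 = y3 -> y1 = x2 -> x3 = y2 ->
    k1 + k2 + k3 = 0 -> p1 + p2 + p3 = 0.
  by move=> -> -> -> -> -> -> <-; ring.
apply: (E _ _ _ _ _ _ _ _ _ _ _ _ (bracket_grad_pairing Fm Gm sH)
  (bracket_grad_pairing Gm Hm sF) (bracket_grad_pairing Hm Fm sG)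
  (dgrad_sym F oU sr inU sG sH) (dgrad_sym G oU sr inU sF sH)
  (dgrad_sym H oU sr inU sF sG)).
have K a b phi := @pairing_csupp m (kernel a b) phi.
have k1 := K _ _ _ (kernel_covector cF cG) sH.
have k2 := K _ _ _ (kernel_covector cG cH) sF.
have k3 := K _ _ _ (kernel_covector cH cF) sG.
rewrite !pairingE -(integD k1 k2) -(integD (csuppD k1 k2) k3).
rewrite (_ : (fun x => _) = fun=> 0); first by rewrite /integ Rintegral_cst// mul0r.
apply/funext => x; rewrite !kernelE.
have C xi eta (phi phi' : 'I_n -> R) : (forall i, phi i = phi' i) ->
    kernel_pairing (gi (r x)) (Gam (r x)) (pz (r x)) (vel x) phi
     (co xi x) (dco xi x) (co eta x) (dco eta x) (potential r xi x) (potential r eta x) =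
    kernel_pairing (gi (r x)) (Gam (r x)) (pz (r x)) (vel x) phi'
     (co xi x) (dco xi x) (co eta x) (dco eta x) (potential r xi x) (potential r eta x).
  by move=> pp; have -> : phi = phi' by apply/funext.
rewrite (C _ _ _ _ (fun i => nonlocal_opE r (fgrad H r) x i)).
rewrite (C _ _ _ _ (fun i => nonlocal_opE r (fgrad F r) x i)).
rewrite (C _ _ _ _ (fun i => nonlocal_opE r (fgrad G r) x i)).
exact: (kernel_cyclic (gi (r x)) (Gam_sym (r x))).
Qed.

End Functionals.

End AlongACurve.

Lemma nonlocal_op_hamiltonian : hamiltonian U nonlocal_op.
Proof.
split => [F G r rU|F G H r rU].
  pose m := Num.max (fwindow F) (fwindow G).
  have Fm : fwindow F <= m by rewrite le_max lexx.
  have Gm : fwindow G <= m by rewrite le_max lexx orbT.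
  exact: pairing_skew rU _ _ _ (grad_covector rU Fm) (grad_covector rU Gm).
exists (bracket_grad r F G), (bracket_grad r G H), (bracket_grad r H F); split.
- exact: bracket_variational_derivative.
- exact: bracket_variational_derivative.
- exact: bracket_variational_derivative.
- exact: bracket_jacobi.
Qed.

End DiagonalOperator.

(** * Curvature of diagonal metrics *)

Section DiagonalCurvature.
Context {R : realType} {n : nat}.
Variables (U : set 'rV[R]_n) (g : 'I_n -> 'rV[R]_n -> R).
Hypotheses (oU : open U) (sg : forall i, smooth_on U (g i)).
Hypothesis g0 : forall i x, U x -> g i x != 0.
Implicit Types x : 'rV[R]_n.

(* d_j ln sqrt |g_ii| *)
Definition log_coef (i j : 'I_n) : 'rV[R]_n -> R := christoffel g i i j.

Lemma log_coefE i j x : log_coef i j x = 2^-1 * (g i x)^-1 * partial j (g i) x.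
Proof.
rewrite /log_coef /christoffel metric_coef_diag.
by rewrite addrAC subrr add0r.
Qed.

Lemma partial_metric i j x : U x -> partial j (g i) x = 2 * g i x * log_coef i j x.
Proof. by move=> Ux; rewrite log_coefE; field; exact: g0. Qed.

(** One formula for all [k]: at [k = j] the correction turns minus the logarithmic derivative into
    plus. Sums over [k] can thus be written as one full sum and a single extra term. *)
Lemma christoffel_diag k j x : U x ->
  christoffel g k j j x = - (g j x / g k x * log_coef j k x)
    + (if k == j then 2 * log_coef j j x else 0).
Proof.
move=> Ux; have gk0 := g0 k Ux; have gj0 := g0 j Ux; rewrite !log_coefE.
have [kj|kj] := eqVneq k j.
  by rewrite -kj -/(log_coef k k x) log_coefE; field.
rewrite /christoffel metric_coef_diag metric_coef_offdiag// !partial_cst.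
by field; rewrite ?gk0 ?gj0.
Qed.

#[local] Opaque christoffel partial.

Lemma curvature_antisym_r i j k l x : curvature g i j k l x = - curvature g i j l k x.
Proof.
rewrite /curvature -mulrN; congr (_ * _).
rewrite opprD opprB -sumrN; congr (_ + _).
by apply: eq_bigr => m _; rewrite opprB.
Qed.

(* Commuting the second derivatives of the inverse metric. *)
Lemma curvature_antisym_l i j k l x : U x ->
  curvature g i j k l x = - curvature g j i k l x.
Proof.
move=> Ux.
have dG a b c := smooth_on_differentiable (smooth_christoffel oU sg g0 a b c) Ux.
have sI := smooth_inv_metric oU sg g0.
have dI a := smooth_on_differentiable (sI a) Ux.
have cmp m z : U z -> christoffel g i m j z * (g j z)^-1 + christoffel g j m i z * (g i z)^-1
    = - (if i == j then partial m (fun y => (g i y)^-1) z else 0).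
  by move=> Uz; rewrite (metric_compat sg g0 m i j Uz); ring.
have dd m m' : partial m' (fun z => christoffel g i m j z * (g j z)^-1 +
      christoffel g j m i z * (g i z)^-1) x =
    - (if i == j then partial m' (partial m (fun y => (g i y)^-1)) x else 0).
  rewrite (eq_partial m' oU (cmp m) Ux); case: (i == j); last first.
    by rewrite (_ : (fun _ => _) = fun=> - 0) // partial_cst oppr0.
  rewrite partialN//; exact: smooth_on_differentiable (smooth_on_partial m (sI i)) Ux.
have ex m m' : partial m' (fun z => christoffel g i m j z * (g j z)^-1 +
      christoffel g j m i z * (g i z)^-1) x =
    christoffel g i m j x * partial m' (fun z => (g j z)^-1) x
    + partial m' (christoffel g i m j) x * (g j x)^-1
    + (christoffel g j m i x * partial m' (fun z => (g i z)^-1) x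
    + partial m' (christoffel g j m i) x * (g i x)^-1).
  rewrite (partialD _ (differentiableM (dG i m j) (dI j)) (differentiableM (dG j m i) (dI i))).
  by rewrite (partialM _ (dG i m j) (dI j)) (partialM _ (dG j m i) (dI i)).
pose P m m' := \sum_c christoffel g i m c x * christoffel g j m' c x * (g c x)^-1.
pose Q a b m m' := \sum_c christoffel g a m c x * christoffel g c m' b x.
pose E a m b m' := partial m' (christoffel g a m b) x.
pose d2 m m' := if i == j then partial m' (partial m (fun y => (g i y)^-1)) x else 0.
have sum a b m m' : christoffel g a m b x * partial m' (fun z => (g b z)^-1) x =
    - (\sum_c christoffel g a m c x * christoffel g b m' c x * (g c x)^-1)
    - (g b x)^-1 * Q a b m m'.
  rewrite mulrC -(sum_if_eql b _ (fun c => christoffel g a m c x)) /Q mulr_sumr.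
  rewrite -sumrN -sumrB; apply: eq_bigr => c _.
  rewrite (metric_compat sg g0 m' b c Ux); ring.
have X m m' : \sum_c christoffel g j m c x * christoffel g i m' c x * (g c x)^-1 = P m' m.
  by apply: eq_bigr => c _; rewrite [christoffel g j m c x * _]mulrC.
have main m m' : - d2 m m' = - P m m' - (g j x)^-1 * Q i j m m' + E i m j m' * (g j x)^-1
    + (- P m' m - (g i x)^-1 * Q j i m m' + E j m i m' * (g i x)^-1).
  have Xm := etrans (sum j i m m') (congr1 (fun y => - y - _) (X m m')).
  exact: etrans (esym (dd m m')) (etrans (ex m m') (f_equal2 +%R
    (f_equal2 +%R (sum i j m m') erefl) (f_equal2 +%R Xm erefl))).
have sw : d2 l k = d2 k l.
  by rewrite /d2; case: (i == j); [exact: partial_swap oU (sI i) Ux|].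
have C a b : curvature g a b k l x =
    (g b x)^-1 * (E a l b k - E a k b l + (Q a b k l - Q a b l k)).
  by rewrite /curvature sumrB.
(* In the difference of the two instances of [main] the second derivatives cancel because [d2] is
   symmetric, and the terms [P] cancel because each instance contains both orders. *)
rewrite !C; move: (main l k) (main k l); rewrite sw.
move: P Q E d2 {sum X main sw C dd ex cmp} => P Q E d2; lra.
Qed.

Lemma sum_split2 (F : 'I_n -> R) a b : a != b ->
  \sum_m F m = F a + (F b + \sum_(m | (m != a) && (m != b)) F m).
Proof. by move=> ab; rewrite (bigD1 a)//= (bigD1 b)//= eq_sym. Qed.

Lemma sum2 (F : 'I_n -> R) a b : a != b -> (forall m, m != a -> m != b -> F m = 0) ->
  \sum_m F m = F a + F b.
Proof.
move=> ab F0; rewrite (sum_split2 _ ab) big1 ?addr0// => m /andP[ma mb].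
exact: F0.
Qed.

(** Its vanishing is the first family of Lame equations, written for logarithmic derivatives of the
    metric coefficients; the value is the component R^ij_il multiplied by - g_jj. *)
Definition mixed_curvature i j l x : R := partial l (log_coef i j) x
  - log_coef i j x * log_coef j l x - log_coef i l x * log_coef l j x
  + log_coef i j x * log_coef i l x.

Lemma curvature_mixed i j l x : i != j -> l != i -> l != j ->
  curvature g i j i l x = - ((g j x)^-1 * mixed_curvature i j l x).
Proof.
move=> ij li lj; rewrite /curvature -mulrN; congr (_ * _).
have jl : j != l by rewrite eq_sym.
have D0 a b c : a != b -> a != c -> b != c -> christoffel g a b c = fun=> 0.
  by move=> ab ac bc; apply/funext => z; exact: christoffel_distinct.
have D : christoffel g i l j = fun=> 0 by apply: D0; rewrite // eq_sym.
rewrite D partial_cst sumrB (@sum2 _ l j lj); last first.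
  by move=> m ml mj; rewrite (D0 m l j)//= mulr0.
rewrite (@sum2 (fun m => christoffel g i l m x * christoffel g m i j x) i j ij); last first.
  by move=> m mi mj; rewrite (D0 m i j)//= mulr0.
rewrite D (christoffel_sym g i l i) (christoffel_sym g j l j) /mixed_curvature /log_coef.
move: (partial l (christoffel g i i j) x) (christoffel g i i j x) (christoffel g j j l x)
  (christoffel g i i l x) (christoffel g l l j x) => *; ring.
Qed.

Lemma curvature_distinct i j k l x : i != j -> k != l -> k != i -> k != j ->
  l != i -> l != j -> curvature g i j k l x = 0.
Proof.
move=> ij kl ki kj li lj; rewrite /curvature.
have D a b c : a != b -> a != c -> b != c -> christoffel g a b c = fun=> 0.
  by move=> ab ac bc; apply/funext => z; exact: christoffel_distinct.
have il : i != l by rewrite eq_sym.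
have ik : i != k by rewrite eq_sym.
have lk : l != k by rewrite eq_sym.
rewrite (D i l j)// (D i k j)// !partial_cst sumrB (@sum2 _ l j lj); last first.
  by move=> m ml mj; rewrite (D m l j)//= mulr0.
rewrite (@sum2 (fun m => christoffel g i l m x * christoffel g m k j x) k j kj); last first.
  by move=> m mi mj; rewrite (D m k j)//= mulr0.
rewrite (D i k l)// (D i k j)// (D i l k)// (D i l j)//.
have E (y a b c d : R) : y * (0 - 0 + (0 * a + 0 * b - (0 * c + 0 * d))) = 0 by ring.
exact: E.
Qed.

(** Antisymmetry in each pair of indices reduces a nonsectional component with a repeated index to
    the type R^ab_ac with distinct a, b, c, or to zero. Components with four distinct indices vanish
    for every diagonal metric. *)
Lemma curvature_vanish i j k l x : U x ->
  (forall i' j' l', i' != j' -> l' != i' -> l' != j' -> mixed_curvature i' j' l' x = 0) ->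
  (i, j) != (k, l) -> (i, j) != (l, k) -> curvature g i j k l x = 0.
Proof.
move=> Ux mix ijkl ijlk.
have half (y : R) : y = - y -> y = 0 by lra.
have [ij|ij] := eqVneq i j.
  by rewrite ij in ijkl ijlk *; apply: half; exact: curvature_antisym_l.
have [kl|kl] := eqVneq k l.
  by rewrite kl; apply: half; exact: curvature_antisym_r.
have M a b c : a != b -> c != a -> c != b -> curvature g a b a c x = 0.
  by move=> ab ca cb; rewrite curvature_mixed// mix// mulr0 oppr0.
have [ki|ki] := eqVneq k i.
  have lj : l != j by apply: contraNneq ijkl => ->; rewrite ki.
  by rewrite ki in kl *; apply: M => //; rewrite eq_sym.
have [kj|kj] := eqVneq k j.
  have li : l != i by apply: contraNneq ijlk => ->; rewrite kj.
  rewrite curvature_antisym_l// kj in kl *; rewrite M ?oppr0// eq_sym//.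
have [li|li] := eqVneq l i.
  by rewrite curvature_antisym_r li M ?oppr0.
have [lj|lj] := eqVneq l j.
  by rewrite curvature_antisym_r curvature_antisym_l// lj M ?oppr0// eq_sym.
exact: curvature_distinct.
Qed.

(** The formula keeps apart the indices different from [i] and [j] and the two terms carrying 1/g_jj
    and 1/g_ii, since these pieces are transformed separately when the metric is rescaled. *)
Lemma sectional_curvature i j x : U x -> i != j -> curvature g i j i j x =
  - (\sum_(m | (m != i) && (m != j)) log_coef i m x * log_coef j m x / g m x)
  - (partial j (log_coef i j) x + log_coef i j x ^+ 2
     - log_coef i j x * log_coef j j x) / g j x
  - (partial i (log_coef j i) x + log_coef j i x ^+ 2
     - log_coef j i x * log_coef i i x) / g i x.
Proof.
move=> Ux ij; have gi0 := g0 i Ux; have gj0 := g0 j Ux.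
rewrite /curvature sumrB.
have ji : j != i by rewrite eq_sym.
have dL a b : differentiable (log_coef a b) x.
  exact: smooth_on_differentiable (smooth_christoffel oU sg g0 a a b) Ux.
have dg a := smooth_on_differentiable (sg a) Ux.
have -> : partial i (christoffel g i j j) x = - (g j x / g i x *
    (partial i (log_coef j i) x + 2 * log_coef j i x ^+ 2
     - 2 * log_coef j i x * log_coef i i x)).
  rewrite (@eq_partial _ _ U _ (fun z => - (g j z / g i z * log_coef j i z)) i x oU)//; last first.
    by move=> z Uz; rewrite christoffel_diag// (negbTE ij) addr0.
  have dV : differentiable (fun z => (g i z)^-1) x by apply: differentiableV.
  have dQ : differentiable (fun z => g j z / g i z) x by exact: differentiableM.
  rewrite (partialN _ (differentiableM dQ (dL j i))) (partialM _ dQ (dL j i)).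
  rewrite (partialM _ (dg j) dV) partialV// !partial_metric//; field; exact: gi0.
have -> : \sum_m christoffel g i i m x * christoffel g m j j x =
    2 * log_coef i j x * log_coef j j x
    - g j x * \sum_m log_coef i m x * log_coef j m x / g m x.
  rewrite (eq_bigr (fun m => (if j == m then 2 * log_coef j j x else 0) * log_coef i m x
    - g j x * (log_coef i m x * log_coef j m x / g m x))); last first.
    move=> m _; rewrite christoffel_diag// -/(log_coef i m x) [m == j]eq_sym.
    by case: (j == m); ring.
  by rewrite sumrB sum_if_eql mulr_sumr; ring.
rewrite (@sum2 (fun m => christoffel g i j m x * christoffel g m i j x) i j)//; last first.
  by move=> m mi mj; rewrite [X in _ * X]christoffel_distinct ?mulr0.
rewrite (christoffel_sym g i j i) (christoffel_sym g j i j) christoffel_diag// (negbTE ij).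
rewrite -/(log_coef i j) -/(log_coef j i).
rewrite (sum_split2 _ ij); move: gi0 gj0 (\sum_(m | _) _) (partial j (log_coef i j) x) (partial i (log_coef j i) x)
  (log_coef i j x) (log_coef j i x) (log_coef i i x) (log_coef j j x).
move: (g i x) (g j x) => a b a0 b0 S dij dji lij lji lii ljj.
by field; rewrite a0 b0.
Qed.

Lemma hessian_offdiag f i j x : U x -> i != j -> hessian g i j f x = 0 ->
  partial i (partial j f) x = log_coef i j x * partial i f x + log_coef j i x * partial j f x.
Proof.
move=> Ux ij /eqP; rewrite mulf_eq0 invr_eq0 (negbTE (g0 i Ux)) /= subr_eq0 => /eqP ->.
rewrite (@sum2 _ i j)// => [|m mi mj].
  by rewrite (christoffel_sym g j i j).
by rewrite christoffel_distinct ?mul0r.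
Qed.

Lemma hessian_diag f i x : U x -> partial i (partial i f) x =
  g i x * hessian g i i f x - g i x * \sum_k log_coef i k x * partial k f x / g k x
  + 2 * log_coef i i x * partial i f x.
Proof.
move=> Ux; have gi0 := g0 i Ux.
have -> : g i x * hessian g i i f x = partial i (partial i f) x
    - \sum_k christoffel g k i i x * partial k f x.
  by rewrite /hessian mulVKf.
rewrite (eq_bigr (fun k => (if i == k then 2 * log_coef i i x else 0) * partial k f x
    - g i x * (log_coef i k x * partial k f x / g k x))); last first.
  move=> k _; rewrite christoffel_diag// [k == i]eq_sym.
  by case: (i == k); ring.
rewrite sumrB sum_if_eql mulr_sumr; ring.
Qed.

Lemma smooth_hessian f i j : smooth_on U f -> smooth_on U (hessian g i j f).
Proof.
move=> sf; apply: smooth_onM => //; first exact: smooth_inv_metric oU sg g0 i.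
apply: smooth_onB => //; first by do 2 apply: smooth_on_partial.
apply: smooth_on_sum => // k; apply: smooth_onM => //; last exact: smooth_on_partial.
exact: smooth_christoffel oU sg g0 k i j.
Qed.

End DiagonalCurvature.

(** * The Codazzi equation for Hessians in a flat metric *)

Section FlatHessian.
Context {R : realType} {n : nat}.
Variables (U : set 'rV[R]_n) (g : 'I_n -> 'rV[R]_n -> R).
Hypotheses (oU : open U) (sg : forall i, smooth_on U (g i)).
Hypothesis g0 : forall i x, U x -> g i x != 0.
#[local] Opaque christoffel partial.

Hypothesis flat_g : forall i j k l x, U x -> curvature g i j k l x = 0.
Variables (f : 'rV[R]_n -> R) (v : 'I_n -> 'rV[R]_n -> R).
Hypothesis sf : smooth_on U f.
Hypothesis hess_f : forall i j x, U x -> hessian g i j f x = if i == j then v i x else 0.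

Lemma smooth_eigenvalue i : smooth_on U (v i).
Proof.
apply: (eq_smooth_on oU _ (smooth_hessian oU sg g0 i i sf)) => x Ux.
by rewrite hess_f// eqxx.
Qed.

(* The Ricci identity in a flat metric: nabla_j nabla_i d_i f = nabla_i nabla_j d_i f. *)
Lemma flat_codazzi i j x : U x -> i != j ->
  partial j (v i) x = (v j x - v i x) * log_coef g i j x.
Proof.
have balance (A1 A2 A3 A4 : R) : A3 - A4 + (A1 - A2) = 0 -> A2 + A4 = A1 + A3 by lra.
have solve (A1 A2 A3 A4 y : R) :
    0 + (A1 + A4) = y + (A2 + A3) -> A3 = A4 -> y = A1 - A2 by lra.
have cancel_metric (p q L dv vi vj : R) : p != 0 -> q != 0 ->
    p * dv + 2 * p * L * vi = L * (p * vi) - (- (p / q * L) + 0) * (q * vj) ->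
    dv = (vj - vi) * L.
  move=> p0 q0 e; apply: (mulfI p0).
  have -> : p * dv = L * (p * vi) - (- (p / q * L) + 0) * (q * vj) - 2 * p * L * vi.
    by rewrite -e addrK.
  by field.
move=> Ux ij; have gi0 := g0 i Ux; have gj0 := g0 j Ux.
have ji : j != i by rewrite eq_sym.
have dG a b c := smooth_on_differentiable (smooth_christoffel oU sg g0 a b c) Ux.
have df a := smooth_on_differentiable (smooth_on_partial a sf) Ux.
have H a b z : U z -> partial a (partial b f) z =
    (if a == b then g a z * v a z else 0) + \sum_k christoffel g k a b z * partial k f z.
  move=> Uz; have := hess_f a b Uz; rewrite /hessian => /(congr1 ( *%R (g a z))).
  rewrite mulVKf ?g0// => /eqP; rewrite subr_eq => /eqP ->; congr (_ + _).
  by case: (a == b); rewrite ?mulr0.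
have sv a : smooth_on U (fun z => g a z * v a z).
  by apply: smooth_onM => //; exact: smooth_eigenvalue.
have sS a b : smooth_on U (fun z => \sum_k christoffel g k a b z * partial k f z).
  apply: smooth_on_sum => // k; apply: smooth_onM => //.
    exact: smooth_christoffel oU sg g0 k a b.
  exact: smooth_on_partial.
have third a b d : partial d (partial a (partial b f)) x =
    (if a == b then partial d (fun z => g a z * v a z) x else 0) +
    \sum_k (christoffel g k a b x * partial d (partial k f) x
      + partial d (christoffel g k a b) x * partial k f x).
  rewrite (eq_partial d oU (H a b) Ux) partialD; last first.
  - exact: smooth_on_differentiable (sS a b) Ux.
  - case: (a == b); last exact: differentiable_cst.
    exact: smooth_on_differentiable (sv a) Ux.
  congr (_ + _); first by case: (a == b); rewrite // partial_cst.
  rewrite partial_sum; first by apply: eq_bigr => k _; rewrite (partialM _ (dG k a b) (df k)).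
  by move=> k; exact: differentiableM (dG k a b) (df k).
have sw : partial j (partial i (partial i f)) x = partial i (partial j (partial i f)) x.
  exact: partial_swap oU (smooth_on_partial i sf) Ux.
have flat m : partial i (christoffel g m j i) x - partial j (christoffel g m i i) x
    + \sum_k (christoffel g m i k x * christoffel g k j i x
      - christoffel g m j k x * christoffel g k i i x) = 0.
  by have /eqP := flat_g m i i j Ux; rewrite mulf_eq0 invr_eq0 (negbTE gi0) => /eqP.
have cov a b d : \sum_k christoffel g k a b x * partial d (partial k f) x =
    christoffel g d a b x * (g d x * v d x) +
    \sum_m partial m f x * \sum_k christoffel g m d k x * christoffel g k a b x.
  rewrite (eq_bigr _ (fun k _ => etrans (congr1 ( *%R _) (H d k x Ux)) (mulrDr _ _ _))) big_split /=; congr (_ + _).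
    apply: etrans (etrans (sum_if_eql d (g d x * v d x) (fun k => christoffel g k a b x))
      (mulrC _ _)).
    by apply: eq_bigr => k _; exact: mulrC.
  rewrite (eq_bigr _ (fun k _ => mulr_sumr _ _ _ _)) exchange_big /=.
  apply: eq_bigr => m _; rewrite mulr_sumr; apply: eq_bigr => k _.
  by rewrite mulrA mulrC [christoffel g m d k x * _]mulrC.
have third_cov a b d : partial d (partial a (partial b f)) x =
    (if a == b then partial d (fun z => g a z * v a z) x else 0) +
    (christoffel g d a b x * (g d x * v d x) +
     \sum_m partial m f x * (\sum_k christoffel g m d k x * christoffel g k a b x
       + partial d (christoffel g m a b) x)).
  rewrite third; congr (_ + _); rewrite big_split cov -[LHS]addrA; congr (_ + _).
  rewrite -[LHS]big_split; apply: eq_bigr => m _; rewrite [LHS]/=.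
  by rewrite [partial d _ x * _]mulrC -mulrDr.
have key : partial j (fun z => g i z * v i z) x =
    christoffel g i j i x * (g i x * v i x) - christoffel g j i i x * (g j x * v j x).
  (* In [third_cov] the first derivatives of [f] have coefficients whose change, when the two
     directions are exchanged, is a curvature component. Flatness makes them agree, and only the
     terms with [v] are left to compare. *)
  have e3 : \sum_m partial m f x * (\sum_k christoffel g m j k x * christoffel g k i i x
       + partial j (christoffel g m i i) x) = \sum_m partial m f x *
       (\sum_k christoffel g m i k x * christoffel g k j i x
       + partial i (christoffel g m j i) x).
    apply: eq_bigr => m _; apply: (congr1 ( *%R (partial m f x))).
    apply: balance; rewrite -sumrB; exact: flat.
  have e1 := third_cov i i j; rewrite eqxx in e1.
  have e2 := third_cov j i i; rewrite (negbTE ji) in e2.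
  exact: solve _ _ _ _ _ (etrans (esym e2) (etrans (esym sw) e1)) e3.
move: key; rewrite (partialM _ (smooth_on_differentiable (sg i) Ux)
  (smooth_on_differentiable (smooth_eigenvalue i) Ux)).
rewrite (partial_metric g0 i j Ux) christoffel_sym (christoffel_diag g0 _ _ Ux) (negbTE ji) => key.
exact: cancel_metric gi0 gj0 key.
Qed.

End FlatHessian.

(** * The reciprocal metric *)

Section ReciprocalCoefficients.
Context {R : realType} {n N : nat}.
Variables (U : set 'rV[R]_n) (g : 'I_n -> 'rV[R]_n -> R).
Variables (ups w : 'I_N.+1 -> 'I_n -> 'rV[R]_n -> R).
Variables (a c : 'I_N.+1 -> 'I_N.+1 -> 'rV[R]_n -> R).
Hypotheses (oU : open U) (sg : forall i, smooth_on U (g i)).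
Hypothesis g0 : forall i x, U x -> g i x != 0.
Hypothesis flat_g : forall i j k l x, U x -> curvature g i j k l x = 0.
Hypothesis smooth_ups : forall be i, smooth_on U (ups be i).
Hypothesis codazzi_ups : forall be i j x, U x -> i != j ->
  partial j (ups be i) x = (ups be j x - ups be i x) * log_coef g i j x.
Hypothesis smooth_a : forall ga be, smooth_on U (a ga be).
Hypothesis flux_a : forall ga be i x, U x ->
  partial i (a ga be) x = ups be i x * partial i (a ga ord0) x.
Hypothesis inv_a : forall x, U x -> flux_matrix a x \in unitmx.
Hypothesis q0 : forall i x, U x -> recip_factor ups a i x != 0.
Hypothesis smooth_w : forall be i, smooth_on U (w be i).
Hypothesis codazzi_w : forall be i j x, U x -> i != j ->
  partial j (w be i) x = (w be j x - w be i x) * log_coef g i j x.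
Hypothesis w_a : forall ga i j x, U x ->
  hessian g i j (a ga ord0) x = if i == j then w ga i x else 0.
Hypothesis smooth_c : forall ga be, smooth_on U (c ga be).
Hypothesis flux_c : forall ga be i x, U x ->
  partial i (c ga be) x = w be i x * partial i (a ga ord0) x.
Hypothesis norm_c : forall be ga x, U x ->
  c be ga x + c ga be x
  = \sum_(k < n) (g k x)^-1 * partial k (a be ord0) x * partial k (a ga ord0) x.

#[local] Opaque christoffel partial.

Local Notation A := (flux_inverse a).
Local Notation q := (recip_factor ups a).
Local Notation da de j x := (partial j (a de ord0) x).

(* recip_ups = inv_ups / q, recip_w = inv_w / q and q = inv_ups ord0. *)
Definition inv_ups (ga : 'I_N.+1) (i : 'I_n) : 'rV[R]_n -> R :=
  fun x => \sum_ep A ep ga x * ups ep i x.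

Definition inv_w (ga : 'I_N.+1) (i : 'I_n) : 'rV[R]_n -> R :=
  fun x => w ga i x - \sum_be c be ga x * inv_ups be i x.

(** The b of the overview; [twisted_coef] is its lambda, with [log_coef g] for gamma. *)
Definition flux_coef (i j : 'I_n) : 'rV[R]_n -> R :=
  fun x => \sum_de inv_ups de i x * da de j x.

Definition twisted_coef (i j : 'I_n) : 'rV[R]_n -> R :=
  fun x => log_coef g i j x - flux_coef i j x.

Lemma smooth_flux_inverse ep ga : smooth_on U (A ep ga).
Proof.
apply: smooth_on_invmx => // i j; have := smooth_a i j.
by congr smooth_on; apply/funext => x; rewrite mxE.
Qed.

Lemma smooth_inv_ups ga i : smooth_on U (inv_ups ga i).
Proof.
apply: smooth_on_sum => // ep; apply: smooth_onM => //.
exact: smooth_flux_inverse.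
Qed.

Lemma smooth_inv_w ga i : smooth_on U (inv_w ga i).
Proof.
apply: smooth_onB => //; apply: smooth_on_sum => // be; apply: smooth_onM => //.
exact: smooth_inv_ups.
Qed.

Lemma smooth_flux_coef i j : smooth_on U (flux_coef i j).
Proof.
apply: smooth_on_sum => // de; apply: smooth_onM => //.
  exact: smooth_inv_ups.
exact: smooth_on_partial.
Qed.

Lemma flux_mulV ep ga x : U x -> \sum_de A ep de x * a de ga x = (ep == ga)%:R.
Proof.
move=> Ux; have := congr1 (fun M : 'M[R]_(N.+1) => M ep ga) (mulVmx (inv_a Ux)).
by rewrite !mxE => <-; apply: eq_bigr => de _; rewrite !mxE.
Qed.

Lemma flux_mulK de ga x : U x -> \sum_be a de be x * A be ga x = (de == ga)%:R.
Proof.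
move=> Ux; have := congr1 (fun M : 'M[R]_(N.+1) => M de ga) (mulmxV (inv_a Ux)).
by rewrite !mxE => <-; apply: eq_bigr => be _; rewrite !mxE.
Qed.

(** The rule dA = - A (da) A. Since the derivative of every flux is a characteristic velocity times
    the derivative of its density, the right factor A is contracted with the velocities and
    collapses to V^j. *)
Lemma partial_flux_inverse j ep ga x : U x ->
  partial j (A ep ga) x = - ((\sum_de A ep de x * da de j x) * inv_ups ga j x).
Proof.
move=> Ux; have dA ep' ga' := smooth_on_differentiable (smooth_flux_inverse ep' ga') Ux.
have dda ga' be' := smooth_on_differentiable (smooth_a ga' be') Ux.
have D be : \sum_de partial j (A ep de) x * a de be x =
    - (\sum_de A ep de x * partial j (a de be) x).
  have D0 : \sum_de (A ep de x * partial j (a de be) x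
      + partial j (A ep de) x * a de be x) = 0.
    apply: etrans (partial_cst ((ep == be)%:R : R) j x).
    rewrite -(eq_partial j oU (flux_mulV ep be) Ux).
    rewrite partial_sum; last by move=> de; exact: differentiableM (dA ep de) (dda de be).
    by apply: eq_bigr => de _; rewrite (partialM _ (dA ep de) (dda de be)).
  apply/eqP; rewrite -addr_eq0 addrC; apply/eqP; apply: etrans D0; apply: esym.
  exact: big_split.
have -> : partial j (A ep ga) x = \sum_be (\sum_de partial j (A ep de) x * a de be x) * A be ga x.
  rewrite (eq_bigr _ (fun be _ => mulr_suml _ _ _ _)) exchange_big /=.
  apply: esym; apply: etrans (etrans (sum_if_eql ga 1 (fun de => partial j (A ep de) x)) (mul1r _)).
  apply: eq_bigr => de _; rewrite -(eq_bigr _ (fun be _ => mulrA _ _ _)) -mulr_sumr flux_mulK//.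
  by rewrite eq_sym mulrC; case: (ga == de).
rewrite -[inv_ups ga j x]/(\sum_ep A ep ga x * ups ep j x) mulr_sumr -sumrN; apply: eq_bigr => be _; rewrite D mulNr.
have -> : \sum_de A ep de x * partial j (a de be) x = (\sum_de A ep de x * da de j x) * ups be j x.
  by rewrite mulr_suml; apply: eq_bigr => de _; rewrite flux_a// [ups _ _ _ * _]mulrC mulrA.
by rewrite -mulrA [ups _ _ _ * _]mulrC.
Qed.

(** The Codazzi equation of the velocities contributes gamma_ij (V^j - V^i), and the derivative of A
    contributes - b_ij V^j; together they give lambda in front of V^j. *)
Lemma partial_inv_ups ga i j x : U x -> i != j -> partial j (inv_ups ga i) x =
  twisted_coef i j x * inv_ups ga j x - log_coef g i j x * inv_ups ga i x.
Proof.
move=> Ux ij; have dA ep ga' := smooth_on_differentiable (smooth_flux_inverse ep ga') Ux.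
have du be' i' := smooth_on_differentiable (smooth_ups be' i') Ux.
have coef : \sum_ep (\sum_de A ep de x * da de j x) * ups ep i x = flux_coef i j x.
  rewrite (eq_bigr _ (fun ep _ => mulr_suml _ _ _ _)) exchange_big.
  apply: eq_bigr => de _; rewrite mulr_suml; apply: eq_bigr => ep _.
  exact: mulrAC.
rewrite partial_sum; last by move=> ep; exact: differentiableM (dA ep ga) (du ep i).
rewrite (eq_bigr (fun ep => - inv_ups ga j x * ((\sum_de A ep de x * da de j x) * ups ep i x)
   + log_coef g i j x * (A ep ga x * ups ep j x - A ep ga x * ups ep i x))); last first.
  move=> ep _; rewrite (partialM _ (dA ep ga) (du ep i)) codazzi_ups// partial_flux_inverse//.
  move: (\sum_de _) (log_coef g i j x) (inv_ups ga j x) (A ep ga x) (ups ep j x) (ups ep i x).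
  by move=> *; ring.
rewrite big_split -!mulr_sumr coef sumrB -/(inv_ups ga j x) -/(inv_ups ga i x) /twisted_coef.
move: (flux_coef i j x) (log_coef g i j x) (inv_ups ga j x) (inv_ups ga i x).
by move=> * /=; ring.
Qed.

(** By [flux_c] the derivatives of the fluxes c contribute - b_ij w^j. This changes gamma_ij w^j
    into lambda_ij w^j, as the derivatives of V do for the remaining part of W^j. *)
Lemma partial_inv_w ga i j x : U x -> i != j -> partial j (inv_w ga i) x =
  twisted_coef i j x * inv_w ga j x - log_coef g i j x * inv_w ga i x.
Proof.
move=> Ux ij; have dc be' ga' := smooth_on_differentiable (smooth_c be' ga') Ux.
have dV be' i' := smooth_on_differentiable (smooth_inv_ups be' i') Ux.
have dw be' i' := smooth_on_differentiable (smooth_w be' i') Ux.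
have dcV be : differentiable (fun z => c be ga z * inv_ups be i z) x.
  exact: differentiableM (dc be ga) (dV be i).
have ds : differentiable (fun z => \sum_be c be ga z * inv_ups be i z) x.
  apply: smooth_on_differentiable Ux; apply: smooth_on_sum => // be.
  by apply: smooth_onM => //; exact: smooth_inv_ups.
rewrite (partialB _ (dw ga i) ds) (partial_sum _ _ _ dcV) codazzi_w//.
rewrite (eq_bigr (fun be => w ga j x * (inv_ups be i x * da be j x)
   + (twisted_coef i j x * (c be ga x * inv_ups be j x)
     - log_coef g i j x * (c be ga x * inv_ups be i x)))); last first.
  move=> be _; rewrite (partialM _ (dc be ga) (dV be i)) flux_c// partial_inv_ups//.
  move: (log_coef g i j x) (twisted_coef i j x) (inv_ups be j x) (inv_ups be i x) (c be ga x).
  by move: (w ga j x) (partial _ _ _) => *; ring.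
rewrite big_split sumrB -!mulr_sumr -/(flux_coef i j x) /inv_w /twisted_coef.
move: (\sum_be _) (\sum_be _) (flux_coef i j x) (log_coef g i j x) (w ga i x) (w ga j x).
by move=> * /=; ring.
Qed.

Local Notation g' := (recip_metric g ups a).

Lemma smooth_recip_factor i : smooth_on U (q i).
Proof. exact: smooth_inv_ups. Qed.

Lemma partial_recip_factor i j x : U x -> i != j -> partial j (q i) x =
  twisted_coef i j x * q j x - log_coef g i j x * q i x.
Proof. exact: partial_inv_ups. Qed.

Lemma smooth_recip_metric i : smooth_on U (g' i).
Proof.
have sq := smooth_recip_factor i.
have := smooth_onM oU (sg i) (smooth_onM oU sq sq).
by congr smooth_on; apply/funext => x; rewrite /recip_metric expr2.
Qed.

Lemma recip_metric_neq0 i x : U x -> g' i x != 0.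
Proof. by move=> Ux; rewrite mulf_neq0 ?expf_neq0 ?g0 ?q0. Qed.

Lemma recip_log_coef i j x : U x ->
  log_coef g' i j x = log_coef g i j x + partial j (q i) x / q i x.
Proof.
have scalar (y y' z z' : R) : y != 0 -> z != 0 -> 2^-1 * (y * (z * z))^-1 *
    (y * (z * z' + z' * z) + y' * (z * z)) = 2^-1 * y^-1 * y' + z' / z.
  by move=> y0 z0; field; rewrite y0 z0.
move=> Ux; have dg := smooth_on_differentiable (sg i) Ux.
have dq := smooth_on_differentiable (smooth_recip_factor i) Ux.
rewrite !log_coefE (_ : g' i = fun z => g i z * (q i z * q i z)); last first.
  by apply/funext => z; rewrite /recip_metric expr2.
rewrite (partialM _ dg (differentiableM dq dq)) (partialM _ dq dq).
exact: scalar (g0 i Ux) (q0 i Ux).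
Qed.

Lemma recip_log_coef_offdiag i j x : U x -> i != j ->
  log_coef g' i j x = q j x / q i x * twisted_coef i j x.
Proof.
move=> Ux ij; rewrite recip_log_coef// partial_recip_factor//.
move: (q j x) (log_coef g i j x) (twisted_coef i j x) (q i x) (q0 i Ux).
by move=> *; field.
Qed.

(** In the quotient of two solutions of the same linear system the gamma terms cancel. What is left
    is lambda_ij (X^j q_i - X^i q_j) / q_i^2, which factors through q_j / q_i. *)
Lemma recip_codazzi (X : 'I_n -> 'rV[R]_n -> R) i j x : U x -> i != j ->
  (forall k, differentiable (X k) x) ->
  partial j (X i) x = twisted_coef i j x * X j x - log_coef g i j x * X i x ->
  partial j (fun z => X i z / q i z) x =
  (X j x / q j x - X i x / q i x) * log_coef g' i j x.
Proof.
move=> Ux ij dX tX; have qi0 := q0 i Ux; have qj0 := q0 j Ux.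
have dq := smooth_on_differentiable (smooth_recip_factor i) Ux.
rewrite (partialM _ (dX i) (differentiableV dq qi0)) partialV// tX.
rewrite partial_recip_factor// recip_log_coef_offdiag//.
move: (log_coef g i j x) (twisted_coef i j x) (X i x) (X j x) (q i x) (q j x) qi0 qj0.
by move=> ? ? ? ? ? ? p p'; field; rewrite p p'.
Qed.

Lemma recip_wE ga i x : recip_w ups w a c ga i x = inv_w ga i x / q i x.
Proof.
rewrite /recip_w /inv_w; congr ((_ - _) / _); apply: eq_bigr => be _.
by rewrite /inv_ups mulr_sumr; apply: eq_bigr => ep _; rewrite mulrA.
Qed.

Lemma recip_ups_codazzi ga i j x : U x -> i != j ->
  partial j (recip_ups ups a ga i) x =
  (recip_ups ups a ga j x - recip_ups ups a ga i x) * log_coef g' i j x.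
Proof.
move=> Ux ij; apply: (@recip_codazzi (inv_ups ga)) => // [k|].
  exact: smooth_on_differentiable (smooth_inv_ups ga k) Ux.
exact: partial_inv_ups.
Qed.

Lemma recip_w_codazzi ga i j x : U x -> i != j ->
  partial j (recip_w ups w a c ga i) x =
  (recip_w ups w a c ga j x - recip_w ups w a c ga i x) * log_coef g' i j x.
Proof.
move=> Ux ij; rewrite !recip_wE (_ : recip_w _ _ _ _ _ _ = fun z => inv_w ga i z / q i z).
  apply: recip_codazzi => // [k|].
    exact: smooth_on_differentiable (smooth_inv_w ga k) Ux.
  exact: partial_inv_w.
by apply/funext => z; rewrite recip_wE.
Qed.

Lemma smooth_recip_ups ga i : smooth_on U (recip_ups ups a ga i).
Proof.
apply: smooth_onM => //; first exact: smooth_inv_ups.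
by apply: smooth_onV => //; [exact: q0|exact: smooth_recip_factor].
Qed.

Lemma smooth_recip_w ga i : smooth_on U (recip_w ups w a c ga i).
Proof.
rewrite (_ : recip_w _ _ _ _ _ _ = fun z => inv_w ga i z / q i z); last first.
  by apply/funext => z; rewrite recip_wE.
apply: smooth_onM => //; first exact: smooth_inv_w.
by apply: smooth_onV => //; [exact: q0|exact: smooth_recip_factor].
Qed.

Lemma partial_flux_coef i j l x : U x -> i != l -> partial l (flux_coef i j) x =
  twisted_coef i l x * flux_coef l j x - log_coef g i l x * flux_coef i j x
  + \sum_de inv_ups de i x * partial l (partial j (a de ord0)) x.
Proof.
move=> Ux il; have dV de i' := smooth_on_differentiable (smooth_inv_ups de i') Ux.
have dd de := smooth_on_differentiable (smooth_on_partial j (smooth_a de ord0)) Ux.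
rewrite partial_sum; last by move=> de; exact: differentiableM (dV de i) (dd de).
rewrite (eq_bigr (fun de => (twisted_coef i l x * (inv_ups de l x * da de j x)
    - log_coef g i l x * (inv_ups de i x * da de j x))
    + inv_ups de i x * partial l (partial j (a de ord0)) x)).
  by rewrite big_split sumrB -!mulr_sumr.
move=> de _; rewrite (partialM _ (dV de i) (dd de)) partial_inv_ups//.
move: (log_coef g i l x) (twisted_coef i l x) (inv_ups de l x) (inv_ups de i x).
by move: (partial _ _ x) (partial _ _ x) => *; ring.
Qed.

Lemma partial_flux_coef_offdiag i j l x : U x -> i != l -> l != j ->
  partial l (flux_coef i j) x =
  twisted_coef i l x * flux_coef l j x - log_coef g i l x * flux_coef i j x
  + (log_coef g l j x * flux_coef i l x + log_coef g j l x * flux_coef i j x).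
Proof.
move=> Ux il lj; rewrite partial_flux_coef//; congr (_ + _).
rewrite /flux_coef !mulr_sumr -big_split; apply: eq_bigr => de _.
rewrite (hessian_offdiag g0 Ux lj); last by rewrite w_a// (negbTE lj).
by rewrite [RHS]/= mulrDr; congr (_ + _); exact: mulrCA.
Qed.

(** The pure second derivatives of the densities are eliminated by the diagonal Hessian, and this is
    how the velocities [w] enter the curvature. *)
Lemma partial_flux_coef_diag i j x : U x -> i != j -> partial j (flux_coef i j) x =
  twisted_coef i j x * flux_coef j j x - log_coef g i j x * flux_coef i j x
  + (g j x * (\sum_de inv_ups de i x * w de j x)
     - g j x * (\sum_k log_coef g j k x * flux_coef i k x / g k x)
     + 2 * log_coef g j j x * flux_coef i j x).
Proof.
move=> Ux ij; rewrite partial_flux_coef//; congr (_ + _).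
have -> : \sum_k log_coef g j k x * flux_coef i k x / g k x =
    \sum_de inv_ups de i x * \sum_k log_coef g j k x * da de k x / g k x.
  rewrite (eq_bigr _ (fun de _ => mulr_sumr _ _ _ _)) exchange_big.
  apply: eq_bigr => k _; rewrite /flux_coef mulr_sumr mulr_suml.
  by apply: eq_bigr => de _; rewrite [log_coef g j k x * _]mulrCA -!mulrA.
rewrite /flux_coef !mulr_sumr -sumrB -big_split; apply: eq_bigr => de _.
rewrite (hessian_diag g0)// w_a// eqxx [RHS]/=.
by move: (\sum_k _) => S; ring.
Qed.

(** Flatness expresses the derivative of gamma_ij in the third direction, and the vanishing
    off-diagonal Hessians of the densities do the same for b_ij. With the derivatives of q_i and q_j
    inserted, only a rational identity remains. *)
Lemma recip_mixed i j l x : U x -> i != j -> l != i -> l != j ->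
  mixed_curvature g' i j l x = 0.
Proof.
have scalar (qi qj ql gij gjl gil glj bij bil blj dgij dbij : R) :
    qi != 0 -> qj != 0 -> ql != 0 ->
    dgij = gij * gjl + gil * glj - gij * gil ->
    dbij = (gil - bil) * blj - gil * bij + (glj * bil + gjl * bij) ->
    forall ljl dqi dqj : R, dqj = ljl * ql - gjl * qj -> dqi = (gil - bil) * ql - gil * qi ->
    (qj / qi * (dgij - dbij) + (qj * (- dqi / qi ^+ 2) + dqj * qi^-1) * (gij - bij))
    - qj / qi * (gij - bij) * (ql / qj * ljl)
    - ql / qi * (gil - bil) * (qj / ql * (glj - blj))
    + qj / qi * (gij - bij) * (ql / qi * (gil - bil)) = 0.
  by move=> qi0 qj0 ql0 -> -> ljl dqi dqj -> ->; field; rewrite qi0 qj0 ql0.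
move=> Ux ij li lj; have il : i != l by rewrite eq_sym.
have jl : j != l by rewrite eq_sym.
have dL i' j' := smooth_on_differentiable (smooth_christoffel oU sg g0 i' i' j') Ux.
have dB i' j' := smooth_on_differentiable (smooth_flux_coef i' j') Ux.
have dq i' := smooth_on_differentiable (smooth_recip_factor i') Ux.
have dV := differentiableV (dq i) (q0 i Ux).
have flat : partial l (log_coef g i j) x = log_coef g i j x * log_coef g j l x
    + log_coef g i l x * log_coef g l j x - log_coef g i j x * log_coef g i l x.
  have /eqP := flat_g i j i l Ux; rewrite curvature_mixed// oppr_eq0 mulf_eq0.
  rewrite invr_eq0 (negbTE (g0 j Ux)) /mixed_curvature /= => /eqP.
  move: (partial _ _ _) (_ * _) (_ * _) (_ * _) => *; apply/eqP.
  by rewrite -subr_eq0; apply/eqP; lra.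
rewrite /mixed_curvature (eq_partial l oU (fun z Uz => recip_log_coef_offdiag Uz ij) Ux).
rewrite (partialM _ (differentiableM (dq j) dV) (differentiableB (dL i j) (dB i j))).
rewrite (partialM _ (dq j) dV) partialV ?q0// (partialB _ (dL i j) (dB i j)).
rewrite !recip_log_coef_offdiag//.
exact: scalar (q0 i Ux) (q0 j Ux) (q0 l Ux) flat (partial_flux_coef_offdiag Ux il lj) _ _ _
  (partial_recip_factor Ux jl) (partial_recip_factor Ux il).
Qed.

(** The factor q_j / q_i brings in the derivative of q_j along its own coordinate, for which no
    equation is available; it cancels against the same derivative inside [log_coef] of the new
    metric at (j, j). The square cancels too, and the term becomes linear in lambda and its
    derivative. *)
Lemma recip_normal_term i j x : U x -> i != j ->
  (partial j (log_coef g' i j) x + log_coef g' i j x ^+ 2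
     - log_coef g' i j x * log_coef g' j j x) / g' j x =
  (partial j (log_coef g i j) x - partial j (flux_coef i j) x
     + log_coef g i j x * twisted_coef i j x
     - log_coef g j j x * twisted_coef i j x) / g j x / (q i x * q j x).
Proof.
have scalar (qi qj gj l gij gjj dl dqi dqj : R) : qi != 0 -> qj != 0 -> gj != 0 ->
    dqi = l * qj - gij * qi ->
    (qj / qi * dl + (qj * (- dqi / qi ^+ 2) + dqj * qi^-1) * l + (qj / qi * l) ^+ 2
     - qj / qi * l * (gjj + dqj / qj)) / (gj * qj ^+ 2) =
    (dl + gij * l - gjj * l) / gj / (qi * qj).
  by move=> qi0 qj0 gj0 ->; field; rewrite qi0 qj0 gj0.
move=> Ux ij.
have dL i' j' := smooth_on_differentiable (smooth_christoffel oU sg g0 i' i' j') Ux.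
have dB i' j' := smooth_on_differentiable (smooth_flux_coef i' j') Ux.
have dq i' := smooth_on_differentiable (smooth_recip_factor i') Ux.
have dV := differentiableV (dq i) (q0 i Ux).
rewrite (eq_partial j oU (fun z Uz => recip_log_coef_offdiag Uz ij) Ux).
rewrite (partialM _ (differentiableM (dq j) dV) (differentiableB (dL i j) (dB i j))).
rewrite (partialM _ (dq j) dV) partialV ?q0// (partialB _ (dL i j) (dB i j)).
rewrite recip_log_coef_offdiag// (recip_log_coef j j Ux).
exact: scalar (q0 i Ux) (q0 j Ux) (g0 j Ux) (partial_recip_factor Ux ij).
Qed.

Definition mixed_sum i j x := \sum_de inv_ups de i x * w de j x.

(** The sums of gamma times b over the indices other than [i] and [j] occur twice with opposite
    signs: in the expansion of lambda_im lambda_jm and in the diagonal derivatives of b. Only the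
    part quadratic in b survives and is completed to a sum over all indices. *)
Lemma recip_sectional_flux i j x : U x -> i != j ->
  curvature g' i j i j x = (mixed_sum i j x + mixed_sum j i x
    - \sum_m flux_coef i m x * flux_coef j m x / g m x) / (q i x * q j x).
Proof.
have scalar (Tt Tg Ta Tb Tq gi gj gij gji gii gjj bij bji bii bjj Sij Sji dgij dgji dbij dbji : R) :
    gi != 0 -> gj != 0 -> Tt = Tg - Ta - Tb + Tq ->
    - Tg - (dgij + gij ^+ 2 - gij * gjj) / gj - (dgji + gji ^+ 2 - gji * gii) / gi = 0 ->
    dbij = (gij - bij) * bjj - gij * bij
      + (gj * Sij - gj * (gji * bii / gi + (gjj * bij / gj + Tb)) + 2 * gjj * bij) ->
    dbji = (gji - bji) * bii - gji * bji
      + (gi * Sji - gi * (gii * bji / gi + (gij * bjj / gj + Ta)) + 2 * gii * bji) ->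
    - Tt - (dgij - dbij + gij * (gij - bij) - gjj * (gij - bij)) / gj
      - (dgji - dbji + gji * (gji - bji) - gii * (gji - bji)) / gi =
    Sij + Sji - (bii * bji / gi + (bij * bjj / gj + Tq)).
  move=> gi0 gj0 -> /eqP; rewrite -addrA -addrA addr_eq0 eqr_opp => /eqP -> -> ->.
  by field; rewrite gi0 gj0.
move=> Ux ij; have ji : j != i by rewrite eq_sym.
have gi0 := g0 i Ux; have gj0 := g0 j Ux.
pose P m := (m != i) && (m != j).
have rest : \sum_(m | P m) log_coef g' i m x * log_coef g' j m x / g' m x =
    (\sum_(m | P m) twisted_coef i m x * twisted_coef j m x / g m x) / (q i x * q j x).
  have scalar2 (qi qj qm l1 l2 gm : R) : qi != 0 -> qj != 0 -> qm != 0 -> gm != 0 ->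
      qm / qi * l1 * (qm / qj * l2) / (gm * qm ^+ 2) = l1 * l2 / gm / (qi * qj).
    by move=> h1 h2 h3 h4; field; rewrite h1 h2 h3 h4.
  rewrite mulr_suml; apply: eq_bigr => m /andP[mi mj].
  rewrite !recip_log_coef_offdiag//; [|by rewrite eq_sym|by rewrite eq_sym].
  exact: scalar2 (q0 i Ux) (q0 j Ux) (q0 m Ux) (g0 m Ux).
have twist : \sum_(m | P m) twisted_coef i m x * twisted_coef j m x / g m x =
    \sum_(m | P m) log_coef g i m x * log_coef g j m x / g m x
    - \sum_(m | P m) log_coef g i m x * flux_coef j m x / g m x
    - \sum_(m | P m) log_coef g j m x * flux_coef i m x / g m x
    + \sum_(m | P m) flux_coef i m x * flux_coef j m x / g m x.
  rewrite -!sumrB -big_split; apply: eq_bigr => m _; rewrite /twisted_coef /=.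
  move: (log_coef _ _ _ _) (log_coef _ _ _ _) (flux_coef _ _ _) (flux_coef _ _ _) => *; ring.
have flat := flat_g i j i j Ux; rewrite (sectional_curvature oU sg g0 Ux ij) in flat.
have dij := partial_flux_coef_diag Ux ij; rewrite (sum_split2 _ ij) in dij.
have dji := partial_flux_coef_diag Ux ji; rewrite (sum_split2 _ ij) in dji.
rewrite (sectional_curvature oU smooth_recip_metric recip_metric_neq0 Ux ij).
rewrite (recip_normal_term Ux ij) (recip_normal_term Ux ji) rest [q j x * q i x]mulrC.
rewrite -mulNr -!mulrBl; congr (_ / _); rewrite [X in _ = _ - X](sum_split2 _ ij).
exact: scalar gi0 gj0 twist flat dij dji.
Qed.

(** The normalization replaces the quadratic sum in b by a double sum of V^i V^j against c plus its
    transpose. One half completes w^j to W^j next to V^i, the other completes w^i to W^i next to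
    V^j. *)
Lemma recip_sectional i j x : U x -> i != j -> curvature g' i j i j x =
  \sum_be (recip_ups ups a be i x * recip_w ups w a c be j x
          + recip_ups ups a be j x * recip_w ups w a c be i x).
Proof.
move=> Ux ij; rewrite recip_sectional_flux//.
have qi0 := q0 i Ux; have qj0 := q0 j Ux.
have -> : \sum_m flux_coef i m x * flux_coef j m x / g m x =
    \sum_be \sum_de inv_ups be i x * inv_ups de j x * (c be de x + c de be x).
  rewrite (eq_bigr (fun m => \sum_be \sum_de inv_ups be i x * inv_ups de j x *
     ((g m x)^-1 * da be m x * da de m x))).
    rewrite exchange_big; apply: eq_bigr => be _; rewrite exchange_big.
    apply: eq_bigr => de _; rewrite norm_c//; exact: esym (mulr_sumr _ _ _ _).
  move=> m _; rewrite /flux_coef mulr_suml mulr_suml; apply: eq_bigr => be _.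
  rewrite mulr_sumr mulr_suml; apply: eq_bigr => de _.
  by move: (partial _ _ _) (partial _ _ _) => *; ring.
rewrite [RHS](eq_bigr (fun be => (inv_ups be i x * inv_w be j x + inv_ups be j x * inv_w be i x)
    / (q i x * q j x))); last first.
  move=> be _; rewrite !recip_wE -[recip_ups _ _ _ i x]/(inv_ups be i x / q i x).
  rewrite -[recip_ups _ _ _ j x]/(inv_ups be j x / q j x).
  move: (inv_ups _ _ _) (inv_ups _ _ _) (inv_w _ _ _) (inv_w _ _ _) (q i x) (q j x) qi0 qj0.
  by move=> ? ? ? ? ? ? h1 h2; field; rewrite h1 h2.
rewrite -mulr_suml; congr (_ / _); rewrite /inv_w /mixed_sum.
have e1 : \sum_be \sum_de inv_ups be i x * inv_ups de j x * c be de x =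
    \sum_be inv_ups be j x * \sum_de c de be x * inv_ups de i x.
  rewrite exchange_big; apply: eq_bigr => be _; rewrite mulr_sumr.
  by apply: eq_bigr => de _; rewrite [_ * inv_ups be j x]mulrC -mulrA [c _ _ _ * _]mulrC.
have e2 : \sum_be \sum_de inv_ups be i x * inv_ups de j x * c de be x =
    \sum_be inv_ups be i x * \sum_de c de be x * inv_ups de j x.
  apply: eq_bigr => be _; rewrite mulr_sumr.
  by apply: eq_bigr => de _; rewrite -mulrA [c _ _ _ * _]mulrC.
have -> : \sum_be \sum_de inv_ups be i x * inv_ups de j x * (c be de x + c de be x) =
    \sum_be inv_ups be j x * (\sum_de c de be x * inv_ups de i x)
    + \sum_be inv_ups be i x * (\sum_de c de be x * inv_ups de j x).
  rewrite -e1 -e2 -big_split; apply: eq_bigr => be _; rewrite -big_split.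
  by apply: eq_bigr => de _; rewrite mulrDr.
rewrite -big_split -big_split -sumrB; apply: eq_bigr => be _ /=.
by move: (\sum_de _) (\sum_de _) => *; ring.
Qed.

End ReciprocalCoefficients.

Theorem theorem4 (R : realType) (n N : nat) (U : set 'rV[R]_n)
  (g : 'I_n -> 'rV[R]_n -> R)
  (ups : 'I_N.+1 -> 'I_n -> 'rV[R]_n -> R)
  (h : 'I_N.+1 -> 'rV[R]_n -> R)
  (a : 'I_N.+1 -> 'I_N.+1 -> 'rV[R]_n -> R)
  (w : 'I_N.+1 -> 'I_n -> 'rV[R]_n -> R)
  (c : 'I_N.+1 -> 'I_N.+1 -> 'rV[R]_n -> R)
  (openU : open U)
  (* flat diagonal metric *)
  (smooth_g : forall i, smooth_on U (g i))
  (nondeg_g : forall i x, U x -> g i x != 0)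
  (flat_g : forall i j k l x, U x -> curvature g i j k l x = 0)
  (* commuting Hamiltonian diagonal systems *)
  (ups1 : forall i x, U x -> ups ord0 i x = 1)
  (commute_ups : forall al be, commuting_flows U (ups al) (ups be))
  (smooth_h : forall be, smooth_on U (h be))
  (ups_h : forall be i j x, U x ->
     hessian g i j (h be) x = if i == j then ups be i x else 0)
  (* conserved densities and fluxes *)
  (smooth_a : forall ga be, smooth_on U (a ga be))
  (flux_a : forall ga be i x, U x ->
     partial i (a ga be) x = ups be i x * partial i (a ga ord0) x)
  (inv_a : forall x, U x -> flux_matrix a x \in unitmx)
  (factor_neq0 : forall i x, U x -> recip_factor ups a i x != 0)
  (* flows generated by the densities a^gamma_1, and their fluxes *)
  (w_a : forall ga i j x, U x ->
     hessian g i j (a ga ord0) x = if i == j then w ga i x else 0)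
  (commute_w : forall ga be, commuting_flows U (w ga) (ups be))
  (smooth_c : forall ga be, smooth_on U (c ga be))
  (flux_c : forall ga be i x, U x ->
     partial i (c ga be) x = w be i x * partial i (a ga ord0) x)
  (norm_c : forall be ga x, U x ->
     c be ga x + c ga be x
     = \sum_(k < n) (g k x)^-1 * partial k (a be ord0) x
                    * partial k (a ga ord0) x) :
  let g' := recip_metric g ups a in
  let ups' := recip_ups ups a in
  let w' := recip_w ups w a c in
  [/\ forall i j x, U x -> i != j ->
        curvature g' i j i j x
        = \sum_be (ups' be i x * w' be j x + ups' be j x * w' be i x),
      forall i j k l x, U x ->
        (i, j) != (k, l) -> (i, j) != (l, k) -> curvature g' i j k l x = 0 &
      hamiltonian U (fun (r xi : R -> 'rV[R]_n) (x : R) =>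
        local_op g' r xi x
        + \sum_be tail_op (ups' be) (w' be) r xi x
        + \sum_be tail_op (w' be) (ups' be) r xi x)].
Proof.
move=> g' ups' w'.
have smooth_ups be i : smooth_on U (ups be i).
  by apply: (smooth_eigenvalue openU smooth_g nondeg_g (smooth_h be)) => ? ? *; exact: ups_h.
have smooth_w be i : smooth_on U (w be i).
  by apply: (smooth_eigenvalue openU smooth_g nondeg_g (smooth_a be ord0)) => ? ? *; exact: w_a.
have codazzi_ups be i j x (Ux : U x) (ij : i != j) :
    partial j (ups be i) x = (ups be j x - ups be i x) * log_coef g i j x.
  apply: (flat_codazzi openU smooth_g nondeg_g flat_g (smooth_h be)) => // *; exact: ups_h.
have codazzi_w be i j x (Ux : U x) (ij : i != j) :
    partial j (w be i) x = (w be j x - w be i x) * log_coef g i j x.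
  apply: (flat_codazzi openU smooth_g nondeg_g flat_g (smooth_a be ord0)) => // *; exact: w_a.
have sg' : forall i, smooth_on U (g' i).
  by move=> i; apply: (smooth_recip_metric openU smooth_g smooth_ups smooth_a inv_a).
have g'0 : forall i x, U x -> g' i x != 0.
  by move=> i x Ux; apply: (recip_metric_neq0 nondeg_g factor_neq0).
have sectional i j x (Ux : U x) (ij : i != j) : curvature g' i j i j x
    = \sum_be (ups' be i x * w' be j x + ups' be j x * w' be i x).
  by apply: (recip_sectional openU smooth_g nondeg_g flat_g smooth_ups codazzi_ups smooth_a flux_a
    inv_a factor_neq0 w_a norm_c).
have vanish i j k l x (Ux : U x) : (i, j) != (k, l) -> (i, j) != (l, k) ->
    curvature g' i j k l x = 0.
  apply: (curvature_vanish openU sg' g'0 Ux) => i' j' l' *.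
  by apply: (recip_mixed openU smooth_g nondeg_g flat_g smooth_ups codazzi_ups smooth_a flux_a
    inv_a factor_neq0 w_a).
split=> //.
(* Each index carries two tails, told apart by the boolean; negating it exchanges the two factors,
   so the products of [p t] and [p (s t)] sum to the symmetric expression of the sectional
   curvature. *)
pose p (t : 'I_N.+1 * bool) := if t.2 then w' t.1 else ups' t.1.
pose s (t : 'I_N.+1 * bool) := (t.1, ~~ t.2).
have sum_pair (V : zmodType) (F : 'I_N.+1 * bool -> V) :
    \sum_t F t = \sum_be F (be, false) + \sum_be F (be, true).
  transitivity (\sum_be \sum_b F (be, b)).
    by rewrite pair_bigA; apply: eq_bigr => -[].
  by rewrite -big_split; apply: eq_bigr => be _ /=; rewrite big_bool addrC.
rewrite (_ : (fun r xi x => _) = nonlocal_op g' s p); last first.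
  by apply/funext => r; apply/funext => xi; apply/funext => x; rewrite /nonlocal_op sum_pair addrA.
have gauss i j x : \sum_t p t i x * p (s t) j x
    = \sum_be (ups' be i x * w' be j x + ups' be j x * w' be i x).
  rewrite sum_pair -big_split; apply: eq_bigr => be _ /=.
  by rewrite [w' be i x * _]mulrC.
apply: nonlocal_op_hamiltonian => //.
- by move=> [be b]; rewrite /s /= negbK.
- move=> [be []] i.
    exact: (smooth_recip_w openU smooth_ups smooth_a inv_a factor_neq0 smooth_w smooth_c be i).
  exact: (smooth_recip_ups openU smooth_ups smooth_a inv_a factor_neq0 be i).
- move=> [be []] i j x Ux ij.
    exact: (recip_w_codazzi openU smooth_g nondeg_g smooth_ups codazzi_ups smooth_a flux_a inv_a
      factor_neq0 smooth_w codazzi_w smooth_c flux_c be Ux ij).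
  exact: (recip_ups_codazzi openU smooth_g nondeg_g smooth_ups codazzi_ups smooth_a flux_a inv_a
    factor_neq0 be Ux ij).
move=> i j k l x Ux; rewrite gauss.
have [ij|ij] := eqVneq i j.
  have half (y : R) : y = - y -> y = 0 by lra.
  rewrite ij [(j == l) && _]andbC subrr mul0r; apply: half.
  exact: curvature_antisym_l openU sg' g'0 _ _ _ _ _ Ux.
have [[ik jl]|ijkl] := @eqP _ (i, j) (k, l).
  by rewrite -ik -jl !eqxx (negbTE ij) subr0 mul1r; exact: sectional.
have [[il jk]|ijlk] := @eqP _ (i, j) (l, k).
  rewrite -il -jk !eqxx (negbTE ij) sub0r mulN1r curvature_antisym_r.
  by congr (- _); exact: sectional.
move/eqP: ijkl => ijkl; move/eqP: ijlk => ijlk.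
rewrite (vanish _ _ _ _ _ Ux ijkl ijlk); move: ijkl ijlk; rewrite !xpair_eqE => /negbTE -> /negbTE ->.
by rewrite subrr mul0r.
Qed.
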